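(* On a metric projective structure $(M,\mathbf m)$ of dimension $n\ge2$ with Weyl nullity almost everywhere (i.e. on an open dense set) and $B$ smooth, the solutions $\sigma^{bc}\in\Gamma(S^2TM(-2))$ of the metrisability equation $\operatorname{trace-free}(\nabla_a\sigma^{bc})=0$ are in one-to-one correspondence with solutions $(\sigma^{bc},\mu^b,\rho')\in\Gamma(S^2\mathcal T)$ of the following system, written in the scale of a metric $g\in\mathbf m$ with Levi-Civita connection $\nabla$ and $B=B^g$ (the solution $\sigma^{bc}$ being the first component): $$\nabla^{\mathcal T_1}_a\begin{pmatrix}\sigma^{bc}\\ \mu^b\\ \rho'\end{pmatrix}+\frac1{n-1}\begin{pmatrix}0\\ 0\\ \sigma^{bc}(g_{ab}\nabla_cB-g_{bc}\nabla_aB)\end{pmatrix}=0 .$$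
   Context: Manifolds are smooth and connected; metrics have arbitrary signature; indices are abstract. Two metrics are projectively equivalent if they have the same geodesics up to reparametrisation; a metric projective structure $\mathbf m$ is an equivalence class of projectively equivalent metrics. For the Levi-Civita connection $\nabla$ of $g$: $[\nabla_\ell,\nabla_k]v^j=R^j{}_{i\ell k}v^i$, $R_{jk}=R^a{}_{jak}$, $\mathsf P_{jk}=\frac1{n-1}R_{jk}$, $\mathsf P^i{}_j=g^{ik}\mathsf P_{kj}$. The projective Weyl tensor $W^i{}_{jk\ell}=R^i{}_{jk\ell}+\delta^i_\ell\mathsf P_{jk}-\delta^i_k\mathsf P_{j\ell}$ is the same for all $g\in\mathbf m$. There is Weyl nullity at $x$ if there is $0\ne v\in T_xM$ with $W^i{}_{jk\ell}v^j=0$ at $x$. Then each $g\in\mathbf m$ determines $B=B^g$ by $\mathsf P^i{}_jv^j=Bv^i$ for all $v$ in the nullity (independent of $v$). $\mathcal E(1)$ is the positive $(2n+2)$-nd root of $(\Lambda^nTM)^2$, $\mathcal E(w)$ its real powers, $\mathcal B(w)=\mathcal B\otimes\mathcal E(w)$. The metrisability equation is equivalent to the existence of $\mu^b$ with $\nabla_a\sigma^{bc}+\delta^b_a\mu^c+\delta^c_a\mu^b=0$ and does not depend on the choice of $g\in\mathbf m$. The tractor bundle $\mathcal T$ is the dual of $J^1\mathcal E(1)$. A choice of $g\in\mathbf m$ splits $\mathcal T\cong TM(-1)\oplus\mathcal E(-1)$, sections being $(\nu^b,\rho)$, and correspondingly $S^2\mathcal T\cong S^2TM(-2)\oplus TM(-2)\oplus\mathcal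 E(-2)$, the square of $(\nu^b,\rho)$ having components $(\nu^b\nu^c,\rho\nu^b,\rho^2)$. In this splitting $$\nabla^{\mathcal T_1}_a\begin{pmatrix}\sigma^{bc}\\ \mu^b\\ \rho\end{pmatrix}=\begin{pmatrix}\nabla_a\sigma^{bc}+\delta^b_a\mu^c+\delta^c_a\mu^b\\ \nabla_a\mu^b+\delta^b_a\rho-Bg_{ac}\sigma^{bc}\\ \nabla_a\rho-2Bg_{ab}\mu^b\end{pmatrix}.$$ *)

(* Defs.v *)
From HB Require Import structures.
From mathcomp Require Import all_boot all_order all_algebra.
From mathcomp Require Import all_classical all_reals all_analysis.
Set Implicit Arguments.
Unset Strict Implicit.
Unset Printing Implicit Defensive.
Import Order.TTheory GRing.Theory Num.Theory.
Import numFieldNormedType.Exports.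
Local Open Scope classical_set_scope.
Local Open Scope ring_scope.

Section Smoothness.
Variables (R : realType) (n : nat).
Implicit Types (f : 'rV[R]_n -> R) (U : set 'rV[R]_n).

Definition pd f (a : 'I_n) (p : 'rV[R]_n) : R := 'D_(delta_mx 0 a) f p.

Definition pds (s : seq 'I_n) f : 'rV[R]_n -> R :=
  foldr (fun a h => pd h a) f s.

(* C^oo on the open set U: the iterated partial derivatives of all orders
   exist and are (Frechet) differentiable, hence continuous, on U. *)
Definition smooth_on U f : Prop :=
  forall (s : seq 'I_n) p, U p -> differentiable (pds s f) p.

Definition smooth_on_R (I : set R) (f : R -> R) : Prop :=
  forall (k : nat) t, I t -> derivable (derive1n k f) t 1.

End Smoothness.

(* A smooth connected manifold with a smooth atlas indexed by [chart].  The
   chart i is the homeomorphism [coord i] from the open set [dom i] onto the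
   open set [cod i], with inverse [param i]; both are total functions whose
   values off [dom i], resp. [cod i], are irrelevant. *)
Record manifold (R : realType) (n : nat) := Manifold {
  carrier :> topologicalType;
  carrier_hausdorff : hausdorff_space carrier;
  carrier_second_countable : @second_countable carrier;
  carrier_connected : connected [set: carrier];
  chart : Type;
  dom : chart -> set carrier;
  cod : chart -> set 'rV[R]_n;
  coord : chart -> carrier -> 'rV[R]_n;
  param : chart -> 'rV[R]_n -> carrier;
  dom_open : forall i, open (dom i);
  cod_open : forall i, open (cod i);
  dom_cover : forall x, exists i, dom i x;
  coord_cod : forall i x, dom i x -> cod i (coord i x);
  param_dom : forall i p, cod i p -> dom i (param i p);
  coordK : forall i x, dom i x -> param i (coord i x) = x;
  paramK : forall i p, cod i p -> coord i (param i p) = p;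
  coord_continuous : forall i x, dom i x -> {for x, continuous (coord i)};
  param_continuous : forall i p, cod i p -> {for p, continuous (param i)};
  trans_smooth : forall i j a,
    smooth_on [set p | cod i p /\ dom j (param i p)]
              (fun p => coord j (param i p) 0 a)
}.

Section Bundles.
Variables (R : realType) (n : nat) (M : manifold R n).
Implicit Types (i j : chart M) (p : 'rV[R]_n).

Definition overlap i j : set 'rV[R]_n :=
  [set p | cod i p /\ dom j (param i p)].

Definition trans i j p : 'rV[R]_n := coord j (param i p).

(* jac i j p b a = d y^b / d x^a, with x the chart i and y the chart j. *)
Definition jac i j p : 'M[R]_n :=
  \matrix_(b, a) pd (fun q => trans i j q 0 b) a p.

(* Components in each chart of a field with values in matrices; by convention
   a section has components 0 off [cod i], so that equal sections are equal as
   functions. *)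
Definition field (k l : nat) := chart M -> 'rV[R]_n -> 'M[R]_(k, l).

(* L i j p transforms components in chart i at p to components in chart j. *)
Definition is_section k l
    (L : chart M -> chart M -> 'rV[R]_n -> 'M[R]_(k, l) -> 'M[R]_(k, l))
    (s : field k l) : Prop :=
  [/\ forall i p, ~ cod i p -> s i p = 0,
      forall i a b, smooth_on (cod i) (fun p => s i p a b) &
      forall i j p, overlap i j p -> s j (trans i j p) = L i j p (s i p)].

Definition symmetric_field k (s : field k k) : Prop :=
  forall i p, (s i p)^T = s i p.

Definition smooth_function (f : M -> R) : Prop :=
  forall i, smooth_on (cod i) (f \o param i).

(* (Lambda^n TM)^2 transforms by (det jac)^2, and E(1) is its positive
   (2n+2)-nd root. *)
Definition dens (w : R) i j p : R := `|\det (jac i j p)| `^ (w / n.+1%:R).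

Definition is_metric (g : field n n) : Prop :=
  [/\ is_section (fun i j p h =>
        (invmx (jac i j p))^T *m h *m invmx (jac i j p)) g,
      symmetric_field g &
      forall i p, cod i p -> g i p \in unitmx].

Definition is_S2TM_m2 (s : field n n) : Prop :=
  is_section (fun i j p h =>
    dens (- 2) i j p *: (jac i j p *m h *m (jac i j p)^T)) s
  /\ symmetric_field s.

(* Change of the 1-jet (f, df) of a section of E(1) from chart i to chart j:
   f_j = dens 1 * f_i, differentiated with respect to the coordinates of j. *)
Definition jet_trans i j p : 'M[R]_(1 + n) :=
  block_mx (dens 1 i j p)%:M 0
    ((invmx (jac i j p))^T *m \col_a pd (dens 1 i j) a p)
    (dens 1 i j p *: (invmx (jac i j p))^T).

(* S^2 T, with T the dual of J^1 E(1), as symmetric bilinear forms on J^1 E(1)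
   with matrices in the frames (f, df). *)
Definition is_S2T (t : field (1 + n) (1 + n)) : Prop :=
  is_section (fun i j p h =>
    (invmx (jet_trans i j p))^T *m h *m invmx (jet_trans i j p)) t
  /\ symmetric_field t.

End Bundles.

(* Geometry in one chart of a metric with component functions G. *)
Section LocalGeometry.
Variables (R : realType) (n : nat) (G : 'rV[R]_n -> 'M[R]_n).
Implicit Types (a b c d i j k l : 'I_n) (p : 'rV[R]_n).

Definition ginv p : 'M[R]_n := invmx (G p).

(* christoffel c a b = Gamma^c_{ab} *)
Definition christoffel c a b p : R :=
  2^-1 * \sum_d ginv p c d *
    (pd (fun q => G q b d) a p + pd (fun q => G q a d) b p
     - pd (fun q => G q a b) d p).

Definition christoffel_trace a p : R := \sum_b christoffel b a b p.

(* riemann j i l k = R^j_{i l k}, the components of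
   [nabla_l, nabla_k] v^j = R^j_{i l k} v^i. *)
Definition riemann j i l k p : R :=
  pd (christoffel j k i) l p - pd (christoffel j l i) k p
  + \sum_m (christoffel j l m p * christoffel m k i p
            - christoffel j k m p * christoffel m l i p).

Definition ricci j k p : R := \sum_a riemann a j a k p.

Definition schouten j k p : R := (n%:R - 1)^-1 * ricci j k p.

(* P^i_j = g^{ik} P_{kj} *)
Definition schouten_up i j p : R := \sum_k ginv p i k * schouten k j p.

(* weyl i j k l = W^i_{jkl} *)
Definition weyl i j k l p : R :=
  riemann i j k l p + (i == l)%:R * schouten j k p
  - (i == k)%:R * schouten j l p.

Definition in_nullity p (v : 'cV[R]_n) : Prop :=
  v != 0 /\ forall i k l, \sum_j weyl i j k l p * v j 0 = 0.

(* The Levi-Civita connection on E(w), TM(w) and S^2 TM(w); on Lambda^n TM,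
   identified with E(n+1) up to sign, it acts by d_a + Gamma^b_{ab}. *)
Definition nabla_E (w : R) (f : 'rV[R]_n -> R) a p : R :=
  pd f a p + w / n.+1%:R * christoffel_trace a p * f p.

Definition nabla_T (w : R) (m : 'rV[R]_n -> 'cV[R]_n) a b p : R :=
  nabla_E w (fun q => m q b 0) a p + \sum_d christoffel b a d p * m p d 0.

Definition nabla_S2T (w : R) (s : 'rV[R]_n -> 'M[R]_n) a b c p : R :=
  nabla_E w (fun q => s q b c) a p
  + \sum_d christoffel b a d p * s p d c
  + \sum_d christoffel c a d p * s p b d.

(* Trace-free part of T_a^{bc} symmetric in b, c. *)
Definition tracefree (T : 'I_n -> 'I_n -> 'I_n -> R) a b c : R :=
  T a b c - n.+1%:R^-1 * ((a == b)%:R * \sum_d T d d c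
                          + (a == c)%:R * \sum_d T d b d).

(* The matrix of (f, df) |-> (f, nabla f) on J^1 E(1). *)
Definition scale_mx p : 'M[R]_(1 + n) :=
  block_mx 1%:M 0 (n.+1%:R^-1 *: \col_a christoffel_trace a p) 1%:M.

(* The splitting of S^2 T by the metric: (nu, rho) in T pairs with the jet of
   f as nu^a nabla_a f + rho f, so the form t on jets has, with respect to
   (f, nabla f), the matrix
     ( rho  mu^T  )
     ( mu   sigma ). *)
Definition split_mx (t : 'rV[R]_n -> 'M[R]_(1 + n)) p : 'M[R]_(1 + n) :=
  (invmx (scale_mx p))^T *m t p *m invmx (scale_mx p).

Definition sigma_part t p : 'M[R]_n := drsubmx (split_mx t p).
Definition mu_part t p : 'cV[R]_n := dlsubmx (split_mx t p).
Definition rho_part t p : R := ulsubmx (split_mx t p) 0 0.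

Section TractorConnection.
Variable B : 'rV[R]_n -> R.
Variables (s : 'rV[R]_n -> 'M[R]_n) (m : 'rV[R]_n -> 'cV[R]_n)
          (r : 'rV[R]_n -> R).

Definition nablaT1_sigma a b c p : R :=
  nabla_S2T (- 2) s a b c p + (a == b)%:R * m p c 0 + (a == c)%:R * m p b 0.

Definition nablaT1_mu a b p : R :=
  nabla_T (- 2) m a b p + (a == b)%:R * r p
  - \sum_c B p * G p a c * s p b c.

Definition nablaT1_rho a p : R :=
  nabla_E (- 2) r a p - 2 * B p * \sum_b G p a b * m p b 0.

Definition system_at p : Prop :=
  [/\ forall a b c, nablaT1_sigma a b c p = 0,
      forall a b, nablaT1_mu a b p = 0 &
      forall a, nablaT1_rho a p
        + (n%:R - 1)^-1 *
          \sum_b \sum_c s p b c * (G p a b * pd B c p - G p b c * pd B a p)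
        = 0].

End TractorConnection.

End LocalGeometry.

Section Projective.
Variables (R : realType) (n : nat) (M : manifold R n).
Implicit Types (g : field M n n) (I : set R).

Definition open_interval I : Prop := open I /\ is_interval I.

(* Affinely parametrised geodesics defined on the open interval I. *)
Definition geodesic g I (c : R -> M) : Prop :=
  [/\ open_interval I,
      forall t, I t -> {for t, continuous c} &
      forall i, let x a (t : R) := coord i (c t) 0 a in
        let I_i := [set t | I t /\ dom i (c t)] in
        (forall a, smooth_on_R I_i (x a)) /\
        forall t, I_i t -> forall a,
          derive1n 2 (x a) t
          + \sum_b \sum_d christoffel (g i) a b d (coord i (c t))
              * derive1n 1 (x b) t * derive1n 1 (x d) t = 0].

Definition geodesics_reparametrise g g' : Prop :=
  forall I c, geodesic g I c ->
  exists (I' : set R) (s : R -> R),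
    [/\ open_interval I',
        smooth_on_R I' s /\ (forall t, I' t -> derive1 s t != 0),
        s @` I' = I &
        geodesic g' I' (c \o s)].

Definition projectively_equivalent g g' : Prop :=
  geodesics_reparametrise g g' /\ geodesics_reparametrise g' g.

Definition metric_projective_structure (m : set (field M n n)) : Prop :=
  exists2 g, is_metric g &
    m = [set g' | is_metric g' /\ projectively_equivalent g g'].

Definition weyl_nullity g : set M :=
  [set x | exists i, dom i x /\ exists v, in_nullity (g i) (coord i x) v].

Definition weyl_nullity_ae g : Prop :=
  exists U : set M, [/\ open U, dense U & U `<=` weyl_nullity g].

(* B = B^g: at every point with Weyl nullity, P^i_j v^j = B v^i for all v in
   the nullity; elsewhere B is determined by density and continuity. *)
Definition is_nullity_function g (B : M -> R) : Prop :=
  forall i p v, cod i p -> in_nullity (g i) p v ->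
  forall a, \sum_j schouten_up (g i) a j p * v j 0 = B (param i p) * v a 0.

Definition metrisability g (s : field M n n) : Prop :=
  forall i p, cod i p ->
  forall a b c,
    tracefree (fun a b c => nabla_S2T (g i) (- 2) (s i) a b c p) a b c = 0.

Definition prolonged_system g (B : M -> R) (t : field M (1 + n) (1 + n)) : Prop :=
  forall i p, cod i p ->
    system_at (g i) (B \o param i)
      (sigma_part (g i) (t i)) (mu_part (g i) (t i)) (rho_part (g i) (t i)) p.

Definition first_component g (t : field M (1 + n) (1 + n)) : field M n n :=
  fun i => sigma_part (g i) (t i).

End Projective.

(* Main.v *)
Require Import Defs.
From HB Require Import structures.
From mathcomp Require Import all_boot all_order all_algebra perm.
From mathcomp Require Import all_classical all_reals all_analysis.
From mathcomp Require Import ring lra.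
Set Implicit Arguments.
Unset Strict Implicit.
Unset Printing Implicit Defensive.
Import Order.TTheory GRing.Theory Num.Theory.
Import numFieldNormedType.Exports.
Local Open Scope classical_set_scope.
Local Open Scope ring_scope.

(* Let Z_ab be the curvature of g minus B (e_a e_b^T g - e_b e_a^T g); the
   condition B = B^g says that the vectors v of the Weyl nullity satisfy
   Z_ab v = 0.  For a solution sigma of the metrisability equation, commuting
   two derivatives of sigma gives, with m_a = nabla_a mu - B sigma g e_a,
       e_a . m_b - e_b . m_a = Z_ab sigma + sigma Z_ab^T     (x . y = x y^T + y x^T).
   Contracting with a nullity vector shows that m_a = - rho e_a, first where
   there is nullity and then everywhere by density.  Hence Z_ab commutes with
   S = sigma g.  Commuting two derivatives of mu gives
       Z_ab mu = tau_b e_a - tau_a e_b + b_a S e_b - b_b S e_a,   b = dB,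
   and the equation for rho is the vanishing of the trace of A_y : x |-> Z(x,y) mu.
   Applying S to this identity, and comparing with S inserted in a slot of Z,
   shows that S satisfies quadratic equations with leading coefficients b_a.  If
   b = 0 or S is scalar, then contraction with the nullity gives Z mu = 0.
   Otherwise the derivative of a quadratic equation, contracted with the nullity,
   gives A_y A_y = 0, so that the trace of A_y vanishes.  Conversely, the system
   determines mu and rho from sigma.  The components of sigma, mu, rho fit
   together across charts because nabla sigma and nabla mu are tensorial. *)

(** * Curvature tensors with a nullity vector *)

Section Algebra.
Variables (R : realFieldType) (n : nat).
Implicit Types (x y z w u v p q : 'cV[R]_n) (A G S : 'M[R]_n).

(** Nullity vectors are chosen point by point and are never differentiated. Only identities between
    smooth quantities are, after density has extended them to the whole chart. So the formula for
    m_a, the commutation of S with Z and the quadratic equations are stated on the whole chart, and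
    the nullity vector returns only at the point where the trace of A_y is computed. The obstacle is
    the gradient b. If b = 0 or S is scalar, inserting v in a slot of Z settles the matter;
    otherwise one more derivative is taken. Where some b_a is nonzero and S is not scalar, S has a
    quadratic minimal polynomial, and completing the square gives w = S - p/2 with scalar square.
    The differentiated equation then says that u . (w mu) + mu . (w u) lies in the span of g^{-1}
    and w g^{-1} for all u. As Z is skew for g and commutes with w, it kills this span, so every
    Z(x,y) mu inherits the property from mu, and pairing with g v leaves few possibilities for
    Z(x,y) mu. The factor 1/(n-1) of the system comes from the trace over x of the identity for
    Z(x,y) mu. *)

Definition dotc x y : R := (x^T *m y) 0 0.

Lemma dotcC x y : dotc x y = dotc y x.
Proof. by rewrite /dotc -[in LHS](trmxK y) -trmx_mul mxE. Qed.

Lemma dotcDl x y z : dotc (x + y) z = dotc x z + dotc y z.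
Proof. by rewrite /dotc linearD mulmxDl mxE. Qed.

Lemma dotcDr x y z : dotc z (x + y) = dotc z x + dotc z y.
Proof. by rewrite /dotc mulmxDr mxE. Qed.

Lemma dotcZl a x y : dotc (a *: x) y = a * dotc x y.
Proof. by rewrite /dotc linearZ -scalemxAl mxE. Qed.

Lemma dotcZr a x y : dotc y (a *: x) = a * dotc y x.
Proof. by rewrite /dotc -scalemxAr mxE. Qed.

Lemma dotcNl x y : dotc (- x) y = - dotc x y.
Proof. by rewrite -scaleN1r dotcZl mulN1r. Qed.

Lemma dotcNr x y : dotc y (- x) = - dotc y x.
Proof. by rewrite -scaleN1r dotcZr mulN1r. Qed.

Lemma dotc0l x : dotc 0 x = 0.
Proof. by rewrite /dotc linear0 mul0mx mxE. Qed.

Lemma dotc0r x : dotc x 0 = 0.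
Proof. by rewrite dotcC dotc0l. Qed.

Lemma dotcA A x y : dotc x (A *m y) = dotc (A^T *m x) y.
Proof. by rewrite /dotc trmx_mul trmxK mulmxA. Qed.

Lemma dotcE x y : dotc x y = \sum_i x i 0 * y i 0.
Proof. by rewrite /dotc mxE; apply: eq_bigr => i _; rewrite mxE. Qed.

Lemma outer_mul x y z : x *m y^T *m z = dotc y z *: x.
Proof.
rewrite -mulmxA [y^T *m z]mx11_scalar mul_mx_scalar.
by rewrite /dotc.
Qed.

Lemma dotc_delta x a : dotc x (delta_mx a 0) = x a 0.
Proof.
rewrite dotcE (bigD1 a) //= mxE !eqxx mulr1 big1 ?addr0 // => i /negPf ia.
by rewrite mxE ia mulr0.
Qed.

Lemma dotc_eq0 x : (forall y, dotc x y = 0) -> x = 0.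
Proof. by move=> h; apply/colP => a; rewrite -dotc_delta h mxE. Qed.

Lemma colE_sum x : x = \sum_a x a 0 *: delta_mx a 0.
Proof.
by rewrite {1}[x]matrix_sum_delta; apply: eq_bigr => a _; rewrite big_ord1.
Qed.

Lemma outerE x y a b : (x *m y^T) a b = x a 0 * y b 0.
Proof. by rewrite !mxE big_ord1 mxE. Qed.

Lemma mx_eq_vec A S : (forall x, A *m x = S *m x) -> A = S.
Proof.
move=> h; apply/matrixP => a b; have := congr1 (fun c : 'cV[R]_n => c a 0) (h (delta_mx b 0)).
by rewrite -!colE !mxE.
Qed.

(** If p_i is nonzero, the diagonal entry 2 p_i q_i gives q_i = 0, and the entries (a,i) then give q
    = 0. This is the cancellation law for symmetric products, used for uniqueness and for changes of
    charts. *)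
Lemma outer_sym_eq0 p q : p *m q^T + q *m p^T = 0 -> p = 0 \/ q = 0.
Proof.
move=> h; have [->|/eqP/cV0Pn [i p_i]] := pselect (p = 0); first by left.
right; have e a b : p a 0 * q b 0 + q a 0 * p b 0 = 0.
  have := congr1 (fun A : 'M[R]_n => A a b) h.
  by rewrite !mxE !big_ord1 !mxE.
have qi : q i 0 = 0.
  have := e i i; rewrite [q i 0 * _]mulrC -mulr2n => /eqP.
  by rewrite mulrn_eq0 /= mulf_eq0 (negPf p_i) => /eqP.
apply/colP => a; rewrite mxE; have /eqP := e a i.
by rewrite qi mulr0 add0r mulf_eq0 (negPf p_i) orbF => /eqP.
Qed.

(** In a rank factorisation A = C L the factor C is injective and L is surjective, so A A = 0 forces
    L C = 0, whose trace is that of A. *)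
Lemma sqr0_tr A : A *m A = 0 -> \tr A = 0.
Proof.
move=> h; rewrite -{1}(mulmx_base A) mxtrace_mulC.
suff -> : row_base A *m col_base A = 0 by rewrite linear0.
have e : col_base A *m (row_base A *m col_base A) *m row_base A = 0.
  by rewrite mulmxA mulmx_base -mulmxA mulmx_base.
apply: (row_free_inj (row_base_free A)); rewrite mul0mx.
have /row_freeP [L hL] : row_free (col_base A)^T.
  by rewrite /row_free mxrank_tr; exact: col_base_full.
have {}hL : L^T *m col_base A = 1%:M by rewrite -trmx1 -hL trmx_mul trmxK.
by rewrite -[LHS]mul1mx -hL -mulmxA [X in _ *m X]mulmxA e mulmx0.
Qed.

(** An algebraic curvature tensor, with [Z x y] the endomorphism R(x,y). Linearity is asked in the
    first slot only; skewness supplies the second. *)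
Record curvature_like G (Z : 'cV[R]_n -> 'cV[R]_n -> 'M[R]_n) : Prop := {
  cl_lin : forall a x x' y, Z (a *: x + x') y = a *: Z x y + Z x' y;
  cl_skew : forall x y, Z y x = - Z x y;
  cl_metric : forall x y, (Z x y)^T *m G = - (G *m Z x y);
  cl_bianchi : forall x y z, Z x y *m z + Z y z *m x + Z z x *m y = 0 }.

(** * Symmetries of algebraic curvature tensors *)

Section CurvatureLike.
Variables (G : 'M[R]_n) (Z : 'cV[R]_n -> 'cV[R]_n -> 'M[R]_n).
Hypotheses (Gsym : G^T = G) (Gunit : G \in unitmx) (cl : curvature_like G Z).

Lemma cl_lin0 y : Z 0 y = 0.
Proof.
by have := cl_lin cl (-1) 0 0 y; rewrite scaler0 add0r scaleN1r addNr.
Qed.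

Lemma cl_linZ a x y : Z (a *: x) y = a *: Z x y.
Proof. by have := cl_lin cl a x 0 y; rewrite !cl_lin0 !addr0. Qed.

Lemma cl_lin_sum (I : finType) (c : I -> R) (f : I -> 'cV[R]_n) y :
  Z (\sum_i c i *: f i) y = \sum_i c i *: Z (f i) y.
Proof.
elim/big_rec2: _ => [|i A x _ <-]; first exact: cl_lin0.
exact: (cl_lin cl).
Qed.

Definition low x y z w : R := dotc z (G *m Z x y *m w).

Lemma low_skew x y z w : low y x z w = - low x y z w.
Proof. by rewrite /low (cl_skew cl) mulmxN mulNmx dotcNr. Qed.

Lemma low_skew' x y z w : low x y w z = - low x y z w.
Proof.
rewrite /low dotcA dotcC trmx_mul Gsym (cl_metric cl).
by rewrite mulNmx dotcNr.
Qed.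

Lemma low_bianchi x y z w : low x y w z + low y z w x + low z x w y = 0.
Proof. by rewrite /low -!dotcDr -!mulmxA -!mulmxDr (cl_bianchi cl) mulmx0 dotc0r. Qed.

(** The classical exchange of pairs is a linear consequence of four Bianchi identities and the two
    skew symmetries; [lra] finds the combination once the instances are listed. *)
Lemma low_pair x y z w : low x y z w = low z w x y.
Proof.
have := low_bianchi x y w z; have := low_bianchi y z x w.
have := low_bianchi z w y x; have := low_bianchi w x z y.
have := low_skew' x y z w; have := low_skew' z w x y.
have := low_skew x z y w; have := low_skew' x z y w; have := low_skew' z x y w.
have := low_skew y w x z; have := low_skew' y w x z; have := low_skew' w y x z.
have := low_skew x w y z; have := low_skew' x w y z; have := low_skew' w x y z.
have := low_skew y z x w; have := low_skew' y z x w; have := low_skew' z y x w.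
lra.
Qed.

Lemma low_inj A x y : (forall z w, dotc z (G *m A *m w) = low x y z w) ->
  A = Z x y.
Proof.
move=> h; have e : G *m A = G *m Z x y.
  apply: mx_eq_vec => w; apply/eqP; rewrite -subr_eq0; apply/eqP.
  by apply: dotc_eq0 => z; rewrite dotcC dotcDr dotcNr h /low subrr.
by rewrite -[A](mulKmx Gunit) e mulKmx.
Qed.

(** Pair symmetry moves v from the argument of the endomorphism into a slot of Z. *)
Lemma cl_null_slot v : (forall x y, Z x y *m v = 0) -> forall y, Z v y = 0.
Proof.
move=> h y; symmetry; apply: low_inj => z w.
by rewrite low_pair low_skew' /low -!mulmxA h !(mulmx0, mul0mx) !dotc0r oppr0.
Qed.

(** Being self-adjoint and commuting with Z, S passes between the last two slots of [low] ([s]),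
    hence by pair symmetry between the first two ([sp]). Four Bianchi identities with one S inserted
    let it cross from one pair to the other. *)
Lemma cl_comm_slot S : S^T *m G = G *m S ->
  (forall x y, Z x y *m S = S *m Z x y) ->
  forall x y, Z (S *m x) y = Z x y *m S.
Proof.
move=> Ssym Sc x y; symmetry; apply: low_inj => z w; rewrite mulmxA -mulmxA.
rewrite -[LHS]/(low x y z (S *m w)).
have s (a b c d : 'cV[R]_n) : low a b c (S *m d) = low a b (S *m c) d.
  rewrite /low -[in RHS](trmxK S) -[in RHS]dotcA !mulmxA Ssym -!mulmxA.
  by rewrite ![Z _ _ *m (S *m _)]mulmxA Sc !mulmxA.
have pr := low_pair.
have sp a b c d : low a (S *m b) c d = low (S *m a) b c d by rewrite !(pr _ _ c) s.
have := low_bianchi (S *m x) y w z; have := low_bianchi (S *m y) w x z.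
have := low_bianchi (S *m w) x y z; have := low_bianchi x y w (S *m z).
rewrite -!s !sp.
have := low_skew x y z (S *m w); have := low_skew' x y z (S *m w).
have := low_skew' x y (S *m z) w; have := low_skew' y w (S *m z) x.
have := low_skew' w x (S *m z) y.
have := low_skew' (S *m x) y w z.
have := low_skew' (S *m y) w x z; have := low_skew' (S *m w) x y z.
have := s x y z w; have := s y w z x; have := s w x z y.
have := s x y w z; have := s y w x z; have := s w x y z.
lra.
Qed.

Definition sym2 x y : 'M[R]_n := x *m y^T + y *m x^T.

Lemma sym2C x y : sym2 x y = sym2 y x.
Proof. exact: addrC. Qed.

Lemma sym2Dr x y z : sym2 x (y + z) = sym2 x y + sym2 x z.
Proof. by rewrite /sym2 linearD /= mulmxDr mulmxDl addrACA. Qed.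

Lemma sym2Zr a x y : sym2 x (a *: y) = a *: sym2 x y.
Proof. by rewrite /sym2 linearZ /= -scalemxAr -scalemxAl scalerDr. Qed.

Lemma sym2_sumr (I : finType) (f : I -> 'cV[R]_n) x :
  sym2 x (\sum_i f i) = \sum_i sym2 x (f i).
Proof.
by rewrite /sym2 linear_sum /= mulmx_sumr mulmx_suml -big_split.
Qed.

Lemma sym2_act A x y :
  A *m sym2 x y + sym2 x y *m A^T = sym2 (A *m x) y + sym2 x (A *m y).
Proof.
rewrite /sym2 mulmxDr mulmxDl !trmx_mul !mulmxA.
by rewrite [X in _ + X]addrC addrACA [X in _ + X]addrC.
Qed.

Lemma sym2_mul x y z : sym2 x y *m z = dotc y z *: x + dotc x z *: y.
Proof. by rewrite mulmxDl !outer_mul. Qed.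

Lemma quad_eq0 A : A^T = A -> (forall u, dotc u (A *m u) = 0) -> A = 0.
Proof.
move=> As h; apply: mx_eq_vec => x; rewrite mul0mx; apply: dotc_eq0 => y.
have := h (x + y); rewrite mulmxDr !(dotcDl, dotcDr) !h.
have : dotc x (A *m y) = dotc (A *m x) y by rewrite dotcA As.
have : dotc y (A *m x) = dotc (A *m x) y by rewrite dotcC.
lra.
Qed.

(** * A null vector together with an operator of scalar square *)

Section NullVector.
Variables (om : 'M[R]_n) (de : R) (v mu : 'cV[R]_n).
Hypotheses (om_sym : om^T *m G = G *m om)
  (om_comm : forall x y, Z x y *m om = om *m Z x y)
  (om_sqr : om *m om = de%:M) (om_neq0 : om != 0)
  (v_neq0 : v != 0) (v_null : forall x y, Z x y *m v = 0).

(** For [p := mu] this is the differentiated quadratic equation of S after completion of the square.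
    The right-hand side ranges over tensors killed by every [Z x y], which makes the condition
    stable under Z. *)
Definition sym_closed p := forall u, exists k l : R,
  sym2 u (om *m p) + sym2 p (om *m u) = k *: invmx G + l *: (om *m invmx G).

Lemma act_inv x y :
  Z x y *m invmx G + invmx G *m (Z x y)^T = 0.
Proof.
have := congr1 (fun A => invmx G *m A *m invmx G) (cl_metric cl x y).
rewrite -!mulmxA mulmxV // mulmx1 => ->.
by rewrite mulNmx mulmxN !mulmxA mulVmx // mul1mx subrr.
Qed.

Lemma act_rhs x y T (k l : R) : T = k *: invmx G + l *: (om *m invmx G) ->
  Z x y *m T + T *m (Z x y)^T = 0.
Proof.
move=> ->; rewrite mulmxDr mulmxDl -!scalemxAr -!scalemxAl mulmxA om_comm addrACA.
by rewrite -!mulmxA -!scalerDr -mulmxDr act_inv mulmx0 !scaler0 addr0.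
Qed.

(** Z acts as a derivation and kills the right-hand side, so the left-hand side for (u, Z p) is
    minus the one for (Z u, p); hence the coefficients [- k'] and [- l']. *)
Lemma sym_closed_act x y p : sym_closed p -> sym_closed (Z x y *m p).
Proof.
move=> h u; have [k [l e]] := h u; have [k' [l' e']] := h (Z x y *m u).
exists (- k'), (- l'); have c q : Z x y *m (om *m q) = om *m (Z x y *m q) by rewrite !mulmxA om_comm.
have := act_rhs x y e; rewrite mulmxDr mulmxDl addrACA !sym2_act !c => r0.
rewrite !scaleNr -opprD -e'; apply/eqP; rewrite -addr_eq0 -r0 addrC addrACA.
by rewrite [eqbRHS]addrC [X in X + _ == _]addrC.
Qed.

Hypothesis mu_closed : sym_closed mu.

Let xi x y := Z x y *m mu.

Let xi_closed x y : sym_closed (xi x y).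
Proof. exact: sym_closed_act. Qed.

Let phi := G *m v.

Let invphi : invmx G *m phi = v.
Proof. by rewrite mulKmx. Qed.

Let dphi x : dotc (om *m x) phi = dotc x (G *m (om *m v)).
Proof. by rewrite mulmxA -om_sym -mulmxA dotcA trmxK. Qed.

Let xi_phi x y : dotc (xi x y) phi = 0.
Proof.
rewrite dotcC dotcA /phi mulmxA (cl_metric cl) mulNmx -mulmxA v_null.
by rewrite mulmx0 oppr0 dotc0l.
Qed.

Let om_xi_phi x y : dotc (om *m xi x y) phi = 0.
Proof.
rewrite dphi dotcC /xi dotcA mulmxA (cl_metric cl) mulNmx -[G *m _ *m _]mulmxA.
by rewrite [_ *m (om *m v)]mulmxA om_comm -mulmxA v_null !mulmx0 oppr0 dotc0l.
Qed.

(** The identity for [xi x y] applied to the covector [phi], that is g v. Two of its four terms drop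
    out because [xi] and [om xi] are both orthogonal to v. *)
Let eq_phi x y u : exists k l : R,
  dotc u phi *: (om *m xi x y) + dotc (om *m u) phi *: xi x y
  = k *: v + l *: (om *m v).
Proof.
have [k [l e]] := xi_closed x y u; exists k, l.
have := congr1 (mulmx^~ phi) e; rewrite /= mulmxDl !sym2_mul om_xi_phi xi_phi mulmxDl.
by rewrite -!scalemxAl -mulmxA invphi !scale0r add0r addr0.
Qed.

Let v_null_om x y : Z x y *m (om *m v) = 0.
Proof. by rewrite mulmxA om_comm -mulmxA v_null mulmx0. Qed.

Lemma dotc_separate p q : p != 0 ->
  (exists2 u, dotc u p = 0 & dotc u q != 0) \/ exists eta, q = eta *: p.
Proof.
move=> /cV0Pn [a pa].
have [h|h] := pselect (exists2 u, dotc u p = 0 & dotc u q != 0); first by left.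
right; exists (q a 0 / p a 0); apply/eqP; rewrite -subr_eq0; apply/eqP.
apply: dotc_eq0 => u; apply/eqP; apply: contra_notT h => ne.
exists (u - (dotc u p / p a 0) *: delta_mx a 0).
  by rewrite dotcDl dotcNl dotcZl [dotc (delta_mx _ _) _]dotcC dotc_delta; field.
move: ne; rewrite !(dotcDl, dotcNl, dotcZl) ![dotc (delta_mx _ _) _]dotcC dotc_delta.
rewrite ![dotc _ u]dotcC.
by congr (_ != _); field.
Qed.

(** This is A_y A_y = 0. Either [xi x y] is killed by all of Z, and then Z vanishes with it in a
    slot; or om is nilpotent, [xi x y] is a multiple of [om u0], and Z(om u0, y) mu = om Z(u0, y) mu
    = 0. *)
Lemma null_endo_sqr x y : Z (Z x y *m mu) y *m mu = 0.
Proof.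
suff [h|h] : (forall x' y', Z x' y' *m xi x y = 0) \/ Z (xi x y) y *m mu = 0.
- by rewrite (cl_null_slot h) mul0mx.
- exact: h.
have phi_neq0 : phi != 0.
  by apply: contra_neq v_neq0 => p0; rewrite -invphi p0 mulmx0.
(* If g (om v) is not proportional to g v, some u removes the [om xi] term of [eq_phi], which puts
   [xi] in the span of the null vectors v and om v. Otherwise v is an eigenvector of om, with
   eigenvalue [eta]. *)
have [[u u0 u1]|[eta]] := dotc_separate (G *m (om *m v)) phi_neq0.
  left=> x' y'; have [k [l]] := eq_phi x y u; rewrite u0 scale0r add0r dphi => e.
  have -> : xi x y = (dotc u (G *m (om *m v)))^-1 *: (k *: v + l *: (om *m v)).
    by rewrite -e scalerA mulVf // scale1r.
  by rewrite -scalemxAr mulmxDr -!scalemxAr v_null v_null_om !scaler0 addr0 scaler0.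
move=> /(congr1 (mulmx (invmx G))); rewrite -scalemxAr invphi mulKmx // => om_v.
have [u u1] : exists u, dotc u phi = 1.
  have /cV0Pn [a pa] := phi_neq0; exists ((phi a 0)^-1 *: delta_mx a 0).
  by rewrite dotcZl dotcC dotc_delta mulVf.
have om_xi x1 y1 : exists k, om *m xi x1 y1 = k *: v - eta *: xi x1 y1.
  have [k [l]] := eq_phi x1 y1 u; rewrite dphi om_v -scalemxAr dotcZr u1 scale1r mulr1.
  by move=> /(canRL (addrK _)) ->; rewrite scalerA -scalerDl; exists (k + l * eta).
have [k om_xi_k] := om_xi x y.
(* For nonzero [eta], take u = xi in the condition on xi and act with Z' = Z(x',y'): the result is
   twice the symmetric product of Z' xi with om xi - eta xi. So Z' xi = 0, or om xi = eta xi and xi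
   is a multiple of v. *)
have [eta0|eta_neq0] := eqVneq eta 0; last first.
  left=> x' y'; have [k1 [l1 /act_rhs e]] := xi_closed x y (xi x y).
  have om_act : om *m (Z x' y' *m xi x y) = - eta *: (Z x' y' *m xi x y).
    by rewrite mulmxA -om_comm -mulmxA om_xi_k mulmxDr -scalemxAr v_null scaler0 add0r mulmxN scaleNr -scalemxAr.
  have := e x' y'; rewrite mulmxDr mulmxDl addrACA !sym2_act mulmxA om_comm -mulmxA om_act.
  move=> /eqP; rewrite -mulr2n -scaler_nat scaler_eq0 pnatr_eq0 /= => /eqP.
  have -> : sym2 (Z x' y' *m xi x y) (om *m xi x y) + sym2 (xi x y) (- eta *: (Z x' y' *m xi x y))
      = sym2 (Z x' y' *m xi x y) (om *m xi x y - eta *: xi x y).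
    by rewrite -scaleNr sym2Dr !sym2Zr [sym2 (xi _ _) _]sym2C.
  move=> /outer_sym_eq0 [//|/eqP]; rewrite om_xi_k -addrA -opprD -scalerDl subr_eq0 => /eqP e'.
  have -> : xi x y = (eta + eta)^-1 *: (k *: v).
    by rewrite e' scalerA mulVf ?scale1r // -mulr2n mulrn_eq0.
  by rewrite -!scalemxAr v_null !scaler0.
(* Now om v = 0, so the scalar [de] is 0, om squares to zero, and every om xi is a multiple of v. *)
right; rewrite eta0 scale0r in om_v.
have {}om_xi x1 y1 : exists k, om *m xi x1 y1 = k *: v.
  by have [k1] := om_xi x1 y1; rewrite eta0 scale0r subr0 => e; exists k1.
have [u0 q_neq0] : exists u0, dotc u0 (G *m (om *m u0)) != 0.
  apply: contrapT => h; have := om_neq0; rewrite -(mulKmx Gunit om).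
  rewrite (@quad_eq0 (G *m om)) ?mulmx0 ?eqxx //.
    by rewrite trmx_mul Gsym om_sym.
  by move=> u0; apply/eqP; apply: contra_notT h => q; exists u0; rewrite mulmxA.
have om_om p : om *m (om *m p) = 0.
  have d0 : de = 0.
    apply/eqP; have := congr1 (mulmx^~ v) om_sqr; rewrite /= -mulmxA om_v mulmx0 mul_scalar_mx.
    by move=> /esym/eqP; rewrite scaler_eq0 (negPf v_neq0) orbF.
  by rewrite mulmxA om_sqr d0 mul_scalar_mx scale0r.
have Gom p q : dotc (om *m p) (G *m q) = dotc p (G *m (om *m q)).
  by rewrite [in RHS]mulmxA -om_sym -[in RHS]mulmxA [in RHS]dotcA trmxK.
have om_phi p : dotc (om *m p) phi = 0 by rewrite dphi om_v mulmx0 dotc0r.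
(* The identity for (xi, u0) is applied to g v, which gives [k2], then to g (om u0), which gives om
   xi = 0, then to g u0, which gives xi as a multiple of om u0. The last two use that g(u0, om u0)
   is nonzero. *)
have xi_line x1 y1 : om *m xi x1 y1 = 0 /\ exists c, xi x1 y1 = c *: (om *m u0).
  have [k1 e1] := om_xi x1 y1; have [k2 [l2 e2]] := xi_closed x1 y1 u0.
  have ev p : dotc (om *m xi x1 y1) (G *m p) *: u0 + dotc u0 (G *m p) *: (om *m xi x1 y1)
      + (dotc (om *m u0) (G *m p) *: xi x1 y1 + dotc (xi x1 y1) (G *m p) *: (om *m u0))
      = k2 *: p + l2 *: (om *m p).
    have := congr1 (mulmx^~ (G *m p)) e2; rewrite /= mulmxDl !sym2_mul mulmxDl => ->.
    by rewrite -!scalemxAl -mulmxA mulKmx.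
  have k2E : k2 = k1 * dotc u0 phi.
    have := ev v; rewrite -/phi om_xi_phi om_phi xi_phi !scale0r add0r !addr0 om_v scaler0 addr0.
    rewrite e1 scalerA => /eqP; rewrite -subr_eq0 -scalerBl scaler_eq0 (negPf v_neq0) orbF.
    by rewrite subr_eq0 => /eqP <-; rewrite mulrC.
  have k1_0 : k1 = 0.
    have := ev (om *m u0).
    rewrite !Gom !om_om mulmx0 !dotc0r scale0r scale0r !add0r scaler0 addr0 k2E.
    rewrite -[dotc (xi _ _) _]Gom e1 dotcZl [dotc v _]dotcA Gsym [dotc _ u0]dotcC => /(canRL (addrK _)).
    rewrite subrr scalerA => /eqP; rewrite scaler_eq0 (negPf v_neq0) orbF mulf_eq0 (negPf q_neq0).
    by move=> /eqP.
  move: e1; rewrite k1_0 scale0r => e1; split=> //.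
  have := ev u0; rewrite e1 dotc0l scaler0 scale0r !add0r k2E k1_0 mul0r scale0r add0r.
  move=> /(canRL (addrK _)); rewrite -scalerBl => /(congr1 (fun p => (dotc u0 (G *m (om *m u0)))^-1 *: p)).
  rewrite Gom !scalerA mulVf // scale1r => ->; by eexists.
have [_ [c ->]] := xi_line x y.
rewrite cl_linZ (cl_comm_slot om_sym om_comm).
by rewrite -scalemxAl om_comm -mulmxA (xi_line u0 y).1 scaler0.
Qed.

Lemma null_trace y : \sum_a (Z (delta_mx a 0) y *m mu) a 0 = 0.
Proof.
pose A : 'M[R]_n := \matrix_(i, a) (Z (delta_mx a 0) y *m mu) i 0.
have AE x : A *m x = Z x y *m mu.
  apply/colP => i; rewrite {2}(colE_sum x) mxE.
  rewrite cl_lin_sum mulmx_suml summxE; apply: eq_bigr => a _.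
  by rewrite -scalemxAl !mxE mulrC.
have -> : \sum_a (Z (delta_mx a 0) y *m mu) a 0 = \tr A.
  by apply: eq_bigr => a _; rewrite [RHS]mxE.
apply: sqr0_tr; apply: mx_eq_vec => x.
by rewrite -mulmxA !AE null_endo_sqr mul0mx.
Qed.

End NullVector.

(** * Pointwise consequences of the commutation identities *)

Section TractorSystem.
Variables (sg : 'M[R]_n) (v mu b t : 'cV[R]_n).
Hypotheses (n_ge2 : (2 <= n)%N) (sg_sym : sg^T = sg) (v_neq0 : v != 0)
  (v_null : forall x y, Z x y *m v = 0).

Lemma null_slot y : Z v y = 0.
Proof. exact: cl_null_slot. Qed.

(** Contracting the index a with v kills the right-hand side and leaves v . m_c = e_c . N, where N
    is the sum of v_a m_a. Tracing over c gives N = r v with r the mean of the diagonal terms, so v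
    . (m_c - r e_c) = 0, and v cancels. *)
Lemma tracefree_null_vector (m : 'I_n -> 'cV[R]_n) :
  (forall a b, sym2 (delta_mx a 0) (m b) - sym2 (delta_mx b 0) (m a)
     = Z (delta_mx a 0) (delta_mx b 0) *m sg + sg *m (Z (delta_mx a 0) (delta_mx b 0))^T) ->
  forall a, m a = (n%:R^-1 * \sum_d m d d 0) *: delta_mx a 0.
Proof.
move=> h; pose N := \sum_a v a 0 *: m a.
have e c : sym2 v (m c) = sym2 (delta_mx c 0) N.
  apply/eqP; rewrite -subr_eq0; apply/eqP.
  have -> : sym2 v (m c) - sym2 (delta_mx c 0) N = \sum_a v a 0 *:
      (sym2 (delta_mx a 0) (m c) - sym2 (delta_mx c 0) (m a)).
    rewrite {1}(colE_sum v) sym2C sym2_sumr sym2_sumr -sumrB; apply: eq_bigr => a _.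
    by rewrite !sym2Zr scalerBr [sym2 (m c) _]sym2C.
  under eq_bigr do rewrite h scalerDr scalemxAl scalemxAr -linearZ /=.
  rewrite big_split /= -mulmx_suml -mulmx_sumr -linear_sum /= -cl_lin_sum -colE_sum.
  by rewrite null_slot mul0mx linear0 mulmx0 addr0.
have n0 : n%:R != 0 :> R by rewrite pnatr_eq0; case: n n_ge2.
have NE : N = (n%:R^-1 * \sum_d m d d 0) *: v.
  apply/colP => d; rewrite [RHS]mxE.
  have : \sum_c (sym2 v (m c)) c d = \sum_c (sym2 (delta_mx c 0) N) c d.
    by apply: eq_bigr => c _; rewrite e.
  under eq_bigr do rewrite mxE !outerE.
  under [in RHS]eq_bigr do rewrite mxE !outerE.
  rewrite !big_split /= -mulr_suml.
  have -> : \sum_i v i 0 * m i d 0 = N d 0.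
    by rewrite summxE; apply: eq_bigr => i _; rewrite mxE.
  have -> : \sum_i (delta_mx i 0 : 'cV[R]_n) i 0 * N d 0 = n%:R * N d 0.
    under eq_bigr do rewrite mxE !eqxx mul1r.
    by rewrite sumr_const cardT size_enum_ord mulr_natl.
  have -> : \sum_i N i 0 * (delta_mx i 0 : 'cV[R]_n) d 0 = N d 0.
    rewrite (bigD1 d) //= mxE !eqxx mulr1 big1 ?addr0 // => i /negPf di.
    by rewrite mxE eq_sym di mulr0.
  rewrite [LHS]addrC => /addIr e2.
  by rewrite -mulrA e2 mulKf.
move=> a; set r := _ * _.
have : sym2 v (m a - r *: delta_mx a 0) = 0.
  by rewrite -scaleNr sym2Dr e NE !sym2Zr [sym2 v _]sym2C -scalerDl subrr scale0r.
case/outer_sym_eq0 => [/eqP|/eqP]; first by rewrite (negPf v_neq0).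
by rewrite subr_eq0 => /eqP.
Qed.

Let S := sg *m G.

Lemma sg_endo_sym : S^T *m G = G *m S.
Proof. by rewrite /S trmx_mul Gsym sg_sym mulmxA. Qed.

(** Since Z is skew for g, the action of Z on sigma multiplied by g is the commutator of Z with
    S. *)
Lemma comm_of_derivation x y : Z x y *m sg + sg *m (Z x y)^T = 0 ->
  Z x y *m S = S *m Z x y.
Proof.
move=> /eqP; rewrite addr_eq0 => /eqP e.
by rewrite /S mulmxA e mulNmx -!mulmxA (cl_metric cl) mulmxN opprK.
Qed.

Hypotheses (S_comm : forall x y, Z x y *m S = S *m Z x y)
  (E : forall x y, Z x y *m mu = dotc t y *: x - dotc t x *: y
                   + dotc b x *: (S *m y) - dotc b y *: (S *m x)).

(** Compare the two values of Z(Sx, y) mu: S Z(x, y) mu, because S crosses slots, and the one given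
    by [E]. The terms where t and b are evaluated at y agree and drop out; what remains is a
    polynomial in S applied to y. *)
Lemma endo_quadratic x y :
  dotc b x *: (S *m (S *m y)) - (dotc t x + dotc b (S *m x)) *: (S *m y)
  + dotc t (S *m x) *: y = 0.
Proof.
have : S *m (Z x y *m mu) = Z (S *m x) y *m mu.
  by rewrite mulmxA -S_comm (cl_comm_slot sg_endo_sym S_comm).
rewrite !E !(mulmxDr, mulmxN) -!scalemxAr => /eqP; rewrite -subr_eq0 => /eqP <-.
by apply/colP => i; rewrite !mxE; ring.
Qed.

(** At x = v the left side vanishes, so th(y) v = th(v) y. Tracing in y gives th(v) = n th(v), hence
    th(v) = 0, and then th = 0. *)
Lemma scalar_case (th : 'cV[R]_n) :
  (forall x y, Z x y *m mu = dotc th y *: x - dotc th x *: y) ->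
  forall x y, Z x y *m mu = 0.
Proof.
move=> h; have hv y : dotc th y *: v = dotc th v *: y.
  by apply/eqP; rewrite -subr_eq0 -h null_slot mul0mx.
have tv : dotc th v = 0.
  have e1 a : th a 0 * v a 0 = dotc th v.
    have := congr1 (fun p : 'cV[R]_n => p a 0) (hv (delta_mx a 0)).
    by rewrite dotc_delta !mxE !eqxx mulr1.
  have : dotc th v = dotc th v *+ n.
    rewrite {1}dotcE; under eq_bigr do rewrite e1.
    by rewrite sumr_const cardT size_enum_ord.
  move=> /eqP; rewrite -subr_eq0 -{1}[dotc th v]mulr1n -opprB -mulrnBr ?(ltnW n_ge2) //.
  by rewrite oppr_eq0 mulrn_eq0 subn_eq0 leqNgt n_ge2 => /eqP.
have th0 : th = 0.
  apply: dotc_eq0 => y; have /eqP := hv y.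
  by rewrite tv scale0r scaler_eq0 (negPf v_neq0) orbF => /eqP.
by move=> x y; rewrite h th0 !dotc0l !scale0r subrr.
Qed.

(* If [S] is not scalar then [w := S - (p / 2)], where [S^2 = p S - q], squares to a scalar. *)
Lemma trace_vanishes :
  (forall a f, exists k2 k1 k0 : R,
     let H := - (sym2 (delta_mx f 0) mu *m G) in
     b a 0 *: (H *m S + S *m H) - (t a 0 + dotc b (S *m delta_mx a 0)) *: H
     = k2 *: (S *m S) + k1 *: S + k0%:M) ->
  forall y, \sum_a (Z (delta_mx a 0) y *m mu) a 0 = 0.
Proof.
move=> h y.
suff [h0|h0] : (forall x y, Z x y *m mu = 0) \/ \sum_a (Z (delta_mx a 0) y *m mu) a 0 = 0.
- by apply: big1 => a _; rewrite h0 mxE.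
- exact: h0.
have [b0|/eqP/cV0Pn [a ba]] := pselect (b = 0).
  by left; apply: (scalar_case (th := t)) => x z; rewrite E b0 !dotc0l !scale0r subr0 addr0.
have [[s Ss]|Sns] := pselect (exists s, S = s%:M).
  (* When S is the scalar s, the terms in b have the same shape as those in t and shift t by - s
     b. *)
  left; apply: (scalar_case (th := t - s *: b)) => x z; rewrite E Ss !mul_scalar_mx.
  by apply/colP => i; rewrite !mxE !dotcDl !dotcNl !dotcZl; ring.
(* [p] and [q] are the coefficients of the quadratic equation with index a, divided by the nonzero
   b_a. *)
right; pose c := t a 0 + dotc b (S *m delta_mx a 0); pose p := c / b a 0.
pose q := dotc t (S *m delta_mx a 0) / b a 0.
have S2 : S *m S = p *: S - q%:M.
  apply: mx_eq_vec => x; have := endo_quadratic (delta_mx a 0) x.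
  rewrite !dotc_delta -/c => e; rewrite mulmxBl -scalemxAl mul_scalar_mx.
  apply/eqP; rewrite -mulmxA -subr_eq0; apply/eqP.
  rewrite -[RHS](scaler0 _ (b a 0)^-1) -e; apply/colP => i; rewrite !mxE /p /q.
  by field.
pose w := S - (p / 2)%:M.
have Sw : S = w + (p / 2)%:M by rewrite /w subrK.
have w_comm x z : Z x z *m w = w *m Z x z.
  by rewrite mulmxBr mulmxBl S_comm scalar_mxC.
have w_sym : w^T *m G = G *m w.
  by rewrite linearB /= tr_scalar_mx mulmxBr mulmxBl sg_endo_sym scalar_mxC.
apply: (null_trace (om := w) (de := p ^+ 2 / 4 - q) (v := v)) => //.
- rewrite /w mulmxBr !mulmxBl S2 mul_mx_scalar !mul_scalar_mx scale_scalar_mx.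
  apply/matrixP => i j; rewrite !mxE; case: (i == j) => /=; rewrite ?mulr1n ?mulr0n; by field.
- by apply/negP => /eqP w0; case: Sns; exists (p / 2); rewrite Sw w0 add0r.
(* The condition is linear in u, so it is enough to treat the basis vectors e_f, for which the
   hypothesis is the derivative in direction f. *)
pose P u := exists k l : R,
  sym2 u (w *m mu) + sym2 mu (w *m u) = k *: invmx G + l *: (w *m invmx G).
have PD u1 u2 k : P u1 -> P u2 -> P (k *: u1 + u2).
  move=> [k1 [l1 e1]] [k2 [l2 e2]]; exists (k * k1 + k2), (k * l1 + l2).
  rewrite mulmxDr -scalemxAr sym2C !sym2Dr !sym2Zr addrACA -scalerDr.
  rewrite [sym2 _ u1]sym2C [sym2 _ u2]sym2C e1 e2.
  by apply/matrixP => i j; rewrite !mxE; ring.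
move=> u; rewrite (colE_sum u) -/(P _).
have P0 : P 0.
  by exists 0, 0; rewrite mulmx0 /sym2 !trmx0 !mulmx0 !mul0mx !scale0r !addr0.
elim/big_ind: _ => [//|u1 u2 P1 P2|f _].
  by rewrite -[u1]scale1r; apply: PD.
rewrite -[_ *: _]addr0; apply: PD => //.
have [k2 [k1 [k0]]] := h a f; rewrite /= -/c.
set Q := sym2 _ mu; set X := Q *m G; rewrite mulNmx mulmxN S2 => e.
have XS : X *m S = X *m w + (p / 2) *: X by rewrite {1}Sw mulmxDr mul_mx_scalar.
have SX : S *m X = w *m X + (p / 2) *: X by rewrite {1}Sw mulmxDl mul_scalar_mx.
have cE : c = b a 0 * p by rewrite /p mulrC divfK.
(* Because c = b_a p, the left side of the hypothesis is b_a (H S + S H - p H) = b_a (H w + w H)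
   with H = - X: the shift by p/2 absorbs the term linear in H. *)
have {XS SX} e2 : X *m w + w *m X = (- (k2 * p + k1) / b a 0) *: w
    + (- ((k2 * p + k1) * (p / 2) - k2 * q + k0) / b a 0)%:M.
  move: e; rewrite XS SX {1 2}Sw cE => e; apply/matrixP => i j.
  have {}e := congr1 (fun M : 'M[R]_n => M i j) e.
  move: e; move: (X) (w) (X *m w) (w *m X) => D W A C.
  rewrite !mxE => e; apply: (mulfI ba).
  move: e; case: (i == j); rewrite ?mulr1n ?mulr0n => e.
    rewrite (_ : b a 0 * _ = - (b a 0 * (- (A i j + p / 2 * D i j)
      - (C i j + p / 2 * D i j)) - b a 0 * p * - D i j)); last by field.
    by rewrite e; field.
  rewrite (_ : b a 0 * _ = - (b a 0 * (- (A i j + p / 2 * D i j)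
    - (C i j + p / 2 * D i j)) - b a 0 * p * - D i j)); last by field.
  by rewrite e; field.
exists (- ((k2 * p + k1) * (p / 2) - k2 * q + k0) / b a 0), (- (k2 * p + k1) / b a 0).
have -> : sym2 (delta_mx f 0) (w *m mu) + sym2 mu (w *m delta_mx f 0) = w *m Q + Q *m w^T.
  by rewrite sym2_act addrC sym2C.
have -> : w *m Q + Q *m w^T = (X *m w + w *m X) *m invmx G.
  by rewrite mulmxDl addrC /X -(mulmxA Q G w) -w_sym !mulmxA !mulmxK.
by rewrite e2 mulmxDl mul_scalar_mx -scalemxAl addrC.
Qed.

End TractorSystem.
End CurvatureLike.
End Algebra.

(** * Smooth functions and matrices *)

(** The affine approximation of f at p has the same remainder for any function that agrees with f
    near p. *)
Lemma near_eq_differentiable (R : realType) (V W : normedModType R) (f g : V -> W) (p : V) :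
  (\near p, f p = g p) -> differentiable f p -> differentiable g p.
Proof.
move=> fg df; have dgE : g \o shift p = cst (g p) + 'd f p +o_ 0 id.
  have /eqaddoP h := diff_locally df.
  apply/eqaddoP => e e0; have fgp := nbhs_singleton fg.
  have fg0 : \forall x \near (0 : V), f (x + p) = g (x + p).
    by move: fg; rewrite (near_shift 0 p) /= subr0.
  near=> x; rewrite !fctE /= -fgp.
  have <- : f (x + p) = g (x + p) by near: x.
  by near: x; exact: (h e e0).
have gf : 'd g p = 'd f p :> (V -> W) by apply: diff_unique => //; exact: diff_continuous.
by apply/diff_locallyP; rewrite gf; split => //; exact: diff_continuous.
Unshelve. all: by end_near. Qed.

(** * Rules for partial derivatives and for smoothness *)

Section Calculus.
Variables (R : realType) (n : nat).
Local Notation V := 'rV[R]_n.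
Implicit Types (f g : V -> R) (U : set V) (p q : V) (a b : 'I_n).

Lemma open_near U (P : V -> Prop) p : open U -> U p -> (forall q, U q -> P q) ->
  \forall q \near p, P q.
Proof.
by move=> oU Up h; have := open_nbhs_nbhs (conj oU Up); apply: filterS.
Qed.

Lemma eq_on_differentiable U f g p : open U -> U p -> (forall q, U q -> f q = g q) ->
  differentiable f p -> differentiable g p.
Proof. by move=> oU Up /(open_near oU Up); exact: near_eq_differentiable. Qed.

Lemma eq_on_pd U f g a p : open U -> U p -> (forall q, U q -> f q = g q) ->
  pd f a p = pd g a p.
Proof. by move=> oU Up /(open_near oU Up); exact: near_eq_derive. Qed.

Lemma pd_cst c a p : pd (fun=> c) a p = 0.
Proof. exact: derive_cst. Qed.

Lemma pdD f g a p : differentiable f p -> differentiable g p ->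
  pd (fun q => f q + g q) a p = pd f a p + pd g a p.
Proof. by move=> df dg; apply: deriveD; exact: diff_derivable. Qed.

Lemma pdN f a p : differentiable f p -> pd (fun q => - f q) a p = - pd f a p.
Proof. by move=> df; apply: deriveN; exact: diff_derivable. Qed.

Lemma pdM f g a p : differentiable f p -> differentiable g p ->
  pd (fun q => f q * g q) a p = pd f a p * g p + f p * pd g a p.
Proof.
move=> df dg; rewrite [LHS]deriveM; try exact: diff_derivable.
by rewrite addrC [X in X + _]mulrC.
Qed.

Lemma pdV f a p : differentiable f p -> f p != 0 ->
  pd (fun q => (f q)^-1) a p = - ((f p)^-1 * (f p)^-1) * pd f a p.
Proof.
move=> df f0; rewrite [LHS]deriveV //; last exact: diff_derivable.
by rewrite -expr2 exprVn.
Qed.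

Lemma differentiable_bigsum (I : finType) (P : pred I) (F : I -> V -> R) p :
  (forall i, P i -> differentiable (F i) p) ->
  differentiable (fun q => \sum_(i | P i) F i q) p.
Proof.
move=> h; elim: (index_enum I) => [|i s d].
  rewrite (_ : (fun _ => _) = fun=> 0); first exact: differentiable_cst.
  by apply/funext => q; rewrite big_nil.
have [Pi|nPi] := boolP (P i); last first.
  rewrite (_ : (fun _ => _) = fun q => \sum_(i <- s | P i) F i q) //.
  by apply/funext => q; rewrite big_cons (negPf nPi).
rewrite (_ : (fun _ => _) = fun q => F i q + \sum_(i <- s | P i) F i q).
  by apply: differentiableD => //; exact: h.
by apply/funext => q; rewrite big_cons Pi.
Qed.

Lemma pd_sum (I : finType) (P : pred I) (F : I -> V -> R) a p :
  (forall i, P i -> differentiable (F i) p) ->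
  pd (fun q => \sum_(i | P i) F i q) a p = \sum_(i | P i) pd (F i) a p.
Proof.
move=> h.
suff H (s : seq I) : differentiable (fun q => \sum_(i <- s | P i) F i q) p /\
  pd (fun q => \sum_(i <- s | P i) F i q) a p = \sum_(i <- s | P i) pd (F i) a p.
  exact: (H _).2.
elim: s => [|i s [d e]].
  rewrite (_ : (fun _ => _) = fun=> 0); last by apply/funext => q; rewrite big_nil.
  by split; [exact: differentiable_cst|rewrite pd_cst big_nil].
have [Pi|nPi] := boolP (P i); last first.
  rewrite (_ : (fun _ => _) = fun q => \sum_(i <- s | P i) F i q).
    by rewrite big_cons (negPf nPi).
  by apply/funext => q; rewrite big_cons (negPf nPi).
rewrite (_ : (fun _ => _) = fun q => F i q + \sum_(i <- s | P i) F i q); last first.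
  by apply/funext => q; rewrite big_cons Pi.
split; first by apply: differentiableD => //; exact: h.
by rewrite pdD ?e ?big_cons ?Pi //; exact: h.
Qed.

Lemma pds_rcons s a f : pds (rcons s a) f = pds s (pd f a).
Proof. by rewrite /pds foldr_rcons. Qed.

(** All partial derivatives of order below k are differentiable. In [pds] the head of the list is
    the outermost derivative; peeling off the innermost one instead lets the Leibniz rule close an
    induction on k. *)
Fixpoint Ck U k f : Prop :=
  if k is k'.+1 then (forall p, U p -> differentiable f p) /\ forall a, Ck U k' (pd f a)
  else True.

Lemma smooth_on_diff U f p : smooth_on U f -> U p -> differentiable f p.
Proof. by move=> h Up; exact: (h [::]). Qed.

Lemma smooth_on_pd U f a : smooth_on U f -> smooth_on U (pd f a).
Proof. by move=> h s p Up; rewrite -pds_rcons; exact: h. Qed.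

Lemma smooth_onP U f : smooth_on U f <-> forall k, Ck U k f.
Proof.
split=> [h k|h s].
  elim: k f h => //= k IH f h; split=> [p|a]; first exact: smooth_on_diff.
  by apply: IH; exact: smooth_on_pd.
elim/last_ind: s f h => [|s a IH] f h p Up; first by have [/(_ _ Up)] := h 1%N.
by rewrite pds_rcons; apply: IH => // k; have [_] := h k.+1; exact.
Qed.

Lemma Ck_ext U k f g : open U -> (forall q, U q -> f q = g q) -> Ck U k f -> Ck U k g.
Proof.
move=> oU; elim: k f g => //= k IH f g fg [df h]; split=> [p Up|a].
  exact: (eq_on_differentiable oU Up fg (df p Up)).
by apply: (IH _ _ _ (h a)) => q Uq; exact: (eq_on_pd _ oU Uq fg).
Qed.

Lemma CkS U k f : Ck U k.+1 f -> Ck U k f.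
Proof.
elim: k f => // k IH f /= [df h]; split=> // a; apply: IH; exact: h.
Qed.

Lemma Ck_cst U k c : Ck U k (fun=> c).
Proof.
elim: k c => //= k IH c; split=> [p _|a]; first exact: differentiable_cst.
by rewrite (_ : pd _ a = fun=> 0) //; apply/funext => q; rewrite pd_cst.
Qed.

Lemma CkD U k f g : open U -> Ck U k f -> Ck U k g -> Ck U k (fun q => f q + g q).
Proof.
move=> oU; elim: k f g => //= k IH f g [df hf] [dg hg]; split=> [p Up|a].
  by apply: differentiableD; [exact: df|exact: dg].
by apply: Ck_ext (IH _ _ (hf a) (hg a)) => // q Uq; rewrite pdD //; [exact: df|exact: dg].
Qed.

Lemma CkM U k f g : open U -> Ck U k f -> Ck U k g -> Ck U k (fun q => f q * g q).
Proof.
move=> oU; elim: k f g => //= k IH f g [df hf] [dg hg]; split=> [p Up|a].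
  by apply: differentiableM; [exact: df|exact: dg].
apply: (@Ck_ext _ _ (fun q => pd f a q * g q + f q * pd g a q)) => //.
  by move=> q Uq; rewrite pdM //; [exact: df|exact: dg].
by apply: CkD => //; apply: IH => //; apply: CkS.
Qed.

Lemma CkV U k f : open U -> (forall q, U q -> f q != 0) -> Ck U k f ->
  Ck U k (fun q => (f q)^-1).
Proof.
move=> oU f0; elim: k => //= k IH [df hf]; split=> [p Up|a].
  by apply: differentiableV; [exact: df|exact: f0].
have hk := IH (CkS (conj df hf)).
apply: (@Ck_ext _ _ (fun q => -1 * ((f q)^-1 * (f q)^-1) * pd f a q)) => //.
  by move=> q Uq; rewrite pdV ?mulN1r //; [exact: df|exact: f0].
by do !apply: CkM => //; exact: Ck_cst.
Qed.

Lemma smooth_on_ext U f g : open U -> (forall q, U q -> f q = g q) ->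
  smooth_on U f -> smooth_on U g.
Proof. by move=> oU e /smooth_onP h; apply/smooth_onP => k; exact: Ck_ext e (h k). Qed.

Lemma smooth_on_cst U c : smooth_on U (fun=> c).
Proof. by apply/smooth_onP => k; exact: Ck_cst. Qed.

Lemma smooth_onD U f g : open U -> smooth_on U f -> smooth_on U g ->
  smooth_on U (fun q => f q + g q).
Proof. by move=> oU /smooth_onP hf /smooth_onP hg; apply/smooth_onP => k; exact: CkD. Qed.

Lemma smooth_onM U f g : open U -> smooth_on U f -> smooth_on U g ->
  smooth_on U (fun q => f q * g q).
Proof. by move=> oU /smooth_onP hf /smooth_onP hg; apply/smooth_onP => k; exact: CkM. Qed.

Lemma smooth_onV U f : open U -> (forall q, U q -> f q != 0) -> smooth_on U f ->
  smooth_on U (fun q => (f q)^-1).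
Proof. by move=> oU f0 /smooth_onP hf; apply/smooth_onP => k; exact: CkV. Qed.

Lemma smooth_onZ U c f : open U -> smooth_on U f -> smooth_on U (fun q => c * f q).
Proof. by move=> oU; apply: smooth_onM => //; exact: smooth_on_cst. Qed.

Lemma smooth_onN U f : open U -> smooth_on U f -> smooth_on U (fun q => - f q).
Proof.
by move=> oU h; apply: smooth_on_ext (smooth_onZ (-1) oU h) => // q _; rewrite mulN1r.
Qed.

Lemma smooth_onB U f g : open U -> smooth_on U f -> smooth_on U g ->
  smooth_on U (fun q => f q - g q).
Proof. by move=> oU hf hg; apply: smooth_onD => //; exact: smooth_onN. Qed.

Lemma smooth_on_sum (I : Type) (r : seq I) (P : pred I) U (F : I -> V -> R) :
  open U -> (forall i, smooth_on U (F i)) -> smooth_on U (fun q => \sum_(i <- r | P i) F i q).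
Proof.
move=> oU h; elim: r => [|i r IH].
  by apply: smooth_on_ext (smooth_on_cst 0) => // q _; rewrite big_nil.
apply: (@smooth_on_ext _ (fun q => (if P i then F i q else 0) + \sum_(i <- r | P i) F i q)) => //.
  by move=> q _; rewrite big_cons; case: ifP; rewrite ?add0r.
by apply: smooth_onD => //; case: (P i) => //; exact: smooth_on_cst.
Qed.

Lemma smooth_on_prod (I : Type) (r : seq I) (P : pred I) U (F : I -> V -> R) :
  open U -> (forall i, smooth_on U (F i)) -> smooth_on U (fun q => \prod_(i <- r | P i) F i q).
Proof.
move=> oU h; elim: r => [|i r IH].
  by apply: smooth_on_ext (smooth_on_cst 1) => // q _; rewrite big_nil.
apply: (@smooth_on_ext _ (fun q => (if P i then F i q else 1) * \prod_(i <- r | P i) F i q)) => //.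
  by move=> q _; rewrite big_cons; case: ifP; rewrite ?mul1r.
by apply: smooth_onM => //; case: (P i) => //; exact: smooth_on_cst.
Qed.

Lemma is_derive_line f q (v : V) (s : R) : differentiable f (q + s *: v) ->
  is_derive s 1 (fun s => f (q + s *: v)) ('D_v f (q + s *: v)).
Proof.
move=> /diff_derivable df.
have e : (fun h : R => h^-1 *: (f (q + (h *: 1 + s) *: v) - f (q + s *: v)))
  = (fun h : R => h^-1 *: (f (h *: v + (q + s *: v)) - f (q + s *: v))).
  apply/funext => h; congr (_ *: (f _ - _)).
  by rewrite scalerDl addrCA; congr (_ *: _ + _); rewrite [LHS]mulr1.
apply: DeriveDef; last by rewrite /derive /= e.
by rewrite /derivable /= e; apply: df.
Qed.

End Calculus.

(** * Symmetry of second partial derivatives *)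

Section Schwarz.
Variables (R : realType) (n : nat).
Local Notation V := 'rV[R]_n.
Implicit Types (f g : V -> R) (U : set V) (p q : V) (a b : 'I_n).

Local Notation e_ a := (delta_mx 0 a : V).

Lemma norm_delta_le (a : 'I_n) : `|e_ a| <= 1.
Proof.
rewrite [leLHS]/Num.Def.normr/= mx_normrE bigmax_le // => -[i j] _ /=.
by rewrite mxE; case: (_ && _); rewrite ?normr1 ?normr0.
Qed.

Lemma differentiable_littleo g p (eps : R) : differentiable g p -> 0 < eps ->
  exists2 d : R, 0 < d & forall w, `|w| < d ->
    `|g (w + p) - g p - 'd g p w| <= eps * `|w|.
Proof.
move=> dg eps0; have /eqaddoP /(_ _ eps0) /= := diff_locally dg.
move=> /nbhs_ballP [d /= d0 h]; exists d => // w wd.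
have := h w; rewrite -ball_normE /= sub0r normrN => /(_ wd).
by rewrite !fctE /= opprD addrA.
Qed.

Definition second_diff f p a b (h : R) : R :=
  (f (p + h *: e_ b + h *: e_ a) - f (p + h *: e_ b)) - (f (p + h *: e_ a) - f p).

Lemma second_diffC f p a b h : second_diff f p a b h = second_diff f p b a h.
Proof. by rewrite /second_diff [p + _ + h *: e_ a]addrAC; ring. Qed.

(** The mean value theorem in direction a turns the second difference into h times an increment of
    [pd f a], and the differentiability of [pd f a] at p evaluates this increment up to o(h). *)
Lemma second_diff_approx U f p a b (eps : R) : open U -> U p ->
  (forall q, U q -> differentiable f q) -> differentiable (pd f a) p -> 0 < eps ->
  exists2 d : R, 0 < d & forall h, 0 < h < d ->
    `|second_diff f p a b h - h * h * pd (pd f a) b p| <= eps * (h * h).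
Proof.
(* The increment is a difference of two values of [pd f a], at displacements of norm at most 2h and
   h; the two errors add up to 3h times eps / 3. *)
move=> oU Up df dg eps0; have eps3 : 0 < eps / 3 by rewrite divr_gt0.
have [d1 d10 hd1] := differentiable_littleo dg eps3.
have /nbhs_ballP [d2 /= d20 hd2] := open_nbhs_nbhs (conj oU Up).
have inU w : `|w| < d2 -> U (w + p).
  by move=> wd; apply: hd2; rewrite -ball_normE /= opprD addrC subrK normrN.
(* Halved because the points that occur lie within 2h of p. *)
exists (Num.min d1 d2 / 2); first by rewrite divr_gt0 // lt_min d10.
move=> h /andP [h0 hlt].
have [h1 h2] : h * 2 < d1 /\ h * 2 < d2.
  by move: hlt; rewrite ltr_pdivlMr // lt_min => /andP.
have small (s k : R) : 0 <= s -> s <= h -> 0 <= k -> k <= h -> `|s *: e_ a + k *: e_ b| <= s + k.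
  move=> s0 sh k0 kh; apply: (le_trans (ler_normD _ _)); rewrite !normrZ !ger0_norm //.
  by rewrite lerD // ler_piMr ?norm_delta_le.
pose F k s := f (p + k *: e_ b + s *: e_ a).
have dF k s : 0 <= s -> s <= h -> 0 <= k -> k <= h ->
    is_derive s 1 (F k) (pd f a (p + k *: e_ b + s *: e_ a)).
  move=> s0 sh k0 kh; apply: is_derive_line; apply: df.
  rewrite addrAC -addrA addrC; apply: inU; apply: le_lt_trans (small _ _ _ _ _ _) _ => //.
  by apply: le_lt_trans h2; rewrite mulr_natr mulr2n lerD.
pose g := pd f a.
have dFF s : s \in `[0, h] -> is_derive s 1 (F h - F 0)
    (g (p + h *: e_ b + s *: e_ a) - g (p + 0 *: e_ b + s *: e_ a)).
  rewrite in_itv /= => /andP [s0 sh]; have h0' := ltW h0.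
  by apply: is_deriveB; exact: dF.
have [s] := MVT h0 (fun s sh => dFF s (subset_itv_oo_cc sh))
  (derivable_within_continuous (fun s sh => @ex_derive _ _ _ _ _ _ _ (dFF s sh))).
rewrite in_itv /= => /andP [s0 sh] e.
have -> : second_diff f p a b h =
    (g (s *: e_ a + h *: e_ b + p) - g (s *: e_ a + 0 *: e_ b + p)) * h.
  rewrite -[X in _ * X](subr0 h) [X in _ = (g X - _) * _]addrC [X in _ = (_ - g X) * _]addrC.
  rewrite ![p + (_ + _)]addrA ![p + _ + _ *: e_ b]addrAC -e /F /second_diff !fctE.
  have z0 (q : V) c : q + 0 *: e_ c = q by rewrite scale0r addr0.
  by rewrite !z0; ring.
have h0' := ltW h0; have s0' := ltW s0; have sh' := ltW sh.
have n1 := small s h s0' sh' h0' (lexx h).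
have n0 := small s 0 s0' sh' (lexx 0) h0'.
have b1 : `|s *: e_ a + h *: e_ b| < d1.
  by apply: le_lt_trans h1; apply: (le_trans n1); rewrite mulr_natr mulr2n lerD.
have b0 : `|s *: e_ a + 0 *: e_ b| < d1.
  apply: le_lt_trans h1; apply: (le_trans n0); rewrite mulr_natr mulr2n; lra.
move: (hd1 _ b1) (hd1 _ b0); rewrite -/g => /ler_normlP [l1 r1] /ler_normlP [l0 r0].
have dE : 'd g p (s *: e_ a + h *: e_ b) - 'd g p (s *: e_ a + 0 *: e_ b) = h * pd g b p.
  by rewrite -linearB /= scale0r addr0 addrAC subrr add0r linearZ /= /pd deriveE.
rewrite -/g.
have c1 : eps / 3 * `|s *: e_ a + h *: e_ b| <= eps / 3 * (2 * h).
  by rewrite ler_pM2l //; apply: (le_trans n1); lra.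
have c0 : eps / 3 * `|s *: e_ a + 0 *: e_ b| <= eps / 3 * h.
  by rewrite ler_pM2l //; apply: (le_trans n0); lra.
move: l1 r1 l0 r0 dE c1 c0 => /=.
move: (g (s *: e_ a + h *: e_ b + p)) (g (s *: e_ a + 0 *: e_ b + p)) (pd g b p) => A1 A0 D.
move: ('d g p (s *: e_ a + h *: e_ b)) ('d g p (s *: e_ a + 0 *: e_ b)) (g p) => E1 E0 A.
move=> l1 r1 l0 r0 dE c1 c0.
have -> : (A1 - A0) * h - h * h * D = h * (A1 - A0 - h * D) by ring.
rewrite normrM (gtr0_norm h0) [leRHS]mulrCA ler_pM2l //.
have -> : eps * h = 3 * (eps / 3 * h) by field.
rewrite mulrCA in c1; move: l1 r1 l0 r0 c1 c0 dE.
move: (eps / 3 * _) (eps / 3 * _) (eps / 3 * h) (h * D) => X1 X0 K hD l1 r1 l0 r0 c1 c0 dE.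
by apply/ler_normlP; split; lra.
Qed.

(** Both mixed derivatives times h^2 approximate the same second difference, which is symmetric in a
    and b; a nonzero discrepancy N would be at most 2N/3. *)
Lemma pd_comm U f p a b : open U -> U p ->
  (forall q, U q -> differentiable f q) -> differentiable (pd f a) p ->
  differentiable (pd f b) p -> pd (pd f a) b p = pd (pd f b) a p.
Proof.
move=> oU Up df da db; apply/eqP; rewrite -subr_eq0 -normr_eq0; apply/negPn/negP => ne.
have ne0 : 0 < `|pd (pd f a) b p - pd (pd f b) a p| by rewrite lt_def ne normr_ge0.
set N := `|_| in ne0.
have e0 : 0 < N / 3 by rewrite divr_gt0.
have [d1 d10 h1] := second_diff_approx b oU Up df da e0.
have [d2 d20 h2] := second_diff_approx a oU Up df db e0.
pose h := Num.min d1 d2 / 2.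
have h0 : 0 < h by rewrite divr_gt0 // lt_min d10.
have hlt : h < Num.min d1 d2.
  by rewrite /h ltr_pdivrMr // ltr_pMr ?ltr1n // lt_min d10.
move: hlt; rewrite lt_min => /andP [hd1 hd2].
have := h1 h; rewrite h0 hd1 => /(_ isT) k1.
have := h2 h; rewrite h0 hd2 second_diffC => /(_ isT) k2.
have : N * (h * h) <= N / 3 * (h * h) + N / 3 * (h * h).
  have -> : N * (h * h) = `|(pd (pd f a) b p - pd (pd f b) a p) * (h * h)|.
    by rewrite normrM [`|h * h|]ger0_norm // mulr_ge0 // ltW.
  apply: le_trans (lerD k1 k2); rewrite -[X in _ <= X + _]normrN.
  apply: le_trans (ler_normD _ _); rewrite le_eqVlt; apply/orP; left; apply/eqP.
  congr (`|_|); clear; move: (second_diff _ _ _ _ _) (pd _ _ _) (pd _ _ _) (h * h) => x y z t.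
  by ring.
rewrite -mulrDl ler_pM2r ?(mulr_gt0 h0 h0) // => le; move: ne0 le; rewrite -/N.
by clear; move: N => x ne0 le; lra.
Qed.

End Schwarz.

Section ChainRule.
Variables (R : realType) (n : nat).
Local Notation V := 'rV[R]_n.
Implicit Types (f g : V -> R) (U : set V) (p q : V) (a b : 'I_n).

Lemma differentiable_row (y : V -> V) p :
  (forall b, differentiable (fun q => y q 0 b) p) -> differentiable y p.
Proof.
move=> h; rewrite (_ : y = \sum_b (fun q => y q 0 b *: delta_mx 0 b)).
  by apply: differentiable_sum => b; apply: differentiableZl; exact: h.
apply/funext => q; rewrite fct_sumE; exact: row_sum_delta.
Qed.

Lemma pd_comp f (y : V -> V) a p :
  (forall b, differentiable (fun q => y q 0 b) p) -> differentiable f (y p) ->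
  differentiable (f \o y) p /\
  pd (f \o y) a p = \sum_b pd f b (y p) * pd (fun q => y q 0 b) a p.
Proof.
move=> hy df; have dy := differentiable_row hy.
split; first exact: differentiable_comp.
rewrite /pd deriveE; last exact: differentiable_comp.
rewrite diff_comp //= [X in 'd f _ X]row_sum_delta linear_sum /=.
apply: eq_bigr => b _; rewrite linearZ /= mulrC; congr (_ * _).
  by rewrite -deriveE // derive_mx ?mxE //; exact: diff_derivable.
by rewrite deriveE.
Qed.

End ChainRule.
HB.lock Definition dmx (R : realType) (n k l : nat) (F : 'rV[R]_n -> 'M[R]_(k, l))
    (a : 'I_n) (p : 'rV[R]_n) : 'M[R]_(k, l) :=
  \matrix_(i, j) pd (fun q => F q i j) a p.

(** * Derivatives of matrix-valued functions *)

Section MatrixCalculus.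
Variables (R : realType) (n : nat).
Local Notation V := 'rV[R]_n.
Implicit Types (U : set V) (p q : V) (a b : 'I_n).

Definition mxdiff k l (F : V -> 'M[R]_(k, l)) p : Prop :=
  forall i j, differentiable (fun q => F q i j) p.

Definition mxsmooth k l U (F : V -> 'M[R]_(k, l)) : Prop :=
  forall i j, smooth_on U (fun q => F q i j).

Lemma dmxE k l (F : V -> 'M[R]_(k, l)) a p i j : dmx F a p i j = pd (fun q => F q i j) a p.
Proof. by rewrite unlock mxE. Qed.

Lemma mxsmooth_diff k l U (F : V -> 'M[R]_(k, l)) p : mxsmooth U F -> U p -> mxdiff F p.
Proof. by move=> h Up i j; exact: smooth_on_diff (h i j) Up. Qed.

Lemma dmx_eq_on k l U (F H : V -> 'M[R]_(k, l)) a p : open U -> U p ->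
  (forall q, U q -> F q = H q) -> dmx F a p = dmx H a p.
Proof.
move=> oU Up e; apply/matrixP => i j; rewrite !dmxE.
by apply: (eq_on_pd _ oU Up) => q Uq; rewrite e.
Qed.

Lemma mxsmooth_ext k l U (F H : V -> 'M[R]_(k, l)) : open U ->
  (forall q, U q -> F q = H q) -> mxsmooth U F -> mxsmooth U H.
Proof.
by move=> oU e h i j; apply: smooth_on_ext (h i j) => // q Uq; rewrite e.
Qed.

Lemma mxdiff_cst k l (C : 'M[R]_(k, l)) p : mxdiff (fun=> C) p.
Proof. by move=> i j; exact: differentiable_cst. Qed.

Lemma dmx_cst k l (C : 'M[R]_(k, l)) a p : dmx (fun=> C) a p = 0.
Proof. by apply/matrixP => i j; rewrite dmxE mxE pd_cst. Qed.

Lemma mxsmooth_cst k l U (C : 'M[R]_(k, l)) : mxsmooth U (fun=> C).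
Proof. by move=> i j; exact: smooth_on_cst. Qed.

Lemma mxdiffD k l (F H : V -> 'M[R]_(k, l)) p : mxdiff F p -> mxdiff H p ->
  mxdiff (fun q => F q + H q) p.
Proof.
move=> dF dH i j; rewrite (_ : (fun _ => _) = fun q => F q i j + H q i j).
  by apply: differentiableD; [exact: dF|exact: dH].
by apply/funext => q; rewrite mxE.
Qed.

Lemma dmxD k l (F H : V -> 'M[R]_(k, l)) a p : mxdiff F p -> mxdiff H p ->
  dmx (fun q => F q + H q) a p = dmx F a p + dmx H a p.
Proof.
move=> dF dH; apply/matrixP => i j; rewrite dmxE mxE !dmxE -pdD; last 2 first.
- exact: dF.
- exact: dH.
by congr (pd _ a p); apply/funext => q; rewrite mxE.
Qed.

Lemma mxsmoothD k l U (F H : V -> 'M[R]_(k, l)) : open U -> mxsmooth U F -> mxsmooth U H ->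
  mxsmooth U (fun q => F q + H q).
Proof.
move=> oU sF sH i j; apply: smooth_on_ext (smooth_onD oU (sF i j) (sH i j)) => // q _.
by rewrite mxE.
Qed.

Lemma mxdiffN k l (F : V -> 'M[R]_(k, l)) p : mxdiff F p -> mxdiff (fun q => - F q) p.
Proof.
move=> dF i j; rewrite (_ : (fun _ => _) = fun q => - F q i j).
  by apply: differentiableN; exact: dF.
by apply/funext => q; rewrite mxE.
Qed.

Lemma dmxN k l (F : V -> 'M[R]_(k, l)) a p : mxdiff F p ->
  dmx (fun q => - F q) a p = - dmx F a p.
Proof.
move=> dF; apply/matrixP => i j; rewrite dmxE mxE !dmxE -pdN; last exact: dF.
by congr (pd _ a p); apply/funext => q; rewrite mxE.
Qed.

Lemma mxsmoothN k l U (F : V -> 'M[R]_(k, l)) : open U -> mxsmooth U F ->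
  mxsmooth U (fun q => - F q).
Proof.
by move=> oU sF i j; apply: smooth_on_ext (smooth_onN oU (sF i j)) => // q _; rewrite mxE.
Qed.

Lemma mxdiffM k l m (F : V -> 'M[R]_(k, l)) (H : V -> 'M[R]_(l, m)) p :
  mxdiff F p -> mxdiff H p -> mxdiff (fun q => F q *m H q) p.
Proof.
move=> dF dH i j; rewrite (_ : (fun _ => _) = fun q => \sum_c F q i c * H q c j).
  have d c : true -> differentiable (fun q => F q i c * H q c j) p.
    by move=> _; apply: differentiableM; [exact: dF|exact: dH].
  exact: (differentiable_bigsum d).
by apply/funext => q; rewrite mxE.
Qed.

Lemma dmxM k l m (F : V -> 'M[R]_(k, l)) (H : V -> 'M[R]_(l, m)) a p :
  mxdiff F p -> mxdiff H p ->
  dmx (fun q => F q *m H q) a p = dmx F a p *m H p + F p *m dmx H a p.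
Proof.
move=> dF dH; apply/matrixP => i j; rewrite dmxE !mxE -big_split /=.
have d c : true -> differentiable (fun q => F q i c * H q c j) p.
  by move=> _; apply: differentiableM; [exact: dF|exact: dH].
have e := pd_sum (F := fun c q => F q i c * H q c j) a d.
rewrite (_ : (fun _ => _) = fun q => \sum_c F q i c * H q c j); last first.
  by apply/funext => q; rewrite mxE.
rewrite e; apply: eq_bigr => c _.
by rewrite pdM ?dmxE.
Qed.

Lemma mxsmoothM k l m U (F : V -> 'M[R]_(k, l)) (H : V -> 'M[R]_(l, m)) :
  open U -> mxsmooth U F -> mxsmooth U H -> mxsmooth U (fun q => F q *m H q).
Proof.
move=> oU sF sH i j.
apply: (@smooth_on_ext _ _ _ (fun q => \sum_c F q i c * H q c j)) => //.
  by move=> q _; rewrite mxE.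
by apply: smooth_on_sum => // c; apply: smooth_onM.
Qed.

Lemma dmx_sum k l (I : finType) (F : I -> V -> 'M[R]_(k, l)) a p :
  (forall i, mxdiff (F i) p) -> mxdiff (fun q => \sum_i F i q) p /\
  dmx (fun q => \sum_i F i q) a p = \sum_i dmx (F i) a p.
Proof.
move=> dF; have e r c : (fun q => (\sum_i F i q) r c) = fun q => \sum_i F i q r c.
  by apply/funext => q; rewrite summxE.
have d r c i : true -> differentiable (fun q => F i q r c) p by move=> _; exact: dF.
split=> [r c|]; first by rewrite e; exact: (differentiable_bigsum (d r c)).
apply/matrixP => r c; rewrite dmxE e (pd_sum a (d r c)) summxE.
by apply: eq_bigr => i _; rewrite dmxE.
Qed.

Lemma mxdiff_tr k l (F : V -> 'M[R]_(k, l)) p : mxdiff F p -> mxdiff (fun q => (F q)^T) p.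
Proof.
move=> dF i j; rewrite (_ : (fun _ => _) = fun q => F q j i) //.
by apply/funext => q; rewrite mxE.
Qed.

Lemma dmx_tr k l (F : V -> 'M[R]_(k, l)) a p :
  dmx (fun q => (F q)^T) a p = (dmx F a p)^T.
Proof.
apply/matrixP => i j; rewrite dmxE [RHS]mxE dmxE; congr (pd _ a p).
by apply/funext => q; rewrite mxE.
Qed.

Lemma mxsmooth_tr k l U (F : V -> 'M[R]_(k, l)) : open U -> mxsmooth U F ->
  mxsmooth U (fun q => (F q)^T).
Proof. by move=> oU sF i j; apply: smooth_on_ext (sF j i) => // q _; rewrite mxE. Qed.

Lemma mxdiffZ k l (c : V -> R) (F : V -> 'M[R]_(k, l)) p :
  differentiable c p -> mxdiff F p -> mxdiff (fun q => c q *: F q) p.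
Proof.
move=> dc dF i j; rewrite (_ : (fun _ => _) = fun q => c q * F q i j).
  by apply: differentiableM => //; exact: dF.
by apply/funext => q; rewrite mxE.
Qed.

Lemma dmxZ k l (c : V -> R) (F : V -> 'M[R]_(k, l)) a p :
  differentiable c p -> mxdiff F p ->
  dmx (fun q => c q *: F q) a p = pd c a p *: F p + c p *: dmx F a p.
Proof.
move=> dc dF; apply/matrixP => i j; rewrite dmxE !mxE dmxE -(pdM (f := c) (g := fun q => F q i j)) //.
by congr (pd _ a p); apply/funext => q; rewrite mxE.
Qed.

Lemma mxsmoothZ k l U (c : V -> R) (F : V -> 'M[R]_(k, l)) : open U ->
  smooth_on U c -> mxsmooth U F -> mxsmooth U (fun q => c q *: F q).
Proof.
move=> oU sc sF i j; apply: smooth_on_ext (smooth_onM oU sc (sF i j)) => // q _.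
by rewrite mxE.
Qed.

Lemma mxsmooth_dmx k l U (F : V -> 'M[R]_(k, l)) a : mxsmooth U F ->
  mxsmooth U (dmx F a).
Proof.
move=> sF i j; rewrite (_ : (fun _ => _) = pd (fun q => F q i j) a).
  exact: smooth_on_pd.
by apply/funext => q; rewrite dmxE.
Qed.

Lemma dmx_comm k l U (F : V -> 'M[R]_(k, l)) a b p : open U -> U p -> mxsmooth U F ->
  dmx (dmx F a) b p = dmx (dmx F b) a p.
Proof.
move=> oU Up sF; apply/matrixP => i j; rewrite !dmxE.
have e c : (fun q => dmx F c q i j) = pd (fun q => F q i j) c.
  by apply/funext => q; rewrite dmxE.
rewrite !e; apply: (pd_comm oU Up).
- by move=> q Uq; exact: smooth_on_diff (sF i j) Uq.
- by apply: smooth_on_diff Up; exact: smooth_on_pd.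
- by apply: smooth_on_diff Up; exact: smooth_on_pd.
Qed.

Lemma smooth_on_tr k U (F : V -> 'M[R]_k) : open U -> mxsmooth U F ->
  smooth_on U (fun q => \tr (F q)).
Proof. by move=> oU sF; apply: smooth_on_sum => // i; exact: sF. Qed.

Lemma pd_tr k (F : V -> 'M[R]_k) a p : mxdiff F p ->
  pd (fun q => \tr (F q)) a p = \tr (dmx F a p).
Proof.
move=> dF; rewrite (pd_sum (F := fun i q => F q i i)) //.
by apply: eq_bigr => i _; rewrite dmxE.
Qed.

Lemma smooth_on_det k U (F : V -> 'M[R]_k) : open U -> mxsmooth U F ->
  smooth_on U (fun q => \det (F q)).
Proof.
move=> oU sF; apply: smooth_on_sum => // s; apply: smooth_onZ => //.
by apply: smooth_on_prod => // i; exact: sF.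
Qed.

(** Cramer's rule reduces this to determinants and one reciprocal. *)
Lemma mxsmooth_inv k U (F : V -> 'M[R]_k) : open U -> mxsmooth U F ->
  (forall q, U q -> F q \in unitmx) -> mxsmooth U (fun q => invmx (F q)).
Proof.
move=> oU sF uF i j.
apply: (@smooth_on_ext _ _ _ (fun q => (\det (F q))^-1 * cofactor (F q) j i)) => //.
  by move=> q Uq; rewrite /invmx uF // !mxE.
apply: smooth_onM => //.
  apply: smooth_onV => //; last exact: smooth_on_det.
  by move=> q Uq; rewrite -unitfE -unitmxE uF.
apply: smooth_onZ => //; apply: smooth_on_det => // i' j'.
by apply: smooth_on_ext (sF (lift j i') (lift i j')) => // q _; rewrite !mxE.
Qed.

Lemma differentiable_bigprod (I : finType) (f : I -> V -> R) p :
  (forall i, differentiable (f i) p) -> differentiable (fun q => \prod_i f i q) p.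
Proof.
move=> df; elim: (index_enum I) => [|i s d].
  rewrite (_ : (fun _ => _) = fun=> 1); first exact: differentiable_cst.
  by apply/funext => q; rewrite big_nil.
rewrite (_ : (fun _ => _) = fun q => f i q * \prod_(i <- s) f i q).
  by apply: differentiableM.
by apply/funext => q; rewrite big_cons.
Qed.

Lemma pd_prod (I : finType) (f : I -> V -> R) a p :
  (forall i, differentiable (f i) p) ->
  pd (fun q => \prod_i f i q) a p
  = \sum_i pd (f i) a p * \prod_(j | j != i) f j p.
Proof.
move=> df.
have h : forall s : seq I, uniq s -> differentiable (fun q => \prod_(i <- s) f i q) p /\
    pd (fun q => \prod_(i <- s) f i q) a p
    = \sum_(i <- s) pd (f i) a p * \prod_(j <- s | j != i) f j p.
  elim=> [_|i s IH /= /andP [si us]].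
    rewrite (_ : (fun _ => _) = fun=> 1); last by apply/funext => q; rewrite big_nil.
    by split; [exact: differentiable_cst|rewrite pd_cst big_nil].
  have [d e] := IH us.
  rewrite (_ : (fun _ => _) = fun q => f i q * \prod_(i <- s) f i q); last first.
    by apply/funext => q; rewrite big_cons.
  split; first exact: differentiableM.
  rewrite pdM // e big_cons big_cons eqxx /= mulr_sumr; congr (_ * _ + _).
    rewrite big_seq [RHS]big_seq_cond; apply: eq_bigl => j.
    by have [->|] := eqVneq j i; rewrite ?andbT ?(negPf si).
  rewrite big_seq [RHS]big_seq; apply: eq_bigr => j js.
  rewrite big_cons; have [ij|_] := eqVneq i j; first by rewrite ij js in si.
  by rewrite mulrCA.
by rewrite (h (index_enum I) (index_enum_uniq I)).2.
Qed.

(** Jacobi's formula. The Leibniz sum differentiates one row at a time, and the determinant with row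
    i differentiated, expanded along that row, gives the cofactors in the adjugate. *)
Lemma pd_det k (F : V -> 'M[R]_k) a p : mxdiff F p ->
  pd (fun q => \det (F q)) a p = \tr (dmx F a p *m \adj (F p)).
Proof.
move=> dF.
have -> : \tr (dmx F a p *m \adj (F p)) =
    \sum_i \det (\matrix_(r, c) if r == i then dmx F a p i c else F p r c).
  apply: eq_bigr => i _; rewrite [LHS]mxE (expand_det_row _ i); apply: eq_bigr => c _.
  rewrite [in RHS]mxE eqxx; congr (_ * _); rewrite [LHS]mxE; congr (_ * \det _).
  by apply/matrixP => r c'; rewrite !mxE eq_sym (negPf (neq_lift _ _)).
have dp (s : 'S_k) : differentiable (fun q => \prod_i F q i (s i)) p.
  by apply: differentiable_bigprod => i; exact: dF.
have dd (s : 'S_k) : true -> differentiable (fun q => (-1) ^+ s * \prod_i F q i (s i)) p.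
  by move=> _; apply: differentiableM => //; exact: differentiable_cst.
rewrite (pd_sum (F := fun (s : 'S_k) q => (-1) ^+ s * \prod_i F q i (s i)) a dd).
rewrite /determinant exchange_big /=; apply: eq_bigr => s _.
rewrite pdM ?pd_cst ?mul0r ?add0r //.
rewrite pd_prod; last by move=> i; exact: dF.
rewrite mulr_sumr; apply: eq_bigr => i _; congr (_ * _).
rewrite [RHS](bigD1 i) //= !mxE eqxx dmxE; congr (_ * _).
by apply: eq_bigr => j /negPf ji; rewrite mxE ji.
Qed.

End MatrixCalculus.

(** Products and derivatives become opaque matrices before the entrywise [ring], so products have to
    be distributed and reassociated beforehand. *)
Ltac mx_ring :=
  repeat match goal with
  | |- context [@mulmx ?R ?m ?n ?p ?A ?B] => move: (@mulmx R m n p A B) => ?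
  end;
  repeat match goal with
  | |- context [@dmx ?R ?n ?k ?l ?F ?a ?p] => move: (@dmx R n k l F a p) => ?
  end; apply/matrixP => ? ?; rewrite !mxE; ring.

(** * The Levi-Civita connection in a chart *)

(** A and B are the connection matrices in two directions, [dA] and [dB] their derivatives each in
    the direction of the other. The hypothesis equates the two second derivatives of G obtained from
    dG = G A + A^T G. *)
Lemma commutator_metric (R : comNzRingType) n (G A B dA dB : 'M[R]_n) :
  (G *m B + B^T *m G) *m A + G *m dA + (dA^T *m G + A^T *m (G *m B + B^T *m G))
  = (G *m A + A^T *m G) *m B + G *m dB + (dB^T *m G + B^T *m (G *m A + A^T *m G)) ->
  (dA - dB + B *m A - A *m B)^T *m G = - (G *m (dA - dB + B *m A - A *m B)).
Proof.
move=> /eqP; rewrite -subr_eq0 => /eqP h; apply/eqP; rewrite -addr_eq0 -h; apply/eqP.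
have -> : (dA - dB + B *m A - A *m B)^T = dA^T - dB^T + A^T *m B^T - B^T *m A^T.
  by rewrite -!trmx_mul; apply/matrixP => i j; rewrite !mxE.
rewrite !(mulmxDl, mulmxDr, mulmxN, mulNmx) !mulmxA.
mx_ring.
Qed.

(** [D a b] plays the derivative of C_b in direction a. Torsion-freeness and its derivative make the
    twelve terms cancel in pairs. *)
Lemma torsionfree_bianchi (R : comNzRingType) n (C : 'I_n -> 'M[R]_n) (D : 'I_n -> 'I_n -> 'M[R]_n)
  (e := fun a => delta_mx a 0 : 'cV[R]_n) :
  (forall a b, C a *m e b = C b *m e a) -> (forall c a b, D c a *m e b = D c b *m e a) ->
  forall a b c,
  (D a b - D b a + C a *m C b - C b *m C a) *m e c
  + (D b c - D c b + C b *m C c - C c *m C b) *m e a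
  + (D c a - D a c + C c *m C a - C a *m C c) *m e b = 0.
Proof.
move=> hC hD a b c; rewrite !(mulmxDl, mulNmx) -!mulmxA.
rewrite (hD a b c) (hD b a c) (hD c b a) (hC b c) (hC a c) (hC b a).
by mx_ring.
Qed.

Lemma mxtrace_commutator (R : comNzRingType) n (X Y A B : 'M[R]_n) :
  \tr (X - Y + A *m B - B *m A) = \tr X - \tr Y.
Proof.
by rewrite !mxtraceD !raddfN /= (mxtrace_mulC A) addrK.
Qed.

(** * Bilinear extension from the coordinate frame *)

Section BasisExtension.
Variables (R : realFieldType) (n : nat) (G : 'M[R]_n).
Variable Zb : 'I_n -> 'I_n -> 'M[R]_n.
Local Notation e_ a := (delta_mx a 0 : 'cV[R]_n).

(** A chart gives curvature on pairs of coordinate vectors, whereas the pointwise algebra inserts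
    arbitrary vectors such as v and S x. *)
Definition extend (x y : 'cV[R]_n) : 'M[R]_n :=
  \sum_a \sum_b (x a 0 * y b 0) *: Zb a b.

Lemma extend_basis a b : extend (e_ a) (e_ b) = Zb a b.
Proof.
rewrite /extend (bigD1 a) //= (bigD1 b) //= !mxE !eqxx mulr1 scale1r big1 ?addr0.
  rewrite big1 ?addr0 // => i /negPf ia; rewrite big1 // => j _.
  by rewrite mxE ia mul0r scale0r.
by move=> j /negPf jb; rewrite !mxE jb mulr0 scale0r.
Qed.

Lemma extend_mul_ext (x y z : 'cV[R]_n) (f : 'cV[R]_n -> 'cV[R]_n -> 'cV[R]_n) :
  (forall k x x' y, f (k *: x + x') y = k *: f x y + f x' y) ->
  (forall k x y y', f x (k *: y + y') = k *: f x y + f x y') ->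
  (forall a b, Zb a b *m z = f (e_ a) (e_ b)) -> extend x y *m z = f x y.
Proof.
move=> fl fr h.
have f0l u : f 0 u = 0 by have := fl (-1) 0 0 u; rewrite scaler0 add0r scaleN1r addNr.
have f0r u : f u 0 = 0 by have := fr (-1) u 0 0; rewrite scaler0 add0r scaleN1r addNr.
rewrite [in RHS](colE_sum x) /extend mulmx_suml.
elim/big_rec2: _ => [|a u w _ ->]; first by rewrite f0l.
rewrite fl; congr (_ + _); rewrite [in RHS](colE_sum y) mulmx_suml.
have -> : f (e_ a) (\sum_b y b 0 *: e_ b) = \sum_b y b 0 *: f (e_ a) (e_ b).
  by elim/big_rec2: _ => [|b u' w' _ <-]; [exact: f0r|exact: fr].
by rewrite scaler_sumr; apply: eq_bigr => b _; rewrite -scalemxAl h scalerA.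
Qed.

Lemma extend_curvature_like :
  (forall a b, Zb b a = - Zb a b) ->
  (forall a b, (Zb a b)^T *m G = - (G *m Zb a b)) ->
  (forall a b c, Zb a b *m e_ c + Zb b c *m e_ a + Zb c a *m e_ b = 0) ->
  curvature_like G extend.
Proof.
move=> sk me bi; split.
- move=> k x x' y; rewrite /extend scaler_sumr -big_split; apply: eq_bigr => a _ /=.
  rewrite scaler_sumr -big_split; apply: eq_bigr => b _ /=.
  by rewrite !mxE scalerA -scalerDl mulrDl mulrA.
- move=> x y; rewrite /extend exchange_big /= -sumrN; apply: eq_bigr => a _.
  by rewrite -sumrN; apply: eq_bigr => b _; rewrite sk scalerN mulrC.
- move=> x y; rewrite /extend linear_sum mulmx_suml mulmx_sumr -sumrN.
  apply: eq_bigr => a _; rewrite linear_sum mulmx_suml mulmx_sumr -sumrN.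
  apply: eq_bigr => b _; by rewrite linearZ /= -scalemxAl -scalemxAr me scalerN.
- move=> x y z.
  have ex u v w : extend u v *m w = \sum_a \sum_b \sum_c
      (u a 0 * v b 0 * w c 0) *: (Zb a b *m e_ c).
    rewrite {1}(colE_sum w) /extend mulmx_suml; apply: eq_bigr => a _.
    rewrite mulmx_suml; apply: eq_bigr => b _; rewrite mulmx_sumr.
    by apply: eq_bigr => c _; rewrite -scalemxAl -scalemxAr scalerA.
  rewrite !ex.
  have -> : \sum_a \sum_b \sum_c (y a 0 * z b 0 * x c 0) *: (Zb a b *m e_ c)
      = \sum_a \sum_b \sum_c (x a 0 * y b 0 * z c 0) *: (Zb b c *m e_ a).
    under eq_bigr do rewrite exchange_big /=.
    rewrite exchange_big /=; apply: eq_bigr => a _; apply: eq_bigr => b _.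
    by apply: eq_bigr => c _; rewrite mulrC mulrA.
  have -> : \sum_a \sum_b \sum_c (z a 0 * x b 0 * y c 0) *: (Zb a b *m e_ c)
      = \sum_a \sum_b \sum_c (x a 0 * y b 0 * z c 0) *: (Zb c a *m e_ b).
    rewrite exchange_big /=; apply: eq_bigr => a _; rewrite exchange_big /=.
    by apply: eq_bigr => b _; apply: eq_bigr => c _; rewrite -mulrA mulrC.
  rewrite -!big_split /=; apply: big1 => a _; rewrite -!big_split /=.
  apply: big1 => b _; rewrite -!big_split /=; apply: big1 => c _.
  by rewrite -!scalerDr bi scaler0.
Qed.

Hypotheses (Gsym : G^T = G) (Gunit : G \in unitmx).

(** Once the trace is written with g^{-1}, pair symmetry and the symmetry of g^{-1} exchange y and
    w. *)
Lemma ricci_sym Z (y w : 'cV[R]_n) : curvature_like G Z ->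
  \sum_a (Z (e_ a) y *m w) a 0 = \sum_a (Z (e_ a) w *m y) a 0.
Proof.
move=> cl.
have ex y' w' : \sum_a (Z (e_ a) y' *m w') a 0
    = \sum_a \sum_b invmx G a b * low G Z (e_ a) y' (e_ b) w'.
  apply: eq_bigr => a _.
  rewrite -{1}[Z _ _](mulKmx Gunit) -mulmxA [LHS]mxE; apply: eq_bigr => b _.
  by rewrite /low dotcC dotc_delta.
rewrite !ex exchange_big /=; apply: eq_bigr => a _; apply: eq_bigr => b _.
rewrite (low_pair Gsym cl); congr (_ * _).
by rewrite -[in LHS]Gsym -trmx_inv mxE.
Qed.

End BasisExtension.

(** The connection matrix Gamma_a, so that nabla_a v = d_a v + Gamma_a v on vector fields. *)
HB.lock Definition conn (R : realType) (n : nat) (G : 'rV[R]_n -> 'M[R]_n) (a : 'I_n)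
    (p : 'rV[R]_n) : 'M[R]_n := \matrix_(c, b) christoffel G c a b p.

HB.lock Definition curv (R : realType) (n : nat) (G : 'rV[R]_n -> 'M[R]_n) (l k : 'I_n)
    (p : 'rV[R]_n) : 'M[R]_n :=
  dmx (conn G k) l p - dmx (conn G l) k p
  + conn G l p *m conn G k p - conn G k p *m conn G l p.

(** * Levi-Civita connection and curvature in matrix form *)

Section LocalGeometry.
Variables (R : realType) (n : nat) (U : set 'rV[R]_n) (G : 'rV[R]_n -> 'M[R]_n).
Hypotheses (oU : open U) (Gsm : mxsmooth U G) (Gsym : forall p, U p -> (G p)^T = G p)
  (Gunit : forall p, U p -> G p \in unitmx).
Local Notation e_ a := (delta_mx a 0 : 'cV[R]_n).

Lemma connE a b c p : conn G a p c b = christoffel G c a b p.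
Proof. by rewrite unlock mxE. Qed.

Lemma conn_trace a p : christoffel_trace G a p = \tr (conn G a p).
Proof. by apply: eq_bigr => b _; rewrite connE. Qed.

Lemma GsymE p b d : U p -> G p b d = G p d b.
Proof. by move=> Up; rewrite -{1}(Gsym Up) mxE. Qed.

Lemma pd_GsymE p a b d : U p -> pd (fun q => G q b d) a p = pd (fun q => G q d b) a p.
Proof. by move=> Up; apply: (eq_on_pd _ oU Up) => q; exact: GsymE. Qed.

Lemma conn_smooth a : mxsmooth U (conn G a).
Proof.
move=> c b; apply: (@smooth_on_ext _ _ _ (fun p => christoffel G c a b p)) => //.
  by move=> q _; rewrite connE.
apply: smooth_onZ => //; apply: smooth_on_sum => // d; apply: smooth_onM => //.
  exact: mxsmooth_inv.
by apply: smooth_onB => //; [apply: smooth_onD => //|]; apply: smooth_on_pd; exact: Gsm.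
Qed.

Lemma conn_sym a b p : U p -> conn G a p *m e_ b = conn G b p *m e_ a.
Proof.
move=> Up; apply/colP => c; rewrite -!colE !mxE !connE /christoffel; congr (_ * _).
apply: eq_bigr => d _; rewrite (pd_GsymE d a b Up); congr (_ * _); ring.
Qed.

Lemma low_conn a p : U p -> G p *m conn G a p = \matrix_(d, b) (2^-1 *
  (pd (fun q => G q b d) a p + pd (fun q => G q a d) b p - pd (fun q => G q a b) d p)).
Proof.
move=> Up; pose T : 'M[R]_n := \matrix_(d, b) (2^-1 *
  (pd (fun q => G q b d) a p + pd (fun q => G q a d) b p - pd (fun q => G q a b) d p)).
have -> : conn G a p = invmx (G p) *m T.
  apply/matrixP => c b; rewrite connE mxE /christoffel mulr_sumr; apply: eq_bigr => d _.
  by rewrite mxE mulrCA.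
by rewrite mulKVmx ?Gunit.
Qed.

Lemma conn_metric a p : U p -> dmx G a p = G p *m conn G a p + (conn G a p)^T *m G p.
Proof.
move=> Up; rewrite -[X in _ + _ *m X](Gsym Up) -trmx_mul low_conn //.
apply/matrixP => d b; rewrite dmxE !mxE (pd_GsymE a b d Up) (pd_GsymE b a d Up).
rewrite (pd_GsymE d a b Up) (pd_GsymE b d a Up); by field.
Qed.

Lemma curvE l k p : curv G l k p = dmx (conn G k) l p - dmx (conn G l) k p
  + conn G l p *m conn G k p - conn G k p *m conn G l p.
Proof. by rewrite unlock. Qed.

Lemma riemannE j i l k p : riemann G j i l k p = curv G l k p j i.
Proof.
have e a b c : (fun q => conn G b q a c) = christoffel G a b c.
  by apply/funext => q; rewrite connE.
rewrite /riemann curvE !mxE !dmxE !e -addrA; congr (_ + _).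
by rewrite sumrB; congr (_ - _); apply: eq_bigr => m _; rewrite !connE.
Qed.

Lemma curv_skew l k p : curv G k l p = - curv G l k p.
Proof. by rewrite !curvE; mx_ring. Qed.

Lemma curv_metric l k p : U p -> (curv G l k p)^T *m G p = - (G p *m curv G l k p).
Proof.
move=> Up; have dG q : U q -> mxdiff G q by exact: mxsmooth_diff.
have dc a : mxdiff (conn G a) p by apply: mxsmooth_diff Up; exact: conn_smooth.
have e a b : dmx (dmx G a) b p = dmx G b p *m conn G a p + G p *m dmx (conn G a) b p
    + ((dmx (conn G a) b p)^T *m G p + (conn G a p)^T *m dmx G b p).
  rewrite (dmx_eq_on (H := fun q => G q *m conn G a q + (conn G a q)^T *m G q) b oU Up).
    rewrite dmxD; last 2 first.
    - by apply: mxdiffM => //; exact: dG.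
    - by apply: mxdiffM; [exact: mxdiff_tr|exact: dG].
    by rewrite !dmxM ?dmx_tr //; [exact: mxdiff_tr|exact: dG|exact: dG].
  by move=> q; exact: conn_metric.
have := dmx_comm k l oU Up Gsm; rewrite !e !(conn_metric _ Up).
by rewrite !curvE; exact: commutator_metric.
Qed.

Lemma curv_bianchi a b c p : U p ->
  curv G a b p *m e_ c + curv G b c p *m e_ a + curv G c a p *m e_ b = 0.
Proof.
move=> Up; have dc a' : mxdiff (conn G a') p by apply: mxsmooth_diff Up; exact: conn_smooth.
have e i k j : dmx (conn G i) k p *m e_ j = dmx (conn G j) k p *m e_ i.
  have ed i' j' : dmx (conn G i') k p *m e_ j' = dmx (fun q => conn G i' q *m e_ j') k p.
    by rewrite dmxM ?dmx_cst ?mulmx0 ?addr0 //; exact: mxdiff_cst.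
  transitivity (dmx (fun q => conn G i q *m e_ j) k p); first exact: ed.
  rewrite [RHS]ed; apply: (dmx_eq_on _ oU Up) => q Uq; exact: conn_sym.
rewrite !curvE; apply: (@torsionfree_bianchi _ _ (fun a => conn G a p) (fun a b => dmx (conn G b) a p)) => [i j|i j k].
  exact: conn_sym.
exact: e.
Qed.

(** An endomorphism skew for g is conjugate to minus its transpose. *)
Lemma curv_trace l k p : U p -> \tr (curv G l k p) = 0.
Proof.
move=> Up; have e : \tr (curv G l k p) = - \tr (curv G l k p).
  rewrite -{1}mxtrace_tr -{1}[(curv G l k p)^T](mulmxK (Gunit Up)) curv_metric //.
  by rewrite mulNmx linearN /= mxtrace_mulC mulKmx ?Gunit.
lra.
Qed.

(** The trace of the curvature is the exterior derivative of the trace of Gamma. Hence density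
    bundles are flat, and the weights contribute no curvature to the commutators below. *)
Lemma conn_trace_closed a b p : U p ->
  pd (christoffel_trace G a) b p = pd (christoffel_trace G b) a p.
Proof.
move=> Up; have dc a' : mxdiff (conn G a') p by apply: mxsmooth_diff Up; exact: conn_smooth.
have e c d : pd (christoffel_trace G c) d p = \tr (dmx (conn G c) d p).
  rewrite -(pd_tr d (dc c)); congr (pd _ d p).
  by apply/funext => q; exact: conn_trace.
have := curv_trace b a Up; rewrite curvE mxtrace_commutator => /eqP.
by rewrite subr_eq0 e e => /eqP.
Qed.

End LocalGeometry.

(** * Prolongation in a chart *)

Section CommutatorAlgebra.
Variables (R : realFieldType) (n : nat).
Implicit Types (e mu : 'cV[R]_n) (A G sg : 'M[R]_n).

Lemma sym2Nr (x y : 'cV[R]_n) : sym2 x (- y) = - sym2 x y.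
Proof. by rewrite -scaleN1r sym2Zr scaleN1r. Qed.

(** Plain letters belong to direction a, primed ones to direction b, except that D = d_b Gamma_a and
    D' = d_a Gamma_b. The connection form of E(1) is k, and the single [kd] is d_b k_a = d_a k_b,
    since this form is closed. The long hypothesis is d_b d_a sigma = d_a d_b sigma. *)
Lemma ricci_identity_sigma e e' mu dmu dmu' sg dsg dsg' A A' D D' (k k' kd : R) :
  A *m e' = A' *m e ->
  dsg = - sym2 e mu - (A *m sg + sg *m A^T) + (2 * k) *: sg ->
  dsg' = - sym2 e' mu - (A' *m sg + sg *m A'^T) + (2 * k') *: sg ->
  - sym2 e dmu' - (D *m sg + A *m dsg' + (dsg' *m A^T + sg *m D^T))
    + ((2 * kd) *: sg + (2 * k) *: dsg')
  = - sym2 e' dmu - (D' *m sg + A' *m dsg + (dsg *m A'^T + sg *m D'^T))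
    + ((2 * kd) *: sg + (2 * k') *: dsg) ->
  sym2 e (dmu' + A' *m mu - (2 * k') *: mu) - sym2 e' (dmu + A *m mu - (2 * k) *: mu)
  = (D' - D + A *m A' - A' *m A) *m sg + sg *m (D' - D + A *m A' - A' *m A)^T.
Proof.
move=> he hs hs' /eqP; rewrite -subr_eq0 => /eqP h.
have -> : (D' - D + A *m A' - A' *m A)^T = D'^T - D^T + A'^T *m A^T - A^T *m A'^T.
  by rewrite -!trmx_mul; apply/matrixP => i j; rewrite !mxE.
apply/eqP; rewrite -subr_eq0 -oppr_eq0; apply/eqP; rewrite -[RHS]h hs hs'.
have he' u : u *m e'^T *m A^T = u *m e^T *m A'^T by rewrite -!mulmxA -!trmx_mul he.
rewrite !(sym2Dr, sym2Nr, sym2Zr) /sym2 !trmx_mul.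
rewrite !(mulmxDl, mulmxDr, mulmxN, mulNmx) -?scalemxAl -?scalemxAr !mulmxA he he'.
mx_ring.
Qed.

(** The analogue for mu; here [rho'], [B'] are derivatives in direction a and [rho''], [B''] in
    direction b. The terms B g(mu, e) come from differentiating sigma in B sigma g e. *)
Lemma ricci_identity_mu e e' mu dmu dmu' G sg dsg dsg' A A' D D' dG dG'
    (k k' kd rho rho' rho'' B B' B'' : R) :
  G^T = G -> A *m e' = A' *m e ->
  dsg = - sym2 e mu - (A *m sg + sg *m A^T) + (2 * k) *: sg ->
  dsg' = - sym2 e' mu - (A' *m sg + sg *m A'^T) + (2 * k') *: sg ->
  dG = G *m A + A^T *m G -> dG' = G *m A' + A'^T *m G ->
  dmu = - (rho *: e) + B *: (sg *m G *m e) - A *m mu + (2 * k) *: mu ->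
  dmu' = - (rho *: e') + B *: (sg *m G *m e') - A' *m mu + (2 * k') *: mu ->
  - (rho'' *: e) + (B'' *: (sg *m G *m e) + B *: ((dsg' *m G + sg *m dG') *m e))
    - (D *m mu + A *m dmu') + ((2 * kd) *: mu + (2 * k) *: dmu')
  = - (rho' *: e') + (B' *: (sg *m G *m e') + B *: ((dsg *m G + sg *m dG) *m e'))
    - (D' *m mu + A' *m dmu) + ((2 * kd) *: mu + (2 * k') *: dmu) ->
  (D' - D + A *m A' - A' *m A) *m mu
  = (rho'' - 2 * k' * rho - B * dotc mu (G *m e')) *: e
    - (rho' - 2 * k * rho - B * dotc mu (G *m e)) *: e'
    + B' *: (sg *m G *m e') - B'' *: (sg *m G *m e).
Proof.
move=> Gs he hs hs' hG hG' hm hm' /eqP; rewrite -subr_eq0 => /eqP h.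
have heM u : u *m A *m e' = u *m A' *m e by rewrite -!mulmxA he.
have s1 : e' *m mu^T *m G *m e = dotc mu (G *m e) *: e' by rewrite -!mulmxA mulmxA outer_mul.
have s2 : e *m mu^T *m G *m e' = dotc mu (G *m e') *: e by rewrite -!mulmxA mulmxA outer_mul.
have s3 : mu *m e'^T *m G *m e = mu *m e^T *m G *m e'.
  by rewrite -!mulmxA !(mulmxA mu) !outer_mul dotcA Gs dotcC.
apply/eqP; rewrite -subr_eq0; apply/eqP; rewrite -[RHS]h hs hs' hG hG' hm hm' /sym2.
rewrite !(mulmxDl, mulmxDr, mulmxN, mulNmx) -?scalemxAl -?scalemxAr.
rewrite ?(mulmxDl, mulmxDr, mulmxN, mulNmx) -?scalemxAl -?scalemxAr !mulmxA.
rewrite he !heM s1 s2 s3.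
mx_ring.
Qed.

Lemma covariant_sym A D sg (k : R) : D^T = D -> sg^T = sg ->
  (D + (A *m sg + sg *m A^T) - k *: sg)^T = D + (A *m sg + sg *m A^T) - k *: sg.
Proof.
move=> hD hs; have e : (A *m sg + sg *m A^T)^T = A *m sg + sg *m A^T.
  by rewrite linearD /= !trmx_mul trmxK hs addrC.
by rewrite linearB /= linearD /= linearZ /= hD hs e.
Qed.

Lemma const_curv_metric e e' G F (k : R) : G^T = G -> F^T *m G = - (G *m F) ->
  (F - k *: (e *m e'^T *m G - e' *m e^T *m G))^T *m G
  = - (G *m (F - k *: (e *m e'^T *m G - e' *m e^T *m G))).
Proof.
move=> hG hF.
have -> : (F - k *: (e *m e'^T *m G - e' *m e^T *m G))^T
    = F^T - k *: (G *m e' *m e^T - G *m e *m e'^T).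
  by rewrite linearB /= linearZ /= linearB /= !trmx_mul !trmxK hG !mulmxA.
rewrite mulmxBl mulmxBr hF -scalemxAl -scalemxAr mulmxBl mulmxBr !mulmxA.
mx_ring.
Qed.

Lemma const_curv_bianchi (a b c : 'I_n) G (F1 F2 F3 : 'M[R]_n) (k : R)
  (e := fun i => delta_mx i 0 : 'cV[R]_n)
  (C := fun i j => k *: (e i *m (e j)^T *m G - e j *m (e i)^T *m G)) : G^T = G ->
  F1 *m e c + F2 *m e a + F3 *m e b = 0 ->
  (F1 - C a b) *m e c + (F2 - C b c) *m e a + (F3 - C c a) *m e b = 0.
Proof.
move=> hG h; rewrite !mulmxBl.
have -> : F1 *m e c - C a b *m e c + (F2 *m e a - C b c *m e a) + (F3 *m e b - C c a *m e b)
    = - (C a b *m e c + C b c *m e a + C c a *m e b).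
  by rewrite -[RHS]add0r -h; mx_ring.
have sm i j k' : e i *m (e j)^T *m G *m e k' = dotc (e j) (G *m e k') *: e i.
  by rewrite -mulmxA outer_mul.
have dC i j : dotc (e i) (G *m e j) = dotc (e j) (G *m e i) by rewrite dotcA hG dotcC.
rewrite /C -!scalemxAl !mulmxBl !sm (dC c a) (dC b a) (dC c b).
by rewrite -!scalerDr; apply/matrixP => i j; rewrite !mxE; ring.
Qed.

(** Subtracting k sigma g e from m changes the left side by the action on sigma of the constant
    curvature tensor, so the curvature may be replaced by Z. *)
Lemma const_curv_shift e e' G sg F m m' (k : R) : G^T = G -> sg^T = sg ->
  sym2 e m' - sym2 e' m = F *m sg + sg *m F^T ->
  sym2 e (m' - k *: (sg *m G *m e')) - sym2 e' (m - k *: (sg *m G *m e))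
  = (F - k *: (e *m e'^T *m G - e' *m e^T *m G)) *m sg
    + sg *m (F - k *: (e *m e'^T *m G - e' *m e^T *m G))^T.
Proof.
move=> hG hs h.
have -> : (F - k *: (e *m e'^T *m G - e' *m e^T *m G))^T
    = F^T - k *: (G *m e' *m e^T - G *m e *m e'^T).
  by rewrite linearB /= linearZ /= linearB /= !trmx_mul !trmxK hG !mulmxA.
rewrite mulmxBl mulmxBr -scalemxAl -scalemxAr mulmxBl mulmxBr !mulmxA.
rewrite -!scaleNr !(sym2Dr, sym2Zr) /sym2 in h *.
have -> : (sg *m G *m e')^T = e'^T *m G *m sg by rewrite !trmx_mul hG hs !mulmxA.
have -> : (sg *m G *m e)^T = e^T *m G *m sg by rewrite !trmx_mul hG hs !mulmxA.
rewrite addrACA -h !mulmxA; mx_ring.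
Qed.

Lemma endo_derivative e mu G sg A dsg dG (k : R) :
  dsg = - sym2 e mu - (A *m sg + sg *m A^T) + (2 * k) *: sg ->
  dG = G *m A + A^T *m G ->
  dsg *m G + sg *m dG
  = - (sym2 e mu *m G) - A *m (sg *m G) + sg *m G *m A + (2 * k) *: (sg *m G).
Proof.
move=> -> ->; rewrite !(mulmxDl, mulmxDr, mulmxN, mulNmx) -?scalemxAl !mulmxA.
mx_ring.
Qed.

(** The connection enters the derivative of the endomorphism S through commutators with A, and these
    add up to the commutator of A with a vanishing polynomial. The weight terms in k only change the
    coefficients of S S and S. *)
Lemma quadratic_derivative S dS H A (k c2 c1 c0 c2' c1' c0' : R) :
  dS = H - A *m S + S *m A + (2 * k) *: S ->
  c2 *: (S *m S) + c1 *: S + c0%:M = 0 ->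
  c2' *: (S *m S) + c2 *: (dS *m S + S *m dS) + (c1' *: S + c1 *: dS) + c0'%:M = 0 ->
  c2 *: (H *m S + S *m H) + c1 *: H
  = (- c2' - 4 * k * c2) *: (S *m S) + (- c1' - 2 * k * c1) *: S + (- c0')%:M.
Proof.
move=> hS q; rewrite {}hS => h.
have z : A *m (c2 *: (S *m S) + c1 *: S + c0%:M) - (c2 *: (S *m S) + c1 *: S + c0%:M) *m A = 0.
  by rewrite q mulmx0 mul0mx subrr.
apply/eqP; rewrite -subr_eq0; apply/eqP; rewrite -[RHS]h -[RHS]addr0 -[in RHS]z.
rewrite !(mulmxDl, mulmxDr, mulmxN, mulNmx) -?scalemxAl -?scalemxAr.
rewrite -?scalemxAl mul_scalar_mx mul_mx_scalar !mulmxA.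
mx_ring.
Qed.

End CommutatorAlgebra.

(** The connection form of E(1): weight w contributes w times [kap], hence the - 2 in the
    derivatives below. *)
HB.lock Definition kap (R : realType) (n : nat) (G : 'rV[R]_n -> 'M[R]_n) (a : 'I_n)
    (p : 'rV[R]_n) : R := n.+1%:R^-1 * christoffel_trace G a p.

HB.lock Definition covS2 (R : realType) (n : nat) (G s : 'rV[R]_n -> 'M[R]_n) (a : 'I_n)
    (p : 'rV[R]_n) : 'M[R]_n :=
  dmx s a p + (conn G a p *m s p + s p *m (conn G a p)^T) - (2 * kap G a p) *: s p.

HB.lock Definition covT (R : realType) (n : nat) (G : 'rV[R]_n -> 'M[R]_n)
    (m : 'rV[R]_n -> 'cV[R]_n) (a : 'I_n) (p : 'rV[R]_n) : 'cV[R]_n :=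
  dmx m a p + conn G a p *m m p - (2 * kap G a p) *: m p.

(** The only candidate: tracing the first line of the system over its lower index gives nabla_d
    sigma^{dc} = - (n + 1) mu^c. *)
HB.lock Definition mu_of (R : realType) (n : nat) (G sg : 'rV[R]_n -> 'M[R]_n)
    (p : 'rV[R]_n) : 'cV[R]_n :=
  - n.+1%:R^-1 *: \sum_d (covS2 G sg d p)^T *m delta_mx d 0.

(** The vector m_a of the overview, that is, the mu-slot of the tractor connection without its rho
    term. *)
HB.lock Definition tf_cov (R : realType) (n : nat) (G : 'rV[R]_n -> 'M[R]_n)
    (B : 'rV[R]_n -> R) (sg : 'rV[R]_n -> 'M[R]_n) (a : 'I_n) (p : 'rV[R]_n) : 'cV[R]_n :=
  covT G (mu_of G sg) a p - B p *: (sg p *m G p *m delta_mx a 0).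

HB.lock Definition rho_of (R : realType) (n : nat) (G : 'rV[R]_n -> 'M[R]_n)
    (B : 'rV[R]_n -> R) (sg : 'rV[R]_n -> 'M[R]_n) (p : 'rV[R]_n) : R :=
  - (n%:R^-1 * \sum_d tf_cov G B sg d p d 0).

HB.lock Definition zcurv (R : realType) (n : nat) (G : 'rV[R]_n -> 'M[R]_n)
    (B : 'rV[R]_n -> R) (a b : 'I_n) (p : 'rV[R]_n) : 'M[R]_n :=
  curv G a b p - B p *: (@delta_mx _ n 1 a 0 *m (@delta_mx _ n 1 b 0)^T *m G p
                         - @delta_mx _ n 1 b 0 *m (@delta_mx _ n 1 a 0)^T *m G p).

(** The rho-slot of the tractor connection, nabla_a rho - 2 B g_ab mu^b. One B comes from
    differentiating sigma in the equation for mu, the other from trading the curvature for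
    [zcurv]. *)
HB.lock Definition tau (R : realType) (n : nat) (G : 'rV[R]_n -> 'M[R]_n)
    (B : 'rV[R]_n -> R) (sg : 'rV[R]_n -> 'M[R]_n) (p : 'rV[R]_n) : 'cV[R]_n :=
  \col_a (pd (rho_of G B sg) a p - 2 * kap G a p * rho_of G B sg p
           - 2 * B p * dotc (mu_of G sg p) (G p *m delta_mx a 0)).

HB.lock Definition grad (R : realType) (n : nat) (B : 'rV[R]_n -> R) (p : 'rV[R]_n) :
    'cV[R]_n := \col_a pd B a p.

Section Dotc.
Variables (R : realType) (n : nat).

Lemma smooth_on_dotc (U : set 'rV[R]_n) (x y : 'rV[R]_n -> 'cV[R]_n) :
  open U -> mxsmooth U x -> mxsmooth U y -> smooth_on U (fun p => dotc (x p) (y p)).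
Proof. by move=> oU sx sy; apply: mxsmoothM => //; exact: mxsmooth_tr. Qed.

End Dotc.

(** * From the metrisability equation to the system, in one chart *)

Section Prolongation.
Variables (R : realType) (n : nat) (U N : set 'rV[R]_n).
Variables (G : 'rV[R]_n -> 'M[R]_n) (B : 'rV[R]_n -> R) (sg : 'rV[R]_n -> 'M[R]_n).
Local Notation e_ a := (delta_mx a 0 : 'cV[R]_n).
Implicit Types (m : 'rV[R]_n -> 'cV[R]_n) (p : 'rV[R]_n).

Lemma kapE a p : kap G a p = n.+1%:R^-1 * christoffel_trace G a p.
Proof. by rewrite unlock. Qed.

Lemma covS2E s a p : covS2 G s a p =
  dmx s a p + (conn G a p *m s p + s p *m (conn G a p)^T) - (2 * kap G a p) *: s p.
Proof. by rewrite unlock. Qed.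

Lemma covTE m a p : covT G m a p =
  dmx m a p + conn G a p *m m p - (2 * kap G a p) *: m p.
Proof. by rewrite unlock. Qed.

Lemma mu_ofE c p : mu_of G sg p c 0 = - n.+1%:R^-1 * \sum_d covS2 G sg d p d c.
Proof.
rewrite unlock mxE summxE; congr (_ * _); apply: eq_bigr => d _.
by rewrite -colE !mxE.
Qed.

Lemma tf_covE a p : tf_cov G B sg a p =
  covT G (mu_of G sg) a p - B p *: (sg p *m G p *m e_ a).
Proof. by rewrite unlock. Qed.

Lemma rho_ofE p : rho_of G B sg p = - (n%:R^-1 * \sum_d tf_cov G B sg d p d 0).
Proof. by rewrite unlock. Qed.

Lemma zcurvE a b p : zcurv G B a b p = curv G a b p
  - B p *: (e_ a *m (e_ b)^T *m G p - e_ b *m (e_ a)^T *m G p).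
Proof. by rewrite unlock. Qed.

Lemma tauE a p : tau G B sg p a 0 = pd (rho_of G B sg) a p - 2 * kap G a p * rho_of G B sg p
  - 2 * B p * dotc (mu_of G sg p) (G p *m e_ a).
Proof. by rewrite unlock mxE. Qed.

Lemma gradE a p : grad B p a 0 = pd B a p.
Proof. by rewrite unlock mxE. Qed.

Lemma nabla_S2TE s a b c p : nabla_S2T G (- 2) s a b c p = covS2 G s a p b c.
Proof.
rewrite /nabla_S2T /nabla_E covS2E !mxE dmxE kapE.
have -> : \sum_j conn G a p b j * s p j c = \sum_d christoffel G b a d p * s p d c.
  by apply: eq_bigr => d _; rewrite connE.
have -> : \sum_j s p b j * (conn G a p)^T j c = \sum_d christoffel G c a d p * s p b d.
  by apply: eq_bigr => d _; rewrite mxE connE mulrC.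
by ring.
Qed.

Lemma nabla_TE m a b p : nabla_T G (- 2) m a b p = covT G m a p b 0.
Proof.
rewrite /nabla_T /nabla_E covTE !mxE dmxE kapE.
have -> : \sum_j conn G a p b j * m p j 0 = \sum_d christoffel G b a d p * m p d 0.
  by apply: eq_bigr => d _; rewrite connE.
by ring.
Qed.

Lemma nabla_EE r a p : nabla_E G (- 2) r a p = pd r a p - 2 * kap G a p * r p.
Proof. by rewrite /nabla_E kapE; ring. Qed.

Hypotheses (n_ge2 : (2 <= n)%N) (oU : open U) (Gsm : mxsmooth U G)
  (Gsym : forall p, U p -> (G p)^T = G p) (Gunit : forall p, U p -> G p \in unitmx)
  (Bsm : smooth_on U B) (sgsm : mxsmooth U sg) (sgsym : forall p, U p -> (sg p)^T = sg p).

Lemma kap_smooth a : smooth_on U (kap G a).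
Proof.
apply: (@smooth_on_ext _ _ _ (fun p => n.+1%:R^-1 * \tr (conn G a p))) => //.
  by move=> q _; rewrite kapE conn_trace.
by apply: smooth_onZ => //; apply: smooth_on_tr => //; exact: conn_smooth.
Qed.

Lemma kap_closed a b p : U p -> pd (kap G a) b p = pd (kap G b) a p.
Proof.
move=> Up; have d c : differentiable (christoffel_trace G c) p.
  apply: (eq_on_differentiable (f := fun p => \tr (conn G c p)) oU Up).
    by move=> q _; rewrite conn_trace.
  by apply: smooth_on_diff Up; apply: smooth_on_tr => //; exact: conn_smooth.
have e c c' : pd (kap G c) c' p = n.+1%:R^-1 * pd (christoffel_trace G c) c' p.
  have -> : kap G c = fun q => n.+1%:R^-1 * christoffel_trace G c q.
    by apply/funext => q; exact: kapE.
  have := pdM c' (differentiable_cst (n.+1%:R^-1 : R) p) (d c).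
  by rewrite pd_cst mul0r add0r.
apply: etrans (e a b) (etrans _ (esym (e b a))).
exact: (congr1 _ (conn_trace_closed oU Gsm Gsym Gunit a b Up)).
Qed.

Lemma covS2_smooth s a : mxsmooth U s -> mxsmooth U (covS2 G s a).
Proof.
move=> ss; have cs := conn_smooth oU Gsm Gunit a.
apply: (mxsmooth_ext oU (fun q _ => esym (covS2E s a q))).
apply: mxsmoothD => //; last first.
  apply: mxsmoothN => //; apply: mxsmoothZ => //.
  by apply: smooth_onZ => //; exact: kap_smooth.
apply: mxsmoothD => //; first exact: mxsmooth_dmx.
apply: mxsmoothD => //; apply: mxsmoothM => //; exact: mxsmooth_tr.
Qed.

Lemma covT_smooth m a : mxsmooth U m -> mxsmooth U (covT G m a).
Proof.
move=> ss; have cs := conn_smooth oU Gsm Gunit a.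
apply: (mxsmooth_ext oU (fun q _ => esym (covTE m a q))).
apply: mxsmoothD => //; last first.
  apply: mxsmoothN => //; apply: mxsmoothZ => //.
  by apply: smooth_onZ => //; exact: kap_smooth.
apply: mxsmoothD => //; first exact: mxsmooth_dmx.
exact: mxsmoothM.
Qed.

Lemma covS2_sym s a p : U p -> (forall q, U q -> (s q)^T = s q) ->
  (covS2 G s a p)^T = covS2 G s a p.
Proof.
move=> Up ssym; have ds : (dmx s a p)^T = dmx s a p.
  by rewrite -dmx_tr; exact: (dmx_eq_on _ oU Up).
by rewrite covS2E; apply: covariant_sym => //; exact: ssym.
Qed.

Lemma mu_of_smooth : mxsmooth U (mu_of G sg).
Proof.
move=> i j; apply: (@smooth_on_ext _ _ _ (fun p => - n.+1%:R^-1 * \sum_d covS2 G sg d p d i)) => //.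
  by move=> q _; rewrite (ord1 j) mu_ofE.
by apply: smooth_onZ => //; apply: smooth_on_sum => // d; exact: covS2_smooth.
Qed.

Lemma endo_smooth : mxsmooth U (fun p => sg p *m G p).
Proof. exact: mxsmoothM. Qed.

Lemma tf_cov_smooth a : mxsmooth U (tf_cov G B sg a).
Proof.
apply: (mxsmooth_ext oU (fun q _ => esym (tf_covE a q))).
apply: mxsmoothD => //; first by apply: covT_smooth; exact: mu_of_smooth.
apply: mxsmoothN => //; apply: mxsmoothZ => //; apply: mxsmoothM => //.
  exact: endo_smooth.
exact: mxsmooth_cst.
Qed.

Lemma rho_of_smooth : smooth_on U (rho_of G B sg).
Proof.
apply: (smooth_on_ext oU (fun q _ => esym (rho_ofE q))).
apply: smooth_onN => //; apply: smooth_onZ => //; apply: smooth_on_sum => // d.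
exact: tf_cov_smooth.
Qed.

Hypothesis metris : forall p, U p -> forall a b c,
  tracefree (fun a b c => nabla_S2T G (- 2) sg a b c p) a b c = 0.

Lemma cov_sg a p : U p -> covS2 G sg a p = - sym2 (e_ a) (mu_of G sg p).
Proof.
move=> Up; have ss d b c : covS2 G sg d p b c = covS2 G sg d p c b.
  by rewrite -[in LHS](covS2_sym d Up sgsym) mxE.
apply/matrixP => b c; have := metris Up a b c; rewrite /tracefree nabla_S2TE.
have -> : \sum_d nabla_S2T G (-2) sg d d c p = \sum_d covS2 G sg d p d c.
  by apply: eq_bigr => d _; rewrite nabla_S2TE.
have -> : \sum_d nabla_S2T G (-2) sg d b d p = \sum_d covS2 G sg d p d b.
  by apply: eq_bigr => d _; rewrite nabla_S2TE ss.
move/eqP; rewrite subr_eq0 => /eqP ->.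
rewrite [RHS]mxE [in RHS]mxE !outerE !mu_ofE !mxE !eqxx !andbT ![_ == a]eq_sym.
by ring.
Qed.

Lemma dmx_sg a p : U p -> dmx sg a p = - sym2 (e_ a) (mu_of G sg p)
  - (conn G a p *m sg p + sg p *m (conn G a p)^T) + (2 * kap G a p) *: sg p.
Proof.
by move=> Up; rewrite -(cov_sg a Up) covS2E; mx_ring.
Qed.

Lemma pdZ2 a b p : U p -> pd (fun q => 2 * kap G a q) b p = 2 * pd (kap G a) b p.
Proof.
move=> Up; have dk : differentiable (kap G a) p by exact: smooth_on_diff (kap_smooth a) Up.
by have := pdM b (differentiable_cst (2 : R) p) dk; rewrite pd_cst mul0r add0r.
Qed.

Lemma dmx_dmx_sg a b p : U p -> dmx (dmx sg a) b p =
  - sym2 (e_ a) (dmx (mu_of G sg) b p)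
  - (dmx (conn G a) b p *m sg p + conn G a p *m dmx sg b p
     + (dmx sg b p *m (conn G a p)^T + sg p *m (dmx (conn G a) b p)^T))
  + ((2 * pd (kap G a) b p) *: sg p + (2 * kap G a p) *: dmx sg b p).
Proof.
move=> Up.
have dm : mxdiff (mu_of G sg) p by exact: mxsmooth_diff mu_of_smooth Up.
have ds : mxdiff sg p by exact: mxsmooth_diff sgsm Up.
have dc : mxdiff (conn G a) p by exact: mxsmooth_diff (conn_smooth oU Gsm Gunit a) Up.
have dk : differentiable (fun q => 2 * kap G a q) p.
  by apply: smooth_on_diff Up; apply: smooth_onZ => //; exact: kap_smooth.
have dct := mxdiff_tr dc; have dmt := mxdiff_tr dm.
have d1 := mxdiffM (mxdiff_cst (e_ a) p) dmt.
have d2 := mxdiffM dm (mxdiff_cst (e_ a)^T p).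
have d3 := mxdiffM dc ds; have d4 := mxdiffM ds dct; have d5 := mxdiffZ dk ds.
have d12 := mxdiffD d1 d2; have d34 := mxdiffD d3 d4.
rewrite (dmx_eq_on b oU Up (fun q Uq => dmx_sg a Uq)).
rewrite dmxD; [|exact: (mxdiffD (mxdiffN d12) (mxdiffN d34))|exact: d5].
rewrite dmxD; [|exact: (mxdiffN d12)|exact: (mxdiffN d34)].
rewrite (dmxN b d12) (dmxN b d34) (dmxD b d1 d2) (dmxD b d3 d4).
rewrite (dmxM b (mxdiff_cst (e_ a) p) dmt) (dmxM b dm (mxdiff_cst (e_ a)^T p)).
rewrite (dmxM b dc ds) (dmxM b ds dct) (dmxZ b dk ds) !dmx_cst !dmx_tr pdZ2 //.
by rewrite mul0mx mulmx0 add0r addr0.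
Qed.

Lemma comm_sg a b p : U p ->
  sym2 (e_ a) (covT G (mu_of G sg) b p) - sym2 (e_ b) (covT G (mu_of G sg) a p)
  = curv G a b p *m sg p + sg p *m (curv G a b p)^T.
Proof.
move=> Up; rewrite !covTE curvE; apply: (ricci_identity_sigma (kd := pd (kap G a) b p)
   (conn_sym oU Gsym a b Up) (dmx_sg a Up) (dmx_sg b Up)).
have := dmx_comm a b oU Up sgsm; rewrite (dmx_dmx_sg a b Up) (dmx_dmx_sg b a Up).
by rewrite -(kap_closed a b Up).
Qed.

Lemma zcurv_like p : U p -> curvature_like (G p) (extend (fun a b => zcurv G B a b p)).
Proof.
move=> Up; apply: extend_curvature_like.
- move=> a b; rewrite !zcurvE (curv_skew G a b p).
  by rewrite [RHS]opprB [LHS]addrC -scalerN opprB.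
- move=> a b; rewrite zcurvE; apply: const_curv_metric; first exact: Gsym.
  exact: (curv_metric oU).
- move=> a b c; rewrite !zcurvE; apply: const_curv_bianchi; first exact: Gsym.
  exact: (curv_bianchi oU).
Qed.

Lemma comm_sg_zcurv a b p : U p ->
  sym2 (e_ a) (tf_cov G B sg b p) - sym2 (e_ b) (tf_cov G B sg a p)
  = zcurv G B a b p *m sg p + sg p *m (zcurv G B a b p)^T.
Proof.
move=> Up; rewrite !tf_covE zcurvE; apply: const_curv_shift; [exact: Gsym|exact: sgsym|exact: comm_sg].
Qed.

Lemma curv_like p : U p -> curvature_like (G p) (extend (fun a b => curv G a b p)).
Proof.
move=> Up; apply: extend_curvature_like.
- by move=> a b; exact: curv_skew.
- by move=> a b; exact: (curv_metric oU).
- by move=> a b c; exact: (curv_bianchi oU).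
Qed.

Lemma schouten_sym j k p : U p -> schouten G j k p = schouten G k j p.
Proof.
move=> Up; have e i l : ricci G i l p
    = \sum_a (extend (fun a b => curv G a b p) (e_ a) (e_ l) *m e_ i) a 0.
  by apply: eq_bigr => a _; rewrite riemannE extend_basis -colE [RHS]mxE.
rewrite /schouten !e; congr (_ * _).
exact: (ricci_sym (Gsym Up) (Gunit Up) (e_ k) (e_ j) (curv_like Up)).
Qed.

(** The eigenvector condition with its index lowered; the symmetry of P moves v to the index of P
    that is contracted in [weyl]. *)
Lemma schouten_vec p (v : 'cV[R]_n) : U p ->
  (forall a, \sum_j schouten_up G a j p * v j 0 = B p * v a 0) ->
  forall k, \sum_j schouten G j k p * v j 0 = B p * (G p *m v) k 0.
Proof.
move=> Up h k; pose P : 'M[R]_n := \matrix_(i, j) schouten G i j p.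
have e : invmx (G p) *m (P *m v) = B p *: v.
  apply/colP => a; rewrite [RHS]mxE -h mulmxA mxE; apply: eq_bigr => j _.
  congr (_ * _); rewrite mxE; apply: eq_bigr => i _; by rewrite mxE.
have {}e : P *m v = B p *: (G p *m v).
  by rewrite scalemxAr -e (mulKVmx (Gunit Up)).
have -> : B p * (G p *m v) k 0 = (P *m v) k 0 by rewrite e [RHS]mxE.
by rewrite [RHS]mxE; apply: eq_bigr => j _; rewrite [P k j]mxE (schouten_sym j k Up).
Qed.

(** On v, the Schouten part of W coincides with the constant curvature term subtracted in
    [zcurv]. *)
Lemma zcurv_null p (v : 'cV[R]_n) : U p -> in_nullity G p v ->
  (forall a, \sum_j schouten_up G a j p * v j 0 = B p * v a 0) ->
  forall a b, zcurv G B a b p *m v = 0.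
Proof.
move=> Up [_ wv] /(schouten_vec Up) hv a b; apply/colP => i; rewrite [RHS]mxE.
have := wv i a b; rewrite /weyl.
have r (x d s d' s' w : R) : (x + d * s - d' * s') * w = x * w + d * (s * w) - d' * (s' * w).
  by ring.
under eq_bigr do rewrite r riemannE.
rewrite big_split sumrN big_split /= -!mulr_sumr !hv.
have -> : \sum_j curv G a b p i j * v j 0 = (curv G a b p *m v) i 0 by rewrite mxE.
rewrite zcurvE (mulmxBl (curv G a b p)) -scalemxAl (mulmxBl (e_ a *m _ *m _)) -!(mulmxA _ (G p) v) !outer_mul.
rewrite ![dotc (e_ _) _]dotcC !dotc_delta => h.
rewrite -[RHS]h; move: (curv _ _ _ _ *m v) (G p *m v) => X Y; rewrite !mxE !eqxx !andbT.
by ring.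
Qed.

Lemma extend_null p (v : 'cV[R]_n) : (forall a b, zcurv G B a b p *m v = 0) ->
  forall x y, extend (fun a b => zcurv G B a b p) x y *m v = 0.
Proof.
move=> h x y; rewrite /extend mulmx_suml big1 // => a _.
by rewrite mulmx_suml big1 // => b _; rewrite -scalemxAl h scaler0.
Qed.

Hypotheses (NU : N `<=` U)
  (dN : forall O : set 'rV[R]_n, open O -> O `<=` U -> O !=set0 -> exists2 p, O p & N p)
  (nulN : forall p, N p -> exists2 v : 'cV[R]_n, v != 0 & forall a b, zcurv G B a b p *m v = 0).

Lemma second_equation_null a p : N p -> tf_cov G B sg a p = - (rho_of G B sg p *: e_ a).
Proof.
move=> Np; have Up := NU Np; have [v nv hv] := nulN Np.
have vn := extend_null hv.
have := tracefree_null_vector (Gsym Up) (Gunit Up) (zcurv_like Up) n_ge2 nv vn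
  (sg := sg p) (m := fun a => tf_cov G B sg a p) => ->.
  by rewrite rho_ofE scaleNr opprK.
by move=> i j; rewrite !extend_basis; exact: comm_sg_zcurv.
Qed.

(** Near a point where f is nonzero it stays nonzero, by continuity, and N meets every nonempty open
    subset of U. *)
Lemma dense_zero (f : 'rV[R]_n -> R) : smooth_on U f -> (forall p, N p -> f p = 0) ->
  forall p, U p -> f p = 0.
Proof.
move=> sf f0 p Up; apply/eqP/negPn/negP => fp.
have cf := differentiable_continuous (smooth_on_diff sf Up).
have near_nz : \forall q \near p, f q != 0.
  by apply: (cf [set y | y != 0]); apply: open_nbhs_nbhs; split=> //; exact: open_neq.
have [W [oW Wp] hW] : exists2 W, open_nbhs p W & W `<=` [set q | f q != 0].
  have : nbhs p [set q | f q != 0] by exact: near_nz.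
  by rewrite nbhsE => -[W ? ?]; exists W.
have [q [Wq Uq] Nq] : exists2 q, (W `&` U) q & N q.
  by apply: dN; [exact: openI|move=> q []|exists p].
by have := hW q Wq; rewrite /= f0 ?eqxx.
Qed.

Lemma second_equation a p : U p -> tf_cov G B sg a p = - (rho_of G B sg p *: e_ a).
Proof.
move=> Up; apply/colP => i; apply/eqP; rewrite -subr_eq0; apply/eqP.
pose f q : R := tf_cov G B sg a q i 0 + rho_of G B sg q * (e_ a) i 0.
have -> : tf_cov G B sg a p i 0 - (- (rho_of G B sg p *: e_ a)) i 0 = f p.
  by rewrite [X in _ - X]mxE [X in _ - - X]mxE opprK.
apply: dense_zero => //.
  apply: smooth_onD => //; first exact: tf_cov_smooth.
  by apply: smooth_onM => //; [exact: rho_of_smooth|exact: smooth_on_cst].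
by move=> q Nq; rewrite /f second_equation_null // [X in X + _]mxE [X in - X + _]mxE addNr.
Qed.

Lemma dmx_mu a p : U p -> dmx (mu_of G sg) a p = - (rho_of G B sg p *: e_ a)
  + B p *: (sg p *m G p *m e_ a) - conn G a p *m mu_of G sg p + (2 * kap G a p) *: mu_of G sg p.
Proof.
by move=> Up; rewrite -(second_equation a Up) tf_covE covTE; mx_ring.
Qed.

Lemma dmx_dmx_mu a b p : U p -> dmx (dmx (mu_of G sg) a) b p =
  - (pd (rho_of G B sg) b p *: e_ a)
  + (pd B b p *: (sg p *m G p *m e_ a)
     + B p *: ((dmx sg b p *m G p + sg p *m dmx G b p) *m e_ a))
  - (dmx (conn G a) b p *m mu_of G sg p + conn G a p *m dmx (mu_of G sg) b p)
  + ((2 * pd (kap G a) b p) *: mu_of G sg p + (2 * kap G a p) *: dmx (mu_of G sg) b p).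
Proof.
move=> Up.
have dm : mxdiff (mu_of G sg) p by exact: mxsmooth_diff mu_of_smooth Up.
have ds : mxdiff sg p by exact: mxsmooth_diff sgsm Up.
have dG : mxdiff G p by exact: mxsmooth_diff Gsm Up.
have dc : mxdiff (conn G a) p by exact: mxsmooth_diff (conn_smooth oU Gsm Gunit a) Up.
have dk : differentiable (fun q => 2 * kap G a q) p.
  by apply: smooth_on_diff Up; apply: smooth_onZ => //; exact: kap_smooth.
have dr : differentiable (rho_of G B sg) p by exact: smooth_on_diff rho_of_smooth Up.
have dB : differentiable B p by exact: smooth_on_diff Bsm Up.
have de := mxdiff_cst (e_ a) p.
have d1 := mxdiffZ dr de; have d2 := mxdiffM ds dG; have d3 := mxdiffM d2 de.
have d4 := mxdiffZ dB d3; have d5 := mxdiffM dc dm; have d6 := mxdiffZ dk dm.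
rewrite (dmx_eq_on b oU Up (fun q Uq => dmx_mu a Uq)).
rewrite dmxD; [|exact: (mxdiffD (mxdiffD (mxdiffN d1) d4) (mxdiffN d5))|exact: d6].
rewrite dmxD; [|exact: (mxdiffD (mxdiffN d1) d4)|exact: (mxdiffN d5)].
rewrite dmxD; [|exact: (mxdiffN d1)|exact: d4].
rewrite (dmxN b d1) (dmxN b d5) (dmxZ b dr de) (dmxZ b dB d3) (dmxM b d2 de) (dmxM b ds dG).
rewrite (dmxM b dc dm) (dmxZ b dk dm) !dmx_cst pdZ2 //.
by rewrite scaler0 mulmx0 !addr0.
Qed.

Lemma zcurv_mu a b p : U p -> zcurv G B a b p *m mu_of G sg p =
  tau G B sg p b 0 *: e_ a - tau G B sg p a 0 *: e_ b
  + grad B p a 0 *: (sg p *m G p *m e_ b) - grad B p b 0 *: (sg p *m G p *m e_ a).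
Proof.
move=> Up.
have h : curv G a b p *m mu_of G sg p =
    (pd (rho_of G B sg) b p - 2 * kap G b p * rho_of G B sg p - B p * dotc (mu_of G sg p) (G p *m e_ b)) *: e_ a
    - (pd (rho_of G B sg) a p - 2 * kap G a p * rho_of G B sg p - B p * dotc (mu_of G sg p) (G p *m e_ a)) *: e_ b
    + pd B a p *: (sg p *m G p *m e_ b) - pd B b p *: (sg p *m G p *m e_ a).
  rewrite curvE; apply: (ricci_identity_mu (kd := pd (kap G a) b p) (Gsym Up)
    (conn_sym oU Gsym a b Up) (dmx_sg a Up) (dmx_sg b Up) (conn_metric oU Gsym Gunit a Up)
    (conn_metric oU Gsym Gunit b Up) (dmx_mu a Up) (dmx_mu b Up)).
  have := dmx_dmx_mu b a Up; rewrite -(kap_closed a b Up) => e.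
  exact: (etrans (esym (dmx_dmx_mu a b Up)) (etrans (dmx_comm a b oU Up mu_of_smooth) e)).
rewrite zcurvE (mulmxBl (curv G a b p)) h -scalemxAl (mulmxBl (e_ a *m _ *m _)).
rewrite -!(mulmxA _ (G p) (mu_of G sg p)) !outer_mul.
have eG i : dotc (e_ i) (G p *m mu_of G sg p) = dotc (mu_of G sg p) (G p *m e_ i).
  by rewrite dotcA (Gsym Up) dotcC.
rewrite !eG !tauE !gradE.
by move: (sg p *m G p *m _) (sg p *m G p *m _) (dotc _ _) (dotc _ _) => x y s t;
   apply/colP => i; rewrite !mxE; ring.
Qed.

Local Notation Z p := (extend (fun a b => zcurv G B a b p)).

Lemma extend_mu p x y : U p -> Z p x y *m mu_of G sg p =
  dotc (tau G B sg p) y *: x - dotc (tau G B sg p) x *: y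
  + dotc (grad B p) x *: (sg p *m G p *m y) - dotc (grad B p) y *: (sg p *m G p *m x).
Proof.
move=> Up; apply: (@extend_mul_ext _ _ _ x y _ (fun x y => dotc (tau G B sg p) y *: x - dotc (tau G B sg p) x *: y
  + dotc (grad B p) x *: (sg p *m G p *m y) - dotc (grad B p) y *: (sg p *m G p *m x))).
- move=> k u u' w; rewrite mulmxDr -scalemxAr !dotcDr !dotcZr.
  by move: (sg p *m G p) => S; mx_ring.
- move=> k u u' w; rewrite mulmxDr -scalemxAr !dotcDr !dotcZr.
  by move: (sg p *m G p) => S; mx_ring.
- by move=> a b; rewrite zcurv_mu // !dotc_delta.
Qed.

(** With m_a = - rho e_a, both symmetric products in the commutator identity are - rho e_a . e_b, so
    Z kills sigma. *)
Lemma extend_comm p x y : U p ->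
  Z p x y *m (sg p *m G p) = sg p *m G p *m Z p x y.
Proof.
move=> Up; apply: (comm_of_derivation (zcurv_like Up)).
have h a b : zcurv G B a b p *m sg p + sg p *m (zcurv G B a b p)^T = 0.
  rewrite -comm_sg_zcurv // !second_equation // -!scaleNr !sym2Zr [sym2 (e_ b) _]sym2C.
  by rewrite subrr.
rewrite /extend linear_sum mulmx_suml mulmx_sumr -big_split /=; apply: big1 => a _.
rewrite linear_sum mulmx_suml mulmx_sumr -big_split /=; apply: big1 => b _.
by rewrite linearZ /= -scalemxAl -scalemxAr -scalerDr h scaler0.
Qed.

Local Notation S p := (sg p *m G p).

(** Stated on the open set U, rather than only where there is nullity, in order to be
    differentiated. *)
Lemma endo_quadratic_mx a p : U p ->
  pd B a p *: (S p *m S p) + - (tau G B sg p a 0 + dotc (grad B p) (S p *m e_ a)) *: S p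
  + (dotc (tau G B sg p) (S p *m e_ a))%:M = 0.
Proof.
move=> Up; apply: mx_eq_vec => x; rewrite mul0mx.
have := endo_quadratic (Gsym Up) (Gunit Up) (zcurv_like Up) (sgsym Up)
  (fun x y => extend_comm x y Up) (fun x y => extend_mu x y Up) (e_ a) x.
rewrite !dotc_delta gradE => <-.
rewrite !mulmxDl mul_scalar_mx -!scalemxAl -(mulmxA (S p) (S p) x).
by rewrite scaleNr.
Qed.

Lemma tau_smooth : mxsmooth U (tau G B sg).
Proof.
move=> a j; apply: (smooth_on_ext oU (f := fun p => pd (rho_of G B sg) a p
  - 2 * kap G a p * rho_of G B sg p - 2 * B p * dotc (mu_of G sg p) (G p *m e_ a))).
  by move=> q _; rewrite (ord1 j) tauE.
have sr := rho_of_smooth; have sm := mu_of_smooth.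
apply: smooth_onB => //.
  apply: smooth_onB => //; first exact: smooth_on_pd.
  by apply: smooth_onM => //; apply: smooth_onZ => //; exact: kap_smooth.
apply: smooth_onM => //; first exact: smooth_onZ.
by apply: smooth_on_dotc => //; apply: mxsmoothM => //; exact: mxsmooth_cst.
Qed.

Lemma grad_smooth : mxsmooth U (grad B).
Proof.
move=> a j; apply: (smooth_on_ext oU (f := pd B a)).
  by move=> q _; rewrite (ord1 j) gradE.
exact: smooth_on_pd.
Qed.

(** [H] is the covariant derivative of S in direction f. Derivatives of the coefficients only
    multiply S S, S and 1, so their values need not be recorded. *)
Lemma endo_quadratic_derivative a f p : U p -> exists k2 k1 k0 : R,
  let H := - (sym2 (e_ f) (mu_of G sg p) *m G p) in
  grad B p a 0 *: (H *m S p + S p *m H)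
  - (tau G B sg p a 0 + dotc (grad B p) (S p *m e_ a)) *: H
  = k2 *: (S p *m S p) + k1 *: S p + k0%:M.
Proof.
move=> Up.
pose c2 := pd B a; pose c1 q := - (tau G B sg q a 0 + dotc (grad B q) (S q *m e_ a)).
pose c0 q := dotc (tau G B sg q) (S q *m e_ a).
have sS := endo_smooth; have st := tau_smooth; have sg' := grad_smooth.
have sSe : mxsmooth U (fun q => S q *m e_ a) by apply: mxsmoothM => //; exact: mxsmooth_cst.
have s2 : smooth_on U c2 by exact: smooth_on_pd.
have s1 : smooth_on U c1.
  by apply: smooth_onN => //; apply: smooth_onD => //; exact: smooth_on_dotc.
have s0 : smooth_on U c0 by exact: smooth_on_dotc.
have d2 := smooth_on_diff s2 Up; have d1 := smooth_on_diff s1 Up.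
have d0 := smooth_on_diff s0 Up; have dS := mxsmooth_diff sS Up.
have dSS := mxdiffM dS dS; have dI := mxdiff_cst (1%:M : 'M[R]_n) p.
have t2 := mxdiffZ d2 dSS; have t1 := mxdiffZ d1 dS; have t0 := mxdiffZ d0 dI.
have q0 q : U q -> c2 q *: (S q *m S q) + c1 q *: S q + c0 q *: 1%:M = 0.
  by move=> Uq; rewrite scalemx1; exact: endo_quadratic_mx.
have h : dmx (fun q => c2 q *: (S q *m S q) + c1 q *: S q + c0 q *: 1%:M) f p = 0.
  by rewrite (dmx_eq_on f oU Up q0) dmx_cst.
rewrite (dmxD f (mxdiffD t2 t1) t0) (dmxD f t2 t1) (dmxZ f d2 dSS) (dmxZ f d1 dS) in h.
rewrite (dmxZ f d0 dI) dmx_cst scaler0 addr0 scalemx1 (dmxM f dS dS) in h.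
have dsg : mxdiff sg p by exact: mxsmooth_diff sgsm Up.
have dG : mxdiff G p by exact: mxsmooth_diff Gsm Up.
have eS := endo_derivative (dmx_sg f Up) (conn_metric oU Gsym Gunit f Up).
rewrite -(dmxM f dsg dG) in eS.
have := q0 p Up; rewrite scalemx1 => q0p.
have := quadratic_derivative eS q0p h; rewrite /c2 /c1 scaleNr => e.
by do 3 eexists; rewrite gradE; exact: e.
Qed.

Lemma zcurv_trace b p : N p -> \sum_a (zcurv G B a b p *m mu_of G sg p) a 0 = 0.
Proof.
move=> Np; have Up := NU Np; have [v nv hv] := nulN Np.
have vn := extend_null hv.
have := trace_vanishes (Gsym Up) (Gunit Up) (zcurv_like Up) n_ge2 (sgsym Up) nv vn
  (fun x y => extend_comm x y Up) (fun x y => extend_mu x y Up)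
  (fun a f => endo_quadratic_derivative a f Up) (e_ b).
by under eq_bigr do rewrite extend_basis.
Qed.

(** The trace over a of the formula for Z_ab mu; its tau terms combine to n tau_b - tau_b. *)
Lemma third_equation b p : U p ->
  (n%:R - 1) * tau G B sg p b 0 + \sum_a grad B p a 0 * S p a b - grad B p b 0 * \tr (S p) = 0.
Proof.
move: p; apply: dense_zero => [|p Np].
  have st := tau_smooth; have sg' := grad_smooth; have sS := endo_smooth.
  apply: smooth_onB => //.
    apply: smooth_onD => //; first exact: smooth_onZ.
    by apply: smooth_on_sum => // a; apply: smooth_onM => //; exact: sS.
  by apply: smooth_onM => //; exact: smooth_on_tr.
rewrite -[RHS](zcurv_trace b Np).
have e a : (zcurv G B a b p *m mu_of G sg p) a 0
  = tau G B sg p b 0 - tau G B sg p a 0 * (a == b)%:R + grad B p a 0 * S p a b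
    - grad B p b 0 * S p a a.
  rewrite (zcurv_mu a b (NU Np)) -!colE; move: (S p) => T.
  by rewrite !mxE !eqxx !andbT mulr1.
rewrite [RHS](eq_bigr _ (fun a _ => e a)).
rewrite !(sumrB, big_split) /= -mulr_sumr sumr_const cardT size_enum_ord.
have -> : \sum_a tau G B sg p a 0 * (a == b)%:R = tau G B sg p b 0.
  rewrite (bigD1 b) //= eqxx mulr1 big1 ?addr0 // => a /negPf ab.
  by rewrite ab mulr0.
by rewrite mulrBl mul1r mulr_natl.
Qed.

Lemma system_of_solution p : U p ->
  system_at G B sg (mu_of G sg) (rho_of G B sg) p.
Proof.
move=> Up; split=> [a b c|a b|a].
- rewrite /nablaT1_sigma nabla_S2TE cov_sg // !mxE !big_ord1 !mxE !eqxx !andbT.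
  by rewrite ![_ == a]eq_sym; ring.
- rewrite /nablaT1_mu nabla_TE.
  have := congr1 (fun x : 'cV[R]_n => x b 0) (second_equation a Up).
  rewrite tf_covE => /eqP; rewrite -subr_eq0 => /eqP; rewrite /= => h.
  rewrite -[RHS]h -colE; move: (covT _ _ _ _) => X; rewrite !mxE eqxx andbT [b == a]eq_sym.
  rewrite mulr_sumr.
  have -> : \sum_c B p * G p a c * sg p b c = \sum_i B p * (sg p b i * G p i a).
    by apply: eq_bigr => c _; rewrite (GsymE Gsym c a Up); ring.
  by ring.
- rewrite /nablaT1_rho nabla_EE.
  have n1 : n%:R - 1 != 0 :> R.
    by rewrite subr_eq0 pnatr_eq1; case: n n_ge2 => [|[]].
  apply: (mulfI n1); rewrite mulr0 mulrDr mulVKf // -[RHS](third_equation a Up) tauE.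
  have -> : dotc (mu_of G sg p) (G p *m e_ a) = \sum_b G p a b * mu_of G sg p b 0.
    rewrite dotcE; apply: eq_bigr => b _; rewrite -colE mxE (GsymE Gsym b a Up).
    exact: mulrC.
  have -> : \sum_b \sum_c sg p b c * (G p a b * pd B c p - G p b c * pd B a p)
      = \sum_c grad B p c 0 * S p c a - grad B p a 0 * \tr (S p).
    rewrite /mxtrace mulr_sumr exchange_big -sumrB; apply: eq_bigr => c _.
    rewrite !gradE !mxE !mulr_sumr -sumrB; apply: eq_bigr => b _.
    rewrite (GsymE Gsym b c Up) (GsymE Gsym b a Up).
    have -> : sg p c b = sg p b c by rewrite -{1}(sgsym Up) mxE.
    by ring.
  by ring.
Qed.

End Prolongation.

(** * The system determines mu and rho *)

Section Uniqueness.
Variables (R : realType) (n : nat) (U : set 'rV[R]_n).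
Variables (G : 'rV[R]_n -> 'M[R]_n) (B : 'rV[R]_n -> R) (s : 'rV[R]_n -> 'M[R]_n).
Variables (m : 'rV[R]_n -> 'cV[R]_n) (r : 'rV[R]_n -> R).
Hypotheses (n_ge2 : (2 <= n)%N) (oU : open U) (Gsym : forall p, U p -> (G p)^T = G p)
  (sys : forall p, U p -> system_at G B s m r p).

Lemma system_divergence c p : U p -> \sum_d covS2 G s d p d c = - (n.+1%:R * m p c 0).
Proof.
move=> Up; have [h _ _] := sys Up.
have e d : covS2 G s d p d c = - (m p c 0 + (d == c)%:R * m p d 0).
  have := h d d c; rewrite /nablaT1_sigma nabla_S2TE eqxx mul1r -addrA => /eqP.
  by rewrite addr_eq0 => /eqP.
under eq_bigr do rewrite e.
rewrite sumrN big_split /= sumr_const cardT size_enum_ord (bigD1 c) //= eqxx mul1r.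
rewrite big1 ?addr0 => [|d /negPf ->]; last by rewrite mul0r.
by rewrite -natr1 mulrDl mul1r mulr_natl.
Qed.

Lemma system_metrisability p a b c : U p ->
  tracefree (fun a b c => nabla_S2T G (- 2) s a b c p) a b c = 0.
Proof.
move=> Up; have [h _ _] := sys Up.
have e a' b' c' : nabla_S2T G (- 2) s a' b' c' p
    = - ((a' == b')%:R * m p c' 0 + (a' == c')%:R * m p b' 0).
  by have := h a' b' c'; rewrite /nablaT1_sigma -addrA => /eqP; rewrite addr_eq0 => /eqP.
have d1 : \sum_d nabla_S2T G (- 2) s d d c p = - (n.+1%:R * m p c 0).
  by under eq_bigr do rewrite nabla_S2TE; exact: system_divergence.
have d2 : \sum_d nabla_S2T G (- 2) s d b d p = - (n.+1%:R * m p b 0).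
  rewrite -(system_divergence b Up); apply: eq_bigr => d _.
  by rewrite -nabla_S2TE !e eqxx addrC.
rewrite /tracefree e d1 d2; have : n.+1%:R != 0 :> R by rewrite pnatr_eq0.
by move=> n0; field.
Qed.

Lemma system_mu p : U p -> m p = mu_of G s p.
Proof.
move=> Up; apply/colP => c; rewrite mu_ofE system_divergence //.
by rewrite mulrNN mulKf // pnatr_eq0.
Qed.

(** Each diagonal component of the second equation equals - rho, hence so does their mean. *)
Lemma system_rho p : U p -> r p = rho_of G B s p.
Proof.
move=> Up; have [_ h _] := sys Up.
have e a : tf_cov G B s a p a 0 = - r p.
  apply/eqP; rewrite -addr_eq0 -[eqbRHS](h a a); apply/eqP.
  rewrite /nablaT1_mu nabla_TE eqxx mul1r tf_covE !covTE.
  rewrite (dmx_eq_on a oU Up (fun q Uq => esym (system_mu Uq))) -(system_mu Up).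
  rewrite -colE; move: (_ + _ *m _ - _) => X; rewrite !mxE addrAC; congr (_ - _).
  rewrite mulr_sumr; apply: eq_bigr => c _.
  by rewrite (GsymE Gsym a c Up); ring.
rewrite rho_ofE; under eq_bigr do rewrite e.
rewrite sumr_const cardT size_enum_ord -[(- r p) *+ n]mulr_natl mulKf ?opprK //.
by rewrite pnatr_eq0; case: n n_ge2.
Qed.

End Uniqueness.

Section SystemExt.
Variables (R : realType) (n : nat) (U : set 'rV[R]_n) (oU : open U).
Variables (G : 'rV[R]_n -> 'M[R]_n) (B : 'rV[R]_n -> R).

(** The parts of the assembled section agree with the local formulas on the image of the chart, an
    open set, and derivatives are local. *)
Lemma system_at_ext (s s' : 'rV[R]_n -> 'M[R]_n) (m m' : 'rV[R]_n -> 'cV[R]_n)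
    (r r' : 'rV[R]_n -> R) p : U p ->
  (forall q, U q -> s q = s' q) -> (forall q, U q -> m q = m' q) ->
  (forall q, U q -> r q = r' q) ->
  system_at G B s m r p -> system_at G B s' m' r' p.
Proof.
move=> Up es em er [h1 h2 h3]; split=> [a b c|a b|a].
- rewrite -[RHS](h1 a b c) /nablaT1_sigma !nabla_S2TE !covS2E (dmx_eq_on a oU Up es).
  by rewrite es // em.
- rewrite -[RHS](h2 a b) /nablaT1_mu !nabla_TE !covTE (dmx_eq_on a oU Up em).
  by rewrite em // er // es.
- rewrite -[RHS](h3 a) /nablaT1_rho !nabla_EE (eq_on_pd a oU Up er).
  by rewrite em // er // es.
Qed.

End SystemExt.

(** * The splitting of S^2 T and its inverse *)

Section Parts.
Variables (R : realType) (n : nat) (G : 'rV[R]_n -> 'M[R]_n).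
Implicit Types (t : 'rV[R]_n -> 'M[R]_(1 + n)) (p : 'rV[R]_n).

Definition kap_vec p : 'cV[R]_n := n.+1%:R^-1 *: \col_a christoffel_trace G a p.

Lemma kap_vecE a p : kap_vec p a 0 = kap G a p.
Proof. by rewrite kapE !mxE. Qed.

Lemma scale_mxE p : scale_mx G p = block_mx 1%:M 0 (kap_vec p) 1%:M.
Proof. by []. Qed.

Lemma lower_block_inv (x : 'cV[R]_n) :
  block_mx 1%:M 0 x 1%:M \in unitmx /\
  invmx (block_mx 1%:M 0 x 1%:M : 'M[R]_(1 + n)) = block_mx 1%:M 0 (- x) 1%:M.
Proof.
have e : block_mx 1%:M 0 (- x) 1%:M *m block_mx 1%:M 0 x 1%:M = 1%:M :> 'M[R]_(1 + n).
  rewrite mulmx_block !mul1mx !mulmx1 !mul0mx !mulmx0 !addr0 add0r addNr.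
  by rewrite -scalar_mx_block.
have u : block_mx 1%:M 0 x 1%:M \in unitmx by have [] := mulmx1_unit e.
by split=> //; rewrite -[RHS](mulmxK u) e mul1mx.
Qed.

Definition assemble p (s : 'M[R]_n) (m : 'cV[R]_n) (r : R) : 'M[R]_(1 + n) :=
  (scale_mx G p)^T *m block_mx r%:M m^T m s *m scale_mx G p.

Lemma split_assemble t p s m r : t p = assemble p s m r ->
  split_mx G t p = block_mx r%:M m^T m s.
Proof.
rewrite /split_mx /assemble => ->; have [u _] := lower_block_inv (kap_vec p).
by rewrite !mulmxA mulmxK // trmx_inv mulVmx ?mul1mx // unitmx_tr.
Qed.

Lemma assemble_split t p : (t p)^T = t p ->
  t p = assemble p (sigma_part G t p) (mu_part G t p) (rho_part G t p).
Proof.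
move=> ts; have [u _] := lower_block_inv (kap_vec p).
have -> : t p = (scale_mx G p)^T *m split_mx G t p *m scale_mx G p.
  rewrite /split_mx !mulmxA -trmx_mul mulVmx // trmx1 mul1mx -!mulmxA mulVmx //.
  by rewrite mulmx1.
rewrite /assemble; congr (_ *m _ *m _).
have ss : (split_mx G t p)^T = split_mx G t p.
  by rewrite /split_mx !trmx_mul trmxK ts mulmxA.
rewrite -[LHS]submxK; congr block_mx.
  by rewrite [LHS]mx11_scalar.
by rewrite /mu_part trmx_dlsub ss.
Qed.

Lemma assembleE p s m r : assemble p s m r =
  block_mx (r%:M + (kap_vec p)^T *m m + (m^T + (kap_vec p)^T *m s) *m kap_vec p)
           (m^T + (kap_vec p)^T *m s) (m + s *m kap_vec p) s.
Proof.
rewrite /assemble scale_mxE tr_block_mx !trmx1 trmx0 !mulmx_block.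
by rewrite !mul1mx !mulmx1 !mul0mx !mulmx0 !add0r.
Qed.

(** sigma is the restriction of the form to jets of value zero, where df and nabla f coincide. *)
Lemma sigma_partE t p : sigma_part G t p = drsubmx (t p).
Proof.
rewrite /sigma_part /split_mx scale_mxE (lower_block_inv _).2 -{1}(submxK (t p)).
rewrite tr_block_mx !trmx1 trmx0 !mulmx_block !mul1mx !mulmx1 !mul0mx !mulmx0 !add0r.
by rewrite block_mxKdr.
Qed.

End Parts.

(** * Changes of charts *)

Section TransitionAlgebra.
Variables (R : realFieldType) (n : nat).
Implicit Types (K G A : 'M[R]_n).
Local Notation e_ a := (delta_mx a 0 : 'cV[R]_n).

(* A tensor symmetric in its first two and skew in its last two indices vanishes. *)
Lemma levi_civita_unique G (X : 'I_n -> 'M[R]_n) : G \in unitmx -> G^T = G ->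
  (forall a b, X a *m e_ b = X b *m e_ a) ->
  (forall a, G *m X a + (X a)^T *m G = 0) -> forall a, X a = 0.
Proof.
move=> Gu Gs hs hk a; pose t a b c := (G *m X a) c b.
have ts a' b c : t a' b c = t b a' c.
  have := congr1 (fun x : 'cV[R]_n => (G *m x) c 0) (hs a' b).
  by rewrite !mulmxA -!colE mxE [RHS]mxE.
have tk a' b c : t a' b c = - t a' c b.
  have e : (G *m X a')^T = - (G *m X a').
    by rewrite trmx_mul Gs; apply/eqP; rewrite -addr_eq0 addrC hk.
  have := congr1 (fun T : 'M[R]_n => T b c) e; rewrite mxE [RHS]mxE => e'.
  by rewrite /t e'.
suff e : G *m X a = 0 by rewrite -(mulKmx Gu (X a)) e mulmx0.
apply/matrixP => c b; rewrite [RHS]mxE -[LHS]/(t a b c).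
have := tk a b c; have := ts a c b; have := tk c a b; have := ts c b a.
have := tk b c a; have := ts b a c; lra.
Qed.

(** K intertwines two connections. On differentiating this relation again, the second derivative
    [Kab] appears symmetrically and drops out. *)
Lemma gauge_curvature K Ka Kb Kab (Ca Cb dCab dCba Aa Ab dAab dAba : 'M[R]_n) :
  K *m Ca = Ka + Aa *m K -> K *m Cb = Kb + Ab *m K ->
  Kb *m Ca + K *m dCba = Kab + (dAba *m K + Aa *m Kb) ->
  Ka *m Cb + K *m dCab = Kab + (dAab *m K + Ab *m Ka) ->
  K *m (dCab - dCba + Ca *m Cb - Cb *m Ca)
  = (dAab - dAba + Aa *m Ab - Ab *m Aa) *m K.
Proof.
move=> ha hb hba hab; rewrite !(mulmxDl, mulmxDr, mulmxN, mulNmx) !mulmxA ha hb.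
rewrite !mulmxDl -!mulmxA hb ha !mulmxDr.
move/(canRL (addKr _)): hba => ->; move/(canRL (addKr _)): hab => ->.
rewrite !mulmxA; mx_ring.
Qed.

(** K is the Jacobian, Ka its derivative, D the density factor with logarithmic derivative - 2 t.
    The inhomogeneous terms in the laws of C and k cancel those in ds'. *)
Lemma covariant_transform_S2 K Ka A C s ds s' ds' (D d k k' t : R) :
  K *m C = Ka + A *m K -> k = t + k' -> d = - (2 * t * D) ->
  s' = D *: (K *m s *m K^T) ->
  ds' = d *: (K *m s *m K^T)
    + D *: ((Ka *m s + K *m ds) *m K^T + K *m s *m Ka^T) ->
  ds' + (A *m s' + s' *m A^T) - (2 * k') *: s'
  = D *: (K *m (ds + (C *m s + s *m C^T) - (2 * k) *: s) *m K^T).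
Proof.
move=> hC hk hd -> ->.
rewrite !(mulmxDl, mulmxDr, mulmxN, mulNmx) -?scalemxAl -?scalemxAr ?mulmxDl !mulmxA.
have -> : K *m s *m C^T *m K^T = K *m s *m Ka^T + K *m s *m K^T *m A^T.
  by rewrite -mulmxA -trmx_mul hC linearD /= trmx_mul mulmxDr mulmxA.
rewrite hC mulmxDl mulmxDl -?scalemxAl ?mulmxA hk hd.
mx_ring.
Qed.

Lemma covariant_transform_T K Ka A C (m dm m' dm' : 'cV[R]_n) (D d k k' t : R) :
  K *m C = Ka + A *m K -> k = t + k' -> d = - (2 * t * D) ->
  m' = D *: (K *m m) -> dm' = d *: (K *m m) + D *: (Ka *m m + K *m dm) ->
  dm' + A *m m' - (2 * k') *: m' = D *: (K *m (dm + C *m m - (2 * k) *: m)).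
Proof.
move=> hC hk hd -> ->.
rewrite !(mulmxDl, mulmxDr, mulmxN, mulNmx) -?scalemxAl -?scalemxAr !mulmxA hC mulmxDl.
rewrite hk hd; mx_ring.
Qed.

End TransitionAlgebra.

(** * Transition maps, Jacobians and density factors *)

Section Transition.
Variables (R : realType) (n : nat) (M : manifold R n).
Implicit Types (i j : chart M) (p : 'rV[R]_n).
Local Notation e_ a := (delta_mx a 0 : 'cV[R]_n).

Lemma overlap_open i j : open (overlap i j).
Proof.
rewrite openE => p [cp dp]; rewrite /interior.
have h1 : nbhs p (cod i) by apply: open_nbhs_nbhs; split=> //; exact: cod_open.
have h2 : nbhs p (param i @^-1` dom j).
  by apply: (param_continuous cp); apply: open_nbhs_nbhs; split=> //; exact: dom_open.
by apply: filterS (filterI h1 h2).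
Qed.

Lemma overlap_trans i j p : overlap i j p -> overlap j i (trans i j p).
Proof.
move=> [cp dp]; split; first exact: coord_cod.
by rewrite /trans coordK //; exact: param_dom.
Qed.

Lemma transK i j p : overlap i j p -> trans j i (trans i j p) = p.
Proof. by move=> [cp dp]; rewrite /trans coordK // paramK. Qed.

Lemma trans_smooth_on i j b : smooth_on (overlap i j) (fun p => trans i j p 0 b).
Proof. exact: trans_smooth. Qed.

Lemma trans_diff i j b p : overlap i j p -> differentiable (fun q => trans i j q 0 b) p.
Proof. by move=> Wp; apply: (smooth_on_diff _ Wp); exact: trans_smooth_on. Qed.

Lemma pd_coord (b a : 'I_n) p : pd (fun q : 'rV[R]_n => q 0 b) a p = (b == a)%:R.
Proof.
have d : derivable (@id 'rV[R]_n) p (delta_mx 0 a) by exact: derivable_id.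
have := derive_mx d; rewrite derive_id => /(congr1 (fun v : 'rV[R]_n => v 0 b)).
by rewrite !mxE eqxx /= /pd => <-.
Qed.

Lemma jacE i j p b a : jac i j p b a = pd (fun q => trans i j q 0 b) a p.
Proof. exact: mxE. Qed.

Lemma jac_smooth i j : mxsmooth (overlap i j) (jac i j).
Proof.
move=> b a; rewrite (_ : (fun _ => _) = pd (fun q => trans i j q 0 b) a).
  by apply: smooth_on_pd; exact: trans_smooth_on.
by apply/funext => q; exact: jacE.
Qed.

Lemma pd_pull i j (f : 'rV[R]_n -> R) a p : overlap i j p ->
  differentiable f (trans i j p) ->
  differentiable (fun q => f (trans i j q)) p /\
  pd (fun q => f (trans i j q)) a p = \sum_d jac i j p d a * pd f d (trans i j p).
Proof.
move=> Wp df; have [d e] := pd_comp a (fun b => trans_diff b Wp) df.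
split; first exact: d.
by rewrite [LHS]e; apply: eq_bigr => b _; rewrite jacE mulrC.
Qed.

Lemma dmx_pull i j k l (F : 'rV[R]_n -> 'M[R]_(k, l)) a p : overlap i j p ->
  mxdiff F (trans i j p) ->
  mxdiff (fun q => F (trans i j q)) p /\
  dmx (fun q => F (trans i j q)) a p = \sum_d jac i j p d a *: dmx F d (trans i j p).
Proof.
move=> Wp dF; split=> [r c|]; first by have [] := pd_pull a Wp (dF r c).
apply/matrixP => r c; rewrite dmxE (pd_pull a Wp (dF r c)).2 summxE.
by apply: eq_bigr => d _; rewrite [RHS]mxE dmxE.
Qed.

Lemma jacK i j p : overlap i j p -> jac j i (trans i j p) *m jac i j p = 1%:M.
Proof.
move=> Wp; apply/matrixP => c a; rewrite [LHS]mxE [RHS]mxE.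
have Wp' := overlap_trans Wp.
have [_ e] := pd_pull a Wp (trans_diff c Wp').
transitivity (pd (fun q => trans j i (trans i j q) 0 c) a p).
  by rewrite e; apply: eq_bigr => b _; rewrite [X in X * _]jacE mulrC.
rewrite -(pd_coord c a p); apply: (eq_on_pd a (@overlap_open i j) Wp) => q Wq.
by rewrite transK.
Qed.

Lemma jac_unit i j p : overlap i j p -> jac i j p \in unitmx.
Proof. by move=> /jacK /mulmx1_unit []. Qed.

Lemma dmx_jac_sym i j a b p : overlap i j p ->
  dmx (jac i j) a p *m e_ b = dmx (jac i j) b p *m e_ a.
Proof.
move=> Wp; apply/colP => c; rewrite -!colE [LHS]mxE [RHS]mxE !dmxE.
have e d : (fun q => jac i j q c d) = pd (fun q => trans i j q 0 c) d.
  by apply/funext => q; exact: jacE.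
rewrite !e; have sy := @trans_smooth_on i j c; apply: (pd_comm (@overlap_open i j) Wp).
- by move=> q; exact: smooth_on_diff sy.
- exact: (smooth_on_diff (smooth_on_pd b sy) Wp).
- exact: (smooth_on_diff (smooth_on_pd a sy) Wp).
Qed.

Lemma dens_gt0 w i j p : overlap i j p -> 0 < dens w i j p.
Proof.
move=> Wp; apply: powR_gt0; rewrite normr_gt0 -unitfE -unitmxE.
exact: jac_unit.
Qed.

Lemma dens_m2 i j p : dens (- 2) i j p = (dens 1 i j p)^-1 ^+ 2.
Proof.
rewrite /dens (_ : - 2 / n.+1%:R = 1 / n.+1%:R * - 2%:R); last by rewrite mul1r mulrC.
by rewrite [LHS]powRrM powR_invn ?powR_ge0 // exprVn.
Qed.

Lemma pd_chain1 (h : R -> R) (f : 'rV[R]_n -> R) a p : differentiable f p ->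
  derivable h (f p) 1 -> differentiable (fun q => h (f q)) p /\
  pd (fun q => h (f q)) a p = 'D_1 h (f p) * pd f a p.
Proof.
move=> df /derivable1_diffP dh; have dc := differentiable_comp df dh.
split; first exact: dc.
rewrite /pd deriveE // [LHS](_ : _ = 'd (h \o f) p (delta_mx 0 a)) //.
rewrite diff_comp //= !deriveE // -[X in 'd h _ X]mulr1 [LHS]linearZ /=.
exact: mulrC.
Qed.

Lemma pd_dens w i j a p : overlap i j p -> differentiable (dens w i j) p /\
  pd (dens w i j) a p
  = w / n.+1%:R * \tr (invmx (jac i j p) *m dmx (jac i j) a p) * dens w i j p.
Proof.
(* Writing |det|^c as (det^2)^(c/2), a power of a positive smooth function, avoids following the
   sign of the determinant. *)
move=> Wp; set c := w / n.+1%:R; pose f q := \det (jac i j q) ^+ 2.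
have sj := @jac_smooth i j; have oW := @overlap_open i j.
have densE q : dens w i j q = f q `^ (c / 2).
  rewrite /dens -/c /f -(real_normK (num_real (\det (jac i j q)))).
  by rewrite -powR_mulrn // -powRrM mulrC divfK // pnatr_eq0.
have dF := mxsmooth_diff sj Wp.
have sd := smooth_on_det oW sj; have dd := smooth_on_diff sd Wp.
have fE : f = fun q => \det (jac i j q) * \det (jac i j q).
  by apply/funext => q; rewrite /f expr2.
have df : differentiable f p by rewrite fE; exact: differentiableM.
have x0 : \det (jac i j p) != 0 by rewrite -unitfE -unitmxE jac_unit.
have f0 : 0 < f p by rewrite /f exprn_even_gt0.
have dh := is_derive1_powR (c / 2) f0.
have [d e] := pd_chain1 a df (@ex_derive _ _ _ _ _ _ _ dh).
have -> : dens w i j = fun q => f q `^ (c / 2) by apply/funext.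
split; first exact: d.
rewrite e (@derive_val _ _ _ _ _ _ _ dh) fE pdM // pd_det //.
have -> : \adj (jac i j p) = \det (jac i j p) *: invmx (jac i j p).
  by rewrite /invmx jac_unit // scalerA divff // scale1r.
rewrite -scalemxAr linearZ /= mxtrace_mulC -expr2 -/(f p).
have -> : f p `^ (c / 2) = f p `^ (c / 2 - 1) * f p.
  by rewrite -{3}(powRr1 (ltW f0)) -powRD ?subrK // (gt_eqF f0) implybT.
by move: (f p `^ (c / 2 - 1)) => h; rewrite /f; field.
Qed.

End Transition.

(** The connection form of chart j pulled back along the transition map; it still acts in the
    coordinate frame of j. *)
HB.lock Definition pulled_conn (R : realType) (n : nat) (M : manifold R n) (i j : chart M)
    (G' : 'rV[R]_n -> 'M[R]_n) (a : 'I_n) (p : 'rV[R]_n) : 'M[R]_n :=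
  \sum_d jac i j p d a *: conn G' d (trans i j p).

Section PulledAlgebra.
Variables (R : realFieldType) (n : nat).
Implicit Types (K G A : 'M[R]_n).
Local Notation e_ a := (delta_mx a 0 : 'cV[R]_n).

Lemma pulled_metric_compatible K G' A dK G C : K \in unitmx -> G = K^T *m G' *m K ->
  dK^T *m G' *m K + K^T *m (G' *m A + A^T *m G') *m K + K^T *m G' *m dK
    = G *m C + C^T *m G ->
  G *m (invmx K *m (dK + A *m K) - C) + (invmx K *m (dK + A *m K) - C)^T *m G = 0.
Proof.
move=> uK hG h.
have GK : G *m invmx K = K^T *m G' by rewrite hG mulmxK.
have KG : (invmx K)^T *m G = G' *m K.
  by rewrite hG !mulmxA trmx_inv mulVmx ?mul1mx // unitmx_tr.
have -> : (invmx K *m (dK + A *m K) - C)^T = (dK^T + K^T *m A^T) *m (invmx K)^T - C^T.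
  by rewrite linearB /= trmx_mul linearD /= trmx_mul.
rewrite mulmxBr mulmxBl !mulmxA GK -[_ *m (invmx K)^T *m G]mulmxA KG.
rewrite addrACA -opprD -h !(mulmxDl, mulmxDr) !mulmxA; mx_ring.
Qed.

Lemma col_unit_neq0 K a : K \in unitmx -> K *m e_ a != 0.
Proof.
move=> uK; apply/eqP => /(congr1 (mulmx (invmx K))).
rewrite mulKmx // mulmx0 => /(congr1 (fun x : 'cV[R]_n => x a 0)).
by rewrite !mxE !eqxx => /eqP; rewrite oner_eq0.
Qed.

Lemma mulmx_col_sum K a : K *m e_ a = \sum_d K d a *: e_ d.
Proof.
by rewrite {1}(colE_sum (K *m e_ a)); apply: eq_bigr => d _; rewrite -colE mxE.
Qed.

Lemma pulled_outer K a b :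
  \sum_d \sum_e (K d a * K e b) *: (e_ d *m (e_ e)^T) = (K *m e_ a) *m (K *m e_ b)^T.
Proof.
rewrite !mulmx_col_sum mulmx_suml; apply: eq_bigr => d _.
rewrite linear_sum mulmx_sumr; apply: eq_bigr => e _.
by rewrite linearZ /= -scalemxAl -scalemxAr scalerA.
Qed.

End PulledAlgebra.

(** * Change of charts for the connection and the curvature *)

Section Covariance.
Variables (R : realType) (n : nat) (M : manifold R n) (g : field M n n).
Hypothesis g_metric : is_metric g.
Implicit Types (i j : chart M) (p : 'rV[R]_n).
Local Notation e_ a := (delta_mx a 0 : 'cV[R]_n).

Lemma metric_smooth i : mxsmooth (cod i) (g i).
Proof. by case: g_metric => -[_ h _] _ _ a b; exact: h. Qed.

Lemma metric_sym i p : (g i p)^T = g i p.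
Proof. by case: g_metric => _ h _; exact: h. Qed.

Lemma metric_unit i p : cod i p -> g i p \in unitmx.
Proof. by case: g_metric => _ _ h; exact: h. Qed.

Lemma overlap_cod i j p : overlap i j p -> cod j (trans i j p).
Proof. by move=> [_ dp]; exact: coord_cod. Qed.

Lemma metric_trans i j p : overlap i j p ->
  g i p = (jac i j p)^T *m g j (trans i j p) *m jac i j p.
Proof.
move=> Wp; case: g_metric => -[_ _ h] _ _; rewrite (h i j p Wp).
have uK := jac_unit Wp; rewrite !mulmxA -trmx_mul mulVmx // trmx1 mul1mx.
by rewrite -mulmxA mulVmx // mulmx1.
Qed.

Lemma pulled_connE i j a p : pulled_conn i j (g j) a p
  = \sum_d jac i j p d a *: conn (g j) d (trans i j p).
Proof. by rewrite unlock. Qed.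

Lemma conn_diff i j d p : overlap i j p -> mxdiff (conn (g j) d) (trans i j p).
Proof.
move=> Wp; apply: (mxsmooth_diff _ (overlap_cod Wp)).
apply: conn_smooth; [exact: cod_open|exact: metric_smooth|exact: metric_unit].
Qed.

Lemma pulled_conn_sym i j a b p : overlap i j p ->
  pulled_conn i j (g j) a p *m (jac i j p *m e_ b)
  = pulled_conn i j (g j) b p *m (jac i j p *m e_ a).
Proof.
move=> Wp.
have e a' b' : pulled_conn i j (g j) a' p *m (jac i j p *m e_ b') = \sum_d \sum_c
    (jac i j p d a' * jac i j p c b') *: (conn (g j) d (trans i j p) *m e_ c).
  rewrite pulled_connE mulmx_suml; apply: eq_bigr => d _.
  rewrite mulmx_col_sum mulmx_sumr; apply: eq_bigr => c _.
  by rewrite -scalemxAl -scalemxAr scalerA.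
rewrite (e a b) (e b a) exchange_big; apply: eq_bigr => d _; apply: eq_bigr => c _.
rewrite mulrC; congr (_ *: _).
exact: (conn_sym (@cod_open _ _ M j) (fun q _ => metric_sym j q) _ _ (overlap_cod Wp)).
Qed.

Lemma pulled_dmx_metric i j a p : overlap i j p ->
  \sum_d jac i j p d a *: dmx (g j) d (trans i j p)
  = g j (trans i j p) *m pulled_conn i j (g j) a p
    + (pulled_conn i j (g j) a p)^T *m g j (trans i j p).
Proof.
move=> Wp; rewrite pulled_connE mulmx_sumr linear_sum mulmx_suml -big_split.
apply: eq_bigr => d _.
rewrite (conn_metric (@cod_open _ _ M j) (fun q _ => metric_sym j q)
  (@metric_unit j) d (overlap_cod Wp)).
by rewrite /= -scalemxAr [(_ *: _)^T]linearZ /= -scalemxAl scalerDr.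
Qed.

(** The difference [X] of the transported and the given connection is symmetric, by the symmetry of
    second derivatives, and skew, by compatibility with g. The uniqueness of the Levi-Civita
    connection replaces a computation with Christoffel symbols. *)
Lemma conn_transform i j a p : overlap i j p -> jac i j p *m conn (g i) a p
  = dmx (jac i j) a p + pulled_conn i j (g j) a p *m jac i j p.
Proof.
move=> Wp; have uK := jac_unit Wp; have oW := @overlap_open _ _ M i j.
have cp : cod i p by case: Wp.
pose X b := invmx (jac i j p) *m (dmx (jac i j) b p + pulled_conn i j (g j) b p *m jac i j p)
  - conn (g i) b p.
suff X0 : X a = 0.
  move/eqP: X0; rewrite subr_eq0 => /eqP <-; exact: mulKVmx.
apply: (levi_civita_unique (metric_unit cp) (metric_sym i p)) => [b c|b].
  rewrite /X !mulmxBl -!mulmxA !mulmxDl (dmx_jac_sym b c Wp) -!mulmxA.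
  rewrite (pulled_conn_sym b c Wp); congr (_ - _).
  exact: (conn_sym (@cod_open _ _ M i) (fun q _ => metric_sym i q) _ _ cp).
apply: (pulled_metric_compatible uK (metric_trans Wp)).
rewrite -(conn_metric (@cod_open _ _ M i) (fun q _ => metric_sym i q) (@metric_unit i) b cp).
have dJ : mxdiff (jac i j) p := mxsmooth_diff (@jac_smooth _ _ M i j) Wp.
have dg : mxdiff (g j) (trans i j p) := mxsmooth_diff (@metric_smooth j) (overlap_cod Wp).
have [dgy e] := dmx_pull b Wp dg; have dJt := mxdiff_tr dJ.
rewrite (dmx_eq_on b oW Wp (fun q Wq => metric_trans Wq)).
rewrite (dmxM b (mxdiffM dJt dgy) dJ) (dmxM b dJt dgy) dmx_tr e pulled_dmx_metric //.
by rewrite mulmxDl.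
Qed.

Lemma pd_jac i j a b c p : pd (fun q => jac i j q c a) b p = dmx (jac i j) b p c a.
Proof. by rewrite dmxE. Qed.

Lemma jac_diff i j c a p : overlap i j p -> differentiable (fun q => jac i j q c a) p.
Proof. by move=> Wp; exact: (mxsmooth_diff (@jac_smooth _ _ M i j) Wp). Qed.

Lemma pulled_conn_diff i j a b p : overlap i j p ->
  mxdiff (pulled_conn i j (g j) a) p /\
  dmx (pulled_conn i j (g j) a) b p
  = \sum_d (dmx (jac i j) b p d a *: conn (g j) d (trans i j p)
      + jac i j p d a *: \sum_c jac i j p c b *: dmx (conn (g j) d) c (trans i j p)).
Proof.
move=> Wp.
have h d : mxdiff (fun q => jac i j q d a *: conn (g j) d (trans i j q)) p /\
    dmx (fun q => jac i j q d a *: conn (g j) d (trans i j q)) b p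
    = dmx (jac i j) b p d a *: conn (g j) d (trans i j p)
      + jac i j p d a *: \sum_c jac i j p c b *: dmx (conn (g j) d) c (trans i j p).
  have [dc e] := dmx_pull b Wp (conn_diff d Wp).
  split; first exact: (mxdiffZ (jac_diff d a Wp) dc).
  by rewrite (dmxZ b (jac_diff d a Wp) dc) e pd_jac.
rewrite (_ : pulled_conn i j (g j) a
    = fun q => \sum_d jac i j q d a *: conn (g j) d (trans i j q)); last first.
  by apply/funext => q; exact: pulled_connE.
have [d e] := dmx_sum b (fun d => (h d).1).
split; first exact: d.
by rewrite e; apply: eq_bigr => c _; exact: (h c).2.
Qed.

(** Curvature commutes with pullback: the second derivatives of the transition map are symmetric and
    cancel. *)
Lemma pulled_curv i j a b p : overlap i j p ->
  dmx (pulled_conn i j (g j) b) a p - dmx (pulled_conn i j (g j) a) b p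
  + pulled_conn i j (g j) a p *m pulled_conn i j (g j) b p
  - pulled_conn i j (g j) b p *m pulled_conn i j (g j) a p
  = \sum_d \sum_c (jac i j p d a * jac i j p c b) *: curv (g j) d c (trans i j p).
Proof.
move=> Wp; rewrite (pulled_conn_diff b a Wp).2 (pulled_conn_diff a b Wp).2 !pulled_connE.
rewrite !big_split /=.
have -> : \sum_d dmx (jac i j) a p d b *: conn (g j) d (trans i j p)
    = \sum_d dmx (jac i j) b p d a *: conn (g j) d (trans i j p).
  apply: eq_bigr => d _; congr (_ *: _).
  have := congr1 (fun x : 'cV[R]_n => x d 0) (dmx_jac_sym a b Wp).
  by rewrite -!colE mxE [RHS]mxE.
have P u v : (\sum_d jac i j p d u *: conn (g j) d (trans i j p))
    *m (\sum_d jac i j p d v *: conn (g j) d (trans i j p))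
    = \sum_d \sum_c (jac i j p d u * jac i j p c v) *:
        (conn (g j) d (trans i j p) *m conn (g j) c (trans i j p)).
  rewrite mulmx_suml; apply: eq_bigr => d _; rewrite mulmx_sumr; apply: eq_bigr => c _.
  by rewrite -scalemxAl -scalemxAr scalerA.
rewrite !P.
have D u v : \sum_d jac i j p d u *: (\sum_c jac i j p c v *: dmx (conn (g j) d) c (trans i j p))
    = \sum_d \sum_c (jac i j p d u * jac i j p c v) *: dmx (conn (g j) d) c (trans i j p).
  apply: eq_bigr => d _; rewrite scaler_sumr; apply: eq_bigr => c _.
  by rewrite scalerA.
rewrite !D.
have sw F : \sum_d \sum_c (jac i j p d b * jac i j p c a) *: F d c
    = \sum_d \sum_c (jac i j p d a * jac i j p c b) *: F c d :> 'M[R]_n.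
  rewrite exchange_big; apply: eq_bigr => d _; apply: eq_bigr => c _.
  by rewrite mulrC.
rewrite (sw (fun d c => dmx (conn (g j) d) c (trans i j p))).
rewrite (sw (fun d c => conn (g j) d (trans i j p) *m conn (g j) c (trans i j p))).
rewrite opprD addrACA subrr add0r -sumrB -big_split -sumrB /=; apply: eq_bigr => d _.
rewrite -sumrB -big_split -sumrB /=; apply: eq_bigr => c _.
by rewrite curvE !(scalerDr, scalerN).
Qed.

Lemma curv_transform i j a b p : overlap i j p ->
  jac i j p *m curv (g i) a b p
  = (\sum_d \sum_c (jac i j p d a * jac i j p c b) *: curv (g j) d c (trans i j p))
    *m jac i j p.
Proof.
move=> Wp; rewrite -pulled_curv // curvE.
have cp : cod i p by case: Wp.
have oW := @overlap_open _ _ M i j; have sJ := @jac_smooth _ _ M i j.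
have dJ : mxdiff (jac i j) p := mxsmooth_diff sJ Wp.
have dc c : mxdiff (conn (g i) c) p.
  apply: (mxsmooth_diff _ cp).
  by apply: conn_smooth; [exact: cod_open|exact: metric_smooth|exact: metric_unit].
have de u v : dmx (jac i j) v p *m conn (g i) u p + jac i j p *m dmx (conn (g i) u) v p
    = dmx (dmx (jac i j) u) v p + (dmx (pulled_conn i j (g j) u) v p *m jac i j p
      + pulled_conn i j (g j) u p *m dmx (jac i j) v p).
  have dA := (pulled_conn_diff u v Wp).1.
  have dJJ : mxdiff (dmx (jac i j) u) p := mxsmooth_diff (mxsmooth_dmx u sJ) Wp.
  rewrite -(dmxM v dJ (dc u)) -(dmxM v dA dJ) -(dmxD v dJJ (mxdiffM dA dJ)).
  by apply: (dmx_eq_on v oW Wp) => q Wq; exact: conn_transform.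
apply: (gauge_curvature (conn_transform a Wp) (conn_transform b Wp) (de a b)).
by rewrite (dmx_comm a b oW Wp sJ); exact: de.
Qed.

End Covariance.

(** * Change of charts for sigma, mu and rho *)

Section CovarianceOfSolutions.
Variables (R : realType) (n : nat) (M : manifold R n) (g : field M n n).
Hypothesis g_metric : is_metric g.
Implicit Types (i j : chart M) (p : 'rV[R]_n).
Local Notation e_ a := (delta_mx a 0 : 'cV[R]_n).

(** The logarithmic derivative of [dens 1], which is the inhomogeneous term in the law of [kap]. *)
Definition log_jac i j a p : R :=
  n.+1%:R^-1 * \tr (invmx (jac i j p) *m dmx (jac i j) a p).

Lemma kap_transform i j a p : overlap i j p ->
  kap (g i) a p = log_jac i j a p + \sum_d jac i j p d a * kap (g j) d (trans i j p).
Proof.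
move=> Wp; have uK := jac_unit Wp.
have e : conn (g i) a p = invmx (jac i j p) *m dmx (jac i j) a p
    + invmx (jac i j p) *m pulled_conn i j (g j) a p *m jac i j p.
  rewrite -mulmxA -mulmxDr -(conn_transform g_metric a Wp).
  by rewrite mulKmx.
rewrite kapE conn_trace e mxtraceD mulrDr; congr (_ + _).
rewrite -mulmxA mxtrace_mulC mulmxK // pulled_connE raddf_sum /= mulr_sumr.
by apply: eq_bigr => d _; rewrite mxtraceZ kapE conn_trace mulrCA.
Qed.

Lemma pd_dens_m2 i j a p : overlap i j p ->
  differentiable (dens (- 2) i j) p /\
  pd (dens (- 2) i j) a p = - (2 * log_jac i j a p * dens (- 2) i j p).
Proof.
move=> Wp; have [d e] := pd_dens (- 2) a Wp; split; first exact: d.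
by rewrite e /log_jac; ring.
Qed.

Lemma covS2_transform (s : field M n n) i j a p : overlap i j p ->
  (forall k, mxsmooth (cod k) (s k)) ->
  (forall q, overlap i j q -> s j (trans i j q)
     = dens (- 2) i j q *: (jac i j q *m s i q *m (jac i j q)^T)) ->
  \sum_d jac i j p d a *: covS2 (g j) (s j) d (trans i j p)
  = dens (- 2) i j p *: (jac i j p *m covS2 (g i) (s i) a p *m (jac i j p)^T).
Proof.
move=> Wp ss h; have oW := @overlap_open _ _ M i j.
have cp : cod i p by case: Wp.
have [dD eD] := pd_dens_m2 a Wp.
have dJ : mxdiff (jac i j) p := mxsmooth_diff (@jac_smooth _ _ M i j) Wp.
have ds : mxdiff (s i) p := mxsmooth_diff (ss i) cp.
have [dsy esy] := dmx_pull a Wp (mxsmooth_diff (ss j) (overlap_cod Wp)).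
have dJt := mxdiff_tr dJ; have d1 := mxdiffM dJ ds; have d2 := mxdiffM d1 dJt.
rewrite covS2E -(covariant_transform_S2 (conn_transform g_metric a Wp)
  (kap_transform a Wp) eD (h p Wp)
  (ds' := \sum_d jac i j p d a *: dmx (s j) d (trans i j p))).
  rewrite pulled_connE linear_sum mulmx_suml mulmx_sumr -!big_split /=.
  rewrite mulr_sumr scaler_suml -sumrB; apply: eq_bigr => d _.
  rewrite covS2E [(_ *: _)^T]linearZ /= -scalemxAl -scalemxAr -!scalerDr scalerBr.
  by rewrite scalerA mulrCA.
rewrite -esy (dmx_eq_on a oW Wp h) (dmxZ a dD d2) (dmxM a d1 dJt) (dmxM a dJ ds).
by rewrite dmx_tr.
Qed.

Lemma covT_transform (m : chart M -> 'rV[R]_n -> 'cV[R]_n) i j a p : overlap i j p ->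
  (forall k, mxsmooth (cod k) (m k)) ->
  (forall q, overlap i j q -> m j (trans i j q)
     = dens (- 2) i j q *: (jac i j q *m m i q)) ->
  \sum_d jac i j p d a *: covT (g j) (m j) d (trans i j p)
  = dens (- 2) i j p *: (jac i j p *m covT (g i) (m i) a p).
Proof.
move=> Wp sm h; have oW := @overlap_open _ _ M i j.
have cp : cod i p by case: Wp.
have [dD eD] := pd_dens_m2 a Wp.
have dJ : mxdiff (jac i j) p := mxsmooth_diff (@jac_smooth _ _ M i j) Wp.
have dm : mxdiff (m i) p := mxsmooth_diff (sm i) cp.
have [dmy emy] := dmx_pull a Wp (mxsmooth_diff (sm j) (overlap_cod Wp)).
have d1 := mxdiffM dJ dm.
rewrite covTE -(covariant_transform_T (conn_transform g_metric a Wp)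
  (kap_transform a Wp) eD (h p Wp)
  (dm' := \sum_d jac i j p d a *: dmx (m j) d (trans i j p))).
  rewrite pulled_connE mulmx_suml -big_split /=.
  rewrite mulr_sumr scaler_suml -sumrB; apply: eq_bigr => d _.
  by rewrite covTE -scalemxAl -scalerDr scalerBr scalerA mulrCA.
by rewrite -emy (dmx_eq_on a oW Wp h) (dmxZ a dD d1) (dmxM a dJ dm).
Qed.

Variables (B : M -> R) (s : field M n n).
Hypotheses (n_ge2 : (2 <= n)%N) (s_section : is_S2TM_m2 s) (s_metris : metrisability g s).

Lemma s_smooth i : mxsmooth (cod i) (s i).
Proof. by case: s_section => -[_ h _] _ a b; exact: h. Qed.

Lemma s_sym i p : (s i p)^T = s i p.
Proof. by case: s_section => _ h; exact: h. Qed.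

Lemma s_trans i j p : overlap i j p -> s j (trans i j p)
  = dens (- 2) i j p *: (jac i j p *m s i p *m (jac i j p)^T).
Proof. by case: s_section => -[_ _ h] _; exact: h. Qed.

Lemma s_cov i a p : cod i p ->
  covS2 (g i) (s i) a p = - sym2 (e_ a) (mu_of (g i) (s i) p).
Proof.
move=> cp; exact: (cov_sg (@cod_open _ _ M i) (fun q _ => s_sym i q)
  (fun q cq => s_metris cq) a cp).
Qed.

Lemma s_mu_smooth i : mxsmooth (cod i) (mu_of (g i) (s i)).
Proof.
apply: mu_of_smooth; [exact: cod_open|exact: metric_smooth|exact: metric_unit|].
exact: s_smooth.
Qed.

(** The tensor nabla_a sigma equals - e_a . mu in every chart. Comparing two charts in a single
    direction a, the nonzero vector K e_a cancels from the symmetric product. *)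
Lemma mu_transform i j p : overlap i j p -> mu_of (g j) (s j) (trans i j p)
  = dens (- 2) i j p *: (jac i j p *m mu_of (g i) (s i) p).
Proof.
move=> Wp; have uK := jac_unit Wp; have cp : cod i p by case: Wp.
have a : 'I_n by case: n n_ge2 => // k _; exact: ord0.
have := covS2_transform a Wp s_smooth (@s_trans i j).
under eq_bigr do rewrite (s_cov _ (overlap_cod Wp)) scalerN [sym2 _ _]sym2C -sym2Zr.
rewrite sumrN -sym2_sumr -mulmx_col_sum (s_cov a cp) mulmxN mulNmx scalerN.
move/oppr_inj; set K := jac i j p; set D := dens _ _ _ _ => h.
have h' : sym2 (K *m e_ a) (mu_of (g j) (s j) (trans i j p) - D *: (K *m mu_of (g i) (s i) p)) = 0.
  rewrite -scaleNr sym2Dr sym2Zr sym2C h scaleNr; apply/eqP; rewrite subr_eq0.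
  by rewrite /sym2 mulmxDr mulmxDl !trmx_mul !mulmxA.
case/outer_sym_eq0: h' => [/eqP|/eqP]; first by rewrite (negPf (col_unit_neq0 a uK)).
by rewrite subr_eq0 => /eqP.
Qed.

Hypothesis second : forall i p a, cod i p ->
  tf_cov (g i) (B \o param i) (s i) a p
  = - (rho_of (g i) (B \o param i) (s i) p *: e_ a).

(** In nabla_a mu = B sigma g e_a - rho e_a the left side and the sigma term are tensorial, so the
    rho terms agree on the nonzero vector K e_a. *)
Lemma rho_transform i j p : overlap i j p ->
  rho_of (g j) (B \o param j) (s j) (trans i j p)
  = dens (- 2) i j p * rho_of (g i) (B \o param i) (s i) p.
Proof.
move=> Wp; have uK := jac_unit Wp; have cp : cod i p by case: Wp.
have a : 'I_n by case: n n_ge2 => // k _; exact: ord0.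
have c k q b : cod k q -> covT (g k) (mu_of (g k) (s k)) b q =
    B (param k q) *: (s k q *m g k q *m e_ b) - rho_of (g k) (B \o param k) (s k) q *: e_ b.
  by move=> cq; rewrite -(second b cq) tf_covE /= addrC subrK.
have := covT_transform a Wp s_mu_smooth (@mu_transform i j).
under eq_bigr do rewrite (c _ _ _ (overlap_cod Wp)).
rewrite (c _ _ _ cp).
have Bj : B (param j (trans i j p)) = B (param i p).
  by rewrite /trans coordK //; case: Wp.
rewrite Bj (s_trans Wp) (metric_trans g_metric Wp).
set K := jac i j p; set D := dens _ _ _ _; set r' := rho_of _ _ _ (trans i j p).
set r := rho_of _ _ _ p; set G' := g j _ => h.
have {}h : r' *: (K *m e_ a) = (D * r) *: (K *m e_ a).
  move: h; rewrite mulmxBr -!scalemxAr scalerBr [D *: (r *: _)]scalerA.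
  have -> : \sum_d K d a *: (B (param i p) *: (D *: (K *m s i p *m K^T) *m G' *m e_ d) - r' *: e_ d)
      = D *: (B (param i p) *: (K *m (s i p *m (K^T *m G' *m K) *m e_ a))) - r' *: (K *m e_ a).
    rewrite [X in r' *: X]mulmx_col_sum scaler_sumr.
    have -> : D *: (B (param i p) *: (K *m (s i p *m (K^T *m G' *m K) *m e_ a)))
        = \sum_d K d a *: (B (param i p) *: (D *: (K *m s i p *m K^T) *m G' *m e_ d)).
      rewrite -!mulmxA mulmx_col_sum !mulmx_sumr !scaler_sumr; apply: eq_bigr => d _.
      by rewrite -!scalemxAl -!scalemxAr !mulmxA !scalerA; congr (_ *: _); ring.
    rewrite -sumrB; apply: eq_bigr => d _; rewrite scalerBr; congr (_ - _).
    by rewrite !scalerA mulrC.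
  by move=> h1; apply: oppr_inj; exact: (addrI _ h1).
move/eqP: h; rewrite -subr_eq0 -scalerBl scaler_eq0 (negPf (col_unit_neq0 a uK)) orbF.
by rewrite subr_eq0 => /eqP.
Qed.

End CovarianceOfSolutions.

Section NullTransport.
Variables (R : realType) (n : nat) (M : manifold R n) (g : field M n n) (B : M -> R).
Hypothesis g_metric : is_metric g.
Local Notation e_ a := (delta_mx a 0 : 'cV[R]_n).

(** [weyl_nullity] provides a null vector in some chart around the point; the equations in chart i
    need one in that chart. *)
Lemma zcurv_transport (i j : chart M) p (v : 'cV[R]_n) : overlap i j p ->
  (forall d c, zcurv (g j) (B \o param j) d c (trans i j p) *m v = 0) ->
  forall a b, zcurv (g i) (B \o param i) a b p *m (invmx (jac i j p) *m v) = 0.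
Proof.
move=> Wp h a b; have uK := jac_unit Wp.
have Bj : B (param j (trans i j p)) = B (param i p).
  by rewrite /trans coordK //; case: Wp.
suff e : jac i j p *m zcurv (g i) (B \o param i) a b p
    = (\sum_d \sum_c (jac i j p d a * jac i j p c b) *:
        zcurv (g j) (B \o param j) d c (trans i j p)) *m jac i j p.
  rewrite -[LHS](mulKmx uK) (mulmxA (jac i j p)) e.
  rewrite -(mulmxA _ (jac i j p)) mulKVmx // mulmx_suml big1 ?mulmx0 // => d _.
  by rewrite mulmx_suml big1 // => c _; rewrite -scalemxAl h scaler0.
rewrite zcurvE mulmxBr (curv_transform g_metric a b Wp) /=.
have -> : \sum_d \sum_c (jac i j p d a * jac i j p c b) *:
        zcurv (g j) (B \o param j) d c (trans i j p)
  = \sum_d \sum_c (jac i j p d a * jac i j p c b) *: curv (g j) d c (trans i j p)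
  - B (param i p) *: ((\sum_d \sum_c (jac i j p d a * jac i j p c b) *: (e_ d *m (e_ c)^T)
      - \sum_d \sum_c (jac i j p c b * jac i j p d a) *: (e_ c *m (e_ d)^T))
    *m g j (trans i j p)).
  rewrite -sumrB mulmx_suml scaler_sumr -sumrB; apply: eq_bigr => d _.
  rewrite -sumrB mulmx_suml scaler_sumr -sumrB; apply: eq_bigr => c _.
  rewrite zcurvE /= Bj scalerBr; congr (_ - _).
  rewrite [jac i j p c b * _]mulrC -scalerBr -scalemxAl mulmxBl.
  by rewrite !scalerA mulrC.
have -> : \sum_d \sum_c (jac i j p c b * jac i j p d a) *: (e_ c *m (e_ d)^T)
    = (jac i j p *m e_ b) *m (jac i j p *m e_ a)^T.
  by rewrite exchange_big; exact: pulled_outer.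
rewrite pulled_outer [RHS]mulmxBl; congr (_ - _).
rewrite -scalemxAl -scalemxAr; congr (_ *: _).
rewrite (metric_trans g_metric Wp) !trmx_mul mulmxBr !mulmxBl !mulmxA.
by [].
Qed.

End NullTransport.

(** * The correspondence *)

Section JetAlgebra.
Variables (R : realFieldType) (n : nat).
Implicit Types (K s : 'M[R]_n) (x c m : 'cV[R]_n).

Lemma jet_unit (D : R) x K : D != 0 -> K \in unitmx ->
  (block_mx D%:M 0 x (D *: (invmx K)^T) : 'M[R]_(1 + n)) \in unitmx.
Proof.
rewrite -unitfE => D0 uK; rewrite unitmxE det_lblock det_scalar1 detZ det_tr !unitrM.
by rewrite unitrX // -unitmxE unitmx_inv uK D0.
Qed.

Lemma jet_drsubmx (D : R) x K (t t' : 'M[R]_(1 + n))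
    (J := block_mx D%:M 0 x (D *: (invmx K)^T)) : D != 0 -> K \in unitmx ->
  t = J^T *m t' *m J -> drsubmx t' = D^-1 ^+ 2 *: (K *m drsubmx t *m K^T).
Proof.
move=> D0 uK ->; rewrite /J -{2}(submxK t') tr_block_mx !mulmx_block block_mxKdr.
rewrite trmx0 !mul0mx !mulmx0 !add0r [(D *: _)^T]linearZ /= trmxK.
rewrite -!scalemxAl -!scalemxAr -!scalemxAl !scalerA !mulmxA mulmxV // mul1mx -mulmxA -trmx_mul.
rewrite mulmxV // trmx1 mulmx1 -[LHS]scale1r; congr (_ *: _).
by field.
Qed.

(** In the frames (f, nabla f) the change of jets is the block diagonal [E]: the law
    [c = D *: (k - K^T *m k')] makes the connection form absorb the derivative of the density
    factor. The components therefore transform as weighted tensors. *)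
Lemma jet_assemble (D r : R) c K s m (k k' : 'cV[R]_n)
    (J := block_mx D%:M 0 ((invmx K)^T *m c) (D *: (invmx K)^T) : 'M[R]_(1 + n))
    (S := fun x : 'cV[R]_n => block_mx 1%:M 0 x 1%:M : 'M[R]_(1 + n))
    (Q := fun (s : 'M[R]_n) (m : 'cV[R]_n) (r : R) =>
            block_mx r%:M m^T m s : 'M[R]_(1 + n)) :
  D != 0 -> K \in unitmx -> c = D *: (k - K^T *m k') ->
  (S k')^T *m Q (D^-1 ^+ 2 *: (K *m s *m K^T)) (D^-1 ^+ 2 *: (K *m m)) (D^-1 ^+ 2 * r) *m S k'
  = (invmx J)^T *m ((S k)^T *m Q s m r *m S k) *m invmx J.
Proof.
move=> D0 uK hc; have uJ : J \in unitmx by exact: jet_unit.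
pose E : 'M[R]_(1 + n) := block_mx D%:M 0 0 (D *: (invmx K)^T).
have SJ : S k' *m J = E *m S k.
  rewrite /S /J /E !mulmx_block !mul1mx !mulmx1 !mul0mx !mulmx0 !addr0 !add0r.
  congr block_mx; rewrite hc mul_mx_scalar -scalemxAr mulmxBr mulmxA -trmx_mul.
  by rewrite mulmxV // trmx1 mul1mx -scalerDr addrC subrK scalemxAl.
set T' := Q _ _ _; have EQ : E^T *m T' *m E = Q s m r.
  rewrite /E /T' /Q tr_block_mx !mulmx_block !trmx0.
  rewrite !mul0mx !mulmx0 !addr0 !add0r tr_scalar_mx [(D *: _)^T]linearZ /= trmxK.
  rewrite [(_ *: (K *m m))^T]linearZ /= trmx_mul.
  congr block_mx.
  - by rewrite -!scalar_mxM; congr (_%:M); field.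
  - rewrite mul_scalar_mx -!scalemxAl -!scalemxAr !scalerA -mulmxA -trmx_mul mulVmx //.
    by rewrite trmx1 mulmx1 -[RHS]scale1r; congr (_ *: _); field.
  - rewrite mul_mx_scalar -!scalemxAl -!scalemxAr !scalerA mulKmx //.
    by rewrite -[RHS]scale1r; congr (_ *: _); field.
  - rewrite -!scalemxAl -!scalemxAr -!scalemxAl !scalerA !mulmxA mulVmx // mul1mx.
    rewrite -mulmxA -trmx_mul mulVmx // trmx1 mulmx1 -[RHS]scale1r; congr (_ *: _).
    by field.
have -> : (S k)^T *m Q s m r *m S k = J^T *m ((S k')^T *m T' *m S k') *m J.
  rewrite -EQ !mulmxA -trmx_mul -SJ -(mulmxA _ E) -SJ trmx_mul !mulmxA.
  by [].
move: ((S k')^T *m _ *m _) => X.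
by rewrite !mulmxA -trmx_mul mulmxV // trmx1 mul1mx -mulmxA mulmxV // mulmx1.
Qed.

End JetAlgebra.

Section BlockSmooth.
Variables (R : realType) (n k l k' l' : nat) (U : set 'rV[R]_n).

Lemma mxsmooth_block (P : 'rV[R]_n -> 'M[R]_(k, l)) (Q : 'rV[R]_n -> 'M[R]_(k, l'))
    (S : 'rV[R]_n -> 'M[R]_(k', l)) (T : 'rV[R]_n -> 'M[R]_(k', l')) : open U ->
  mxsmooth U P -> mxsmooth U Q -> mxsmooth U S -> mxsmooth U T ->
  mxsmooth U (fun p => block_mx (P p) (Q p) (S p) (T p)).
Proof.
move=> oU sP sQ sS sT i j; case: (split_ordP i) => a ->; case: (split_ordP j) => b ->.
- by apply: smooth_on_ext (sP a b) => // q _; rewrite block_mxEul.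
- by apply: smooth_on_ext (sQ a b) => // q _; rewrite block_mxEur.
- by apply: smooth_on_ext (sS a b) => // q _; rewrite block_mxEdl.
- by apply: smooth_on_ext (sT a b) => // q _; rewrite block_mxEdr.
Qed.

End BlockSmooth.

(** * Global sections *)

Section Correspondence.
Variables (R : realType) (n : nat) (n_ge2 : (2 <= n)%N) (M : manifold R n).
Variables (g : field M n n) (B : M -> R).
Hypotheses (g_metric : is_metric g) (nullity_ae : weyl_nullity_ae g)
  (B_smooth : smooth_function B) (B_g : is_nullity_function g B).
Implicit Types (i j : chart M) (p : 'rV[R]_n).

Let oC i : open (cod i) := @cod_open _ _ M i.
Let gsm i : mxsmooth (cod i) (g i).
Proof. exact: metric_smooth. Qed.
Let gsym i p : cod i p -> (g i p)^T = g i p.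
Proof. by move=> _; exact: metric_sym. Qed.
Let gunit i p : cod i p -> g i p \in unitmx.
Proof. exact: metric_unit. Qed.

Lemma nullity_kernel i p : cod i p -> weyl_nullity g (param i p) ->
  exists2 v : 'cV[R]_n, v != 0 &
    forall a b, zcurv (g i) (B \o param i) a b p *m v = 0.
Proof.
move=> cp [j [dj [v nv]]]; have Wp : overlap i j p by split.
have uK := jac_unit Wp; have cj := overlap_cod Wp; have v0 := nv.1.
have z := zcurv_null (B := B \o param j) (@oC j) (@gsm j) (@gsym j) (@gunit j) cj nv (B_g cj nv).
exists (invmx (jac i j p) *m v); last exact: (zcurv_transport g_metric Wp z).
by apply: contra_neq v0 => e; rewrite -(mulKVmx uK v) e mulmx0.
Qed.

Lemma nullity_dense i : exists2 N : set 'rV[R]_n, N `<=` cod i &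
  (forall V : set 'rV[R]_n, open V -> V `<=` cod i -> V !=set0 ->
     exists2 p, V p & N p) /\
  (forall p, N p -> exists2 v : 'cV[R]_n, v != 0 &
     forall a b, zcurv (g i) (B \o param i) a b p *m v = 0).
Proof.
have [W [oW dW sW]] := nullity_ae.
exists [set p | cod i p /\ W (param i p)]; first by move=> p [].
split=> [V oV sV [p Op]|p [cp Wp]]; last by apply: nullity_kernel => //; exact: sW.
pose V' := [set x | dom i x /\ V (Defs.coord i x)].
have oV1 : open V'.
  rewrite openE => x [dx Ox]; rewrite /interior.
  have h1 : nbhs x (dom i) by apply: open_nbhs_nbhs; split=> //; exact: dom_open.
  have h2 : nbhs x (Defs.coord i @^-1` V).
    by apply: (Defs.coord_continuous dx); exact: open_nbhs_nbhs.
  exact: filterS (filterI h1 h2).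
have [|x [[dx Ox] Wx]] := dW V' _ oV1.
  exists (param i p); split; first exact/param_dom/sV.
  by rewrite paramK //; exact: sV.
by exists (Defs.coord i x) => //; split; [exact: sV|rewrite coordK].
Qed.

Lemma B_chart_smooth i : smooth_on (cod i) (B \o param i).
Proof. exact: B_smooth. Qed.

Lemma jet_transE i j p : overlap i j p ->
  [/\ dens 1 i j p != 0, jac i j p \in unitmx & jet_trans i j p \in unitmx].
Proof.
move=> Wp; have D0 : dens 1 i j p != 0 by rewrite gt_eqF // dens_gt0.
by have uK := jac_unit Wp; split=> //; exact: jet_unit.
Qed.

Section FromSystem.
Variable t : field M (1 + n) (1 + n).
Hypotheses (tS : is_S2T t) (tsys : prolonged_system g B t).

Lemma first_componentE i p : first_component g t i p = drsubmx (t i p).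
Proof. exact: sigma_partE. Qed.

Lemma first_component_section : is_S2TM_m2 (first_component g t).
Proof.
have [[t0 tsm ttr] tsy] := tS; split; last first.
  by move=> i p; rewrite first_componentE trmx_drsub tsy.
split=> [i p ncp|i a b|i j p Wp].
- by rewrite first_componentE t0 // -block_mx0 block_mxKdr.
- apply: smooth_on_ext (tsm i (rshift 1 a) (rshift 1 b)) => // q _.
  by rewrite first_componentE !mxE.
rewrite !first_componentE; have [D0 uK uJ] := jet_transE Wp.
rewrite dens_m2; apply: (jet_drsubmx (x := (invmx (jac i j p))^T *m
  \col_a pd (dens 1 i j) a p)) => //.
rewrite (ttr _ _ _ Wp) -[block_mx _ _ _ _]/(jet_trans i j p).
by rewrite !mulmxA -trmx_mul mulVmx // trmx1 mul1mx -mulmxA mulVmx // mulmx1.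
Qed.

Lemma first_component_metrisability : metrisability g (first_component g t).
Proof.
move=> i p cp a b c.
exact: (system_metrisability (fun q cq => tsys cq) a b c cp).
Qed.

(** A solution of the system is a function of its first component, which is the source of
    injectivity. *)
Lemma prolonged_assemble i p : cod i p ->
  t i p = assemble (g i) p (first_component g t i p)
    (mu_of (g i) (first_component g t i) p)
    (rho_of (g i) (B \o param i) (first_component g t i) p).
Proof.
move=> cp; have [_ tsy] := tS.
rewrite -(system_mu (fun q cq => tsys cq) cp).
rewrite -(system_rho n_ge2 (@oC i) (@gsym i) (fun q cq => tsys cq) cp).
exact: assemble_split.
Qed.

End FromSystem.

Section FromSolution.
Variable s : field M n n.
Hypotheses (s_section : is_S2TM_m2 s) (s_metris : metrisability g s).

Lemma solution_second i p a : cod i p ->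
  tf_cov (g i) (B \o param i) (s i) a p
  = - (rho_of (g i) (B \o param i) (s i) p *: (delta_mx a 0 : 'cV[R]_n)).
Proof.
move=> cp; have [N NU [dN nulN]] := nullity_dense i.
have h1 : mxsmooth (cod i) (s i) := s_smooth s_section (i := i).
have := second_equation n_ge2 (@oC i) (@gsm i) (@gsym i) (@gunit i) (@B_chart_smooth i)
  h1 (fun q _ => s_sym s_section i q) (fun q cq => s_metris cq) NU dN nulN.
by apply.
Qed.

Lemma solution_system i p : cod i p ->
  system_at (g i) (B \o param i) (s i) (mu_of (g i) (s i))
    (rho_of (g i) (B \o param i) (s i)) p.
Proof.
move=> cp; have [N NU [dN nulN]] := nullity_dense i.
have h1 : mxsmooth (cod i) (s i) := s_smooth s_section (i := i).
have := system_of_solution n_ge2 (@oC i) (@gsm i) (@gsym i) (@gunit i) (@B_chart_smooth i)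
  h1 (fun q _ => s_sym s_section i q) (fun q cq => s_metris cq) NU dN nulN.
by apply.
Qed.

(** The value 0 off [cod i] is the one that [is_section] prescribes. *)
Definition prolongation : field M (1 + n) (1 + n) := fun i p =>
  if `[< cod i p >] then
    assemble (g i) p (s i p) (mu_of (g i) (s i) p) (rho_of (g i) (B \o param i) (s i) p)
  else 0.

Lemma prolongationE i p : cod i p -> prolongation i p =
  assemble (g i) p (s i p) (mu_of (g i) (s i) p) (rho_of (g i) (B \o param i) (s i) p).
Proof. by rewrite /prolongation; case: asboolP. Qed.

Lemma prolongation_off i p : ~ cod i p -> prolongation i p = 0.
Proof. by rewrite /prolongation; case: asboolP. Qed.

Lemma prolongation_sym : symmetric_field prolongation.
Proof.
move=> i p; rewrite /prolongation; case: asboolP => _; last exact: trmx0.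
rewrite /assemble; set Q := block_mx _ _ _ _; set S := scale_mx _ _.
have Qs : Q^T = Q by rewrite /Q tr_block_mx tr_scalar_mx trmxK (s_sym s_section).
by rewrite trmx_mul trmx_mul trmxK Qs mulmxA.
Qed.

Lemma prolongation_smooth i : mxsmooth (cod i) (prolongation i).
Proof.
have sm := s_mu_smooth g_metric s_section (i := i).
have ss := s_smooth s_section (i := i).
have sr : smooth_on (cod i) (rho_of (g i) (B \o param i) (s i)).
  exact: (rho_of_smooth (@oC i) (@gsm i) (@gunit i) (@B_chart_smooth i) ss).
have sk : mxsmooth (cod i) (kap_vec (g i)).
  move=> a b; rewrite (ord1 b).
  apply: smooth_on_ext (kap_smooth (@oC i) (@gsm i) (@gunit i) a) => // q _.
  by rewrite kap_vecE.
have srM : mxsmooth (cod i) (fun p => (rho_of (g i) (B \o param i) (s i) p)%:M : 'M[R]_1).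
  by move=> a b; apply: smooth_on_ext sr => // q _; rewrite mxE (ord1 a) (ord1 b).
have smt := mxsmooth_tr (@oC i) sm; have skt := mxsmooth_tr (@oC i) sk.
have skm := mxsmoothM (@oC i) skt sm; have sks := mxsmoothM (@oC i) skt ss.
have sx := mxsmoothD (@oC i) smt sks.
apply: mxsmooth_ext (@oC i) _ (mxsmooth_block (@oC i)
  (mxsmoothD (@oC i) (mxsmoothD (@oC i) srM skm) (mxsmoothM (@oC i) sx sk)) sx
  (mxsmoothD (@oC i) sm (mxsmoothM (@oC i) ss sk)) ss) => q cq.
by rewrite prolongationE // assembleE.
Qed.

Lemma prolongation_trans i j p : overlap i j p -> prolongation j (trans i j p)
  = (invmx (jet_trans i j p))^T *m prolongation i p *m invmx (jet_trans i j p).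
Proof.
move=> Wp; have cp : cod i p by case: Wp.
have [D0 uK _] := jet_transE Wp.
rewrite !prolongationE //; last exact: overlap_cod.
rewrite (s_trans s_section Wp) (mu_transform g_metric n_ge2 s_section s_metris Wp).
rewrite (rho_transform g_metric n_ge2 s_section s_metris solution_second Wp).
rewrite dens_m2 /assemble !scale_mxE /jet_trans; apply: jet_assemble => //.
(* What remains is the condition on c in [jet_assemble], with c the gradient of [dens 1]; it is the
   law of [kap]. *)
apply/colP => a; rewrite mxE (pd_dens 1 a Wp).2 [RHS]mxE [in RHS]mxE mulrC.
rewrite kap_vecE (kap_transform g_metric a Wp) -addrA.
set x := (- _ : 'cV[R]_n) a 0; have -> : x = - \sum_d jac i j p d a * kap (g j) d (trans i j p).
  by rewrite /x mxE [in LHS]mxE; congr (- _); apply: eq_bigr => d _; rewrite mxE kap_vecE.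
by rewrite subrr addr0 div1r.
Qed.

Lemma prolongation_section : is_S2T prolongation.
Proof.
split; last exact: prolongation_sym.
split=> [i p|i a b|i j p]; first exact: prolongation_off.
  exact: prolongation_smooth.
exact: prolongation_trans.
Qed.

Lemma prolongation_first : first_component g prolongation = s.
Proof.
apply/funext => i; apply/funext => p; rewrite first_componentE.
case: (asboolP (cod i p)) => cp.
  by rewrite prolongationE // assembleE block_mxKdr.
by rewrite prolongation_off // -block_mx0 block_mxKdr; case: s_section => -[s0 _ _] _; rewrite s0.
Qed.

Lemma prolongation_system : prolonged_system g B prolongation.
Proof.
move=> i p cp; have sp q (cq : cod i q) := split_assemble (prolongationE cq).
apply: (system_at_ext (@oC i) cp) (solution_system cp) => q cq.
- by rewrite /sigma_part sp // block_mxKdr.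
- by rewrite /mu_part sp // block_mxKdl.
- by rewrite /rho_part sp // block_mxKul mxE eqxx mulr1n.
Qed.

End FromSolution.

End Correspondence.

Theorem theorem4p20 (R : realType) (n : nat) (n_ge2 : (2 <= n)%N)
    (M : manifold R n) (m : set (field M n n))
    (m_proj : metric_projective_structure m)
    (g : field M n n) (g_in_m : m g)
    (nullity_ae : weyl_nullity_ae g)
    (B : M -> R) (B_smooth : smooth_function B)
    (B_g : is_nullity_function g B) :
  set_bij [set t : field M (1 + n) (1 + n) | is_S2T t /\ prolonged_system g B t]
          [set s : field M n n | is_S2TM_m2 s /\ metrisability g s]
          (first_component g).
Proof.
have g_metric : is_metric g.
  by have [g0 _ e] := m_proj; move: g_in_m; rewrite e => -[].
split.
- move=> t [tS tsys]; split; first exact: first_component_section.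
  exact: first_component_metrisability tsys.
- move=> t t' /set_mem[tS tsys] /set_mem[tS' tsys'] e.
  apply/funext => i; apply/funext => p.
  case: (asboolP (cod i p)) => cp.
    rewrite (prolonged_assemble n_ge2 g_metric tS tsys cp).
    by rewrite (prolonged_assemble n_ge2 g_metric tS' tsys' cp) e.
  (* Off the image of the chart both sections vanish by convention, so they are equal as
     functions. *)
  by case: tS tS' => -[t0 _ _] _ [[t0' _ _] _]; rewrite t0 // t0'.
- move=> s [s_section s_metris].
  exists (prolongation g B s); last exact: prolongation_first.
  split; first exact: prolongation_section.
  exact: prolongation_system.
Qed.
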